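(* Let $\rho\in\mathcal P([0,\infty))$ be absolutely continuous with respect to Lebesgue measure, let $s_1<s_2$ be such that $\rho([0,s_1))=\rho([s_1,s_2))=\rho([s_2,\infty))=\tfrac13$, and let $T$ be the DDI map of $\rho$. Assume that \[ r_2(r_3-r_1)^3 - r_1(r_3+r_2)^3 - r_3(r_1+r_2)^3 \ \ge\ 0 \] for $(\rho\otimes\rho\otimes\rho)$-a.e. $(r_1,r_2,r_3)\in[0,s_1]\times[s_1,s_2]\times[s_2,\infty)$. Then $\gamma=(\mathrm{Id},T,T^2)_\sharp\rho$ is an optimal solution of the radial problem, i.e. $\gamma\in\Pi_3(\rho)$ and \[\int c\,d\gamma=\min_{\gamma'\in\Pi_3(\rho)}\int_{[0,\infty)^3} c\,d\gamma'.\]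
   Context: For $r_1,r_2,r_3\ge 0$ and $(\alpha,\beta)\in\mathbb T^2=(\mathbb R/2\pi\mathbb Z)^2$ let \[C(r_1,r_2,r_3,\alpha,\beta)=\frac{1}{\sqrt{r_1^2+r_2^2-2r_1r_2\cos\alpha}}+\frac{1}{\sqrt{r_1^2+r_3^2-2r_1r_3\cos\beta}}+\frac{1}{\sqrt{r_2^2+r_3^2-2r_2r_3\cos(\alpha-\beta)}}\] (value $+\infty$ if a denominator vanishes); this is the Coulomb cost $\sum_{i<j}|v_i-v_j|^{-1}$ of $v_1=(r_1,0)$, $v_2=r_2(\cos\alpha,\sin\alpha)$, $v_3=r_3(\cos\beta,\sin\beta)$ in $\mathbb R^2$. The radial cost is $c(r_1,r_2,r_3)=\min_{(\alpha,\beta)\in\mathbb T^2}C(r_1,r_2,r_3,\alpha,\beta)$. For $\rho\in\mathcal P([0,\infty))$, $\Pi_3(\rho)$ is the set of Borel probability measures on $[0,\infty)^3$ all three of whose marginals equal $\rho$; the radial problem is minimizing $\int c\,d\gamma$ over $\gamma\in\Pi_3(\rho)$. With $F(r)=\rho([0,r))$ and $F^{-1}$ its generalized inverse, the DDI map is the map $T:[0,\infty)\to[0,\infty)$ with $T(x)=F^{-1}(\tfrac23-F(x))$ for $x\in[0,s_1)$, $T(x)=F^{-1}(\tfrac43-F(x))$ for $x\in[s_1,s_2)$, and $T(x)=F^{-1}(F(x)-\tfrac23)$ for $x\in[s_2,\infty)$; it maps $[0,s_1)$ onto $[s_1,s_2)$ decreasingly, $[s_1,s_2)$ onto $[s_2,\infty)$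 decreasingly and $[s_2,\infty)$ onto $[0,s_1)$ increasingly, preserves $\rho$, and $T^3=\mathrm{Id}$ $\rho$-a.e. *)

(* Defs.v *)
From HB Require Import structures.
From mathcomp Require Import all_boot all_order all_algebra.
From mathcomp Require Import all_classical all_reals all_analysis.
Set Implicit Arguments. Unset Strict Implicit. Unset Printing Implicit Defensive.
Import Order.TTheory GRing.Theory Num.Theory.
Import numFieldNormedType.Exports.
Local Open Scope classical_set_scope.
Local Open Scope ring_scope.

Section Defs.
Variable R : realType.
Notation RR := (measurableTypeR R).

Definition R3 := (RR * RR * RR)%type.

(* squared distance |v_i - v_j|^2 between r (cos a, sin a) and s (cos b, sin b),
   with angle difference t *)
Definition sqd (r s t : R) : R := r ^+ 2 + s ^+ 2 - 2 * r * s * cos t.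

Definition invsq (d : R) : \bar R :=
  if d == 0 then +oo%E else ((Num.sqrt d)^-1)%:E.

Definition Ccost (r1 r2 r3 alpha beta : R) : \bar R :=
  (invsq (sqd r1 r2 alpha) + invsq (sqd r1 r3 beta)
   + invsq (sqd r2 r3 (alpha - beta)))%E.

(* radial cost: min over the torus (the torus is the quotient of R^2 by
   2pi Z^2 and C is 2pi-periodic; the minimum is attained, so it equals
   the infimum over R^2) *)
Definition ccost (r1 r2 r3 : R) : \bar R :=
  ereal_inf [set Ccost r1 r2 r3 ab.1 ab.2 | ab in [set: R * R]].

Definition ccost3 (x : R3) : \bar R := ccost x.1.1 x.1.2 x.2.

Definition Q3 : set R3 :=
  [set x | 0 <= x.1.1 /\ 0 <= x.1.2 /\ 0 <= x.2].

Definition Pi3 (rho : set RR -> \bar R) (g : set R3 -> \bar R) : Prop :=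
  (exists P : probability R3 R, forall A, P A = g A) /\
  forall A : set RR, measurable A ->
    [/\ g ((fun x : R3 => x.1.1) @^-1` A) = rho A,
        g ((fun x : R3 => x.1.2) @^-1` A) = rho A &
        g ((fun x : R3 => x.2) @^-1` A) = rho A].

Definition cdf (rho : set RR -> \bar R) (r : R) : R := fine (rho `[0, r[%classic).

Definition cdf_inv (rho : set RR -> \bar R) (t : R) : R :=
  inf [set x : R | 0 <= x /\ t <= cdf rho x].

Definition DDI (rho : set RR -> \bar R) (s1 s2 : R) (x : R) : R :=
  if x < s1 then cdf_inv rho (2 / 3 - cdf rho x)
  else if x < s2 then cdf_inv rho (4 / 3 - cdf rho x)
  else cdf_inv rho (cdf rho x - 2 / 3).

Definition ddi_plan (rho : set RR -> \bar R) (s1 s2 : R) : set R3 -> \bar R :=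
  fun A => rho ((fun x : RR =>
     ((x, DDI rho s1 s2 x), DDI rho s1 s2 (DDI rho s1 s2 x)) : R3) @^-1` A).

Definition poly3 (r1 r2 r3 : R) : R :=
  r2 * (r3 - r1) ^+ 3 - r1 * (r3 + r2) ^+ 3 - r3 * (r1 + r2) ^+ 3.

End Defs.

(* Main.v *)
(* The condition 0 <= poly3 says exactly that the collinear configuration
   (alpha, beta) = (pi, 0) minimises the angular energy: replacing s^(-1/2) by
   its tangents turns the energy gap into a quadratic form in (1 + e^(i alpha),
   1 + e^(i (alpha - beta))) whose positivity is poly3 >= 0.  Hence on good
   triples (one radius in each third of rho) c is the one-dimensional Coulomb
   cost of the points -r2 < r1 < r3, and DDI is the comonotone coupling of these
   three points, which is optimal for each pair separately.

   Optimality among all plans is certified by a dual potential U with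
   U r1 + U r2 + U r3 <= c r1 r2 r3 everywhere on the support and equality on
   the graph of DDI.  On each third U is a sum of two pair potentials; the two
   remaining free constants are fixed by prescribing the jump of U across the
   gap (a, b) between the first and second third and across the gap (B, d)
   between the second and third one.  The stability condition at (a, b, d) and
   (a, B, d) bounds these gaps from below, and this is what makes the dual
   inequality hold for triples that do not meet each third once: a sorted triple
   is compared with a good one by moving each radius to the third of its rank. *)
Require Import Defs.
From HB Require Import structures.
From mathcomp Require Import all_boot all_order all_algebra.
From mathcomp Require Import all_classical all_reals all_analysis.
From mathcomp Require Import measurable_realfun ring lra.
Set Implicit Arguments. Unset Strict Implicit. Unset Printing Implicit Defensive.
Import Order.TTheory GRing.Theory Num.Theory.
Import numFieldNormedType.Exports.
Local Open Scope classical_set_scope.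
Local Open Scope ring_scope.

(** * Rational inequalities *)

(** A triple has type ijk when its sorted radii lie in the thirds i, j, k. The jump [U1 a - U2 b] is
    under two-sided pressure: two low radii want it at most 1/(2a) - 1/(a+b), two middle ones at
    least 1/(a+b) - 1/(2b). The choice (1/a - 1/b)/4 is the midpoint, and leaves on both sides the
    slack (1/a + 1/b)/4 - 1/(a+b) that pays for the errors. The jump [U2 B - U3 d] is the increment
    over the gap of 1/r + 1/(r+d), the steepest decrease that the pair potentials permit in the
    middle third; trading a middle radius y for d then costs 1/y + 1/(y+d) - 3/(2d), whence the
    recurring 3/2.

    Most types are settled with the crude bound that gives every pair its largest distance r + s.
    The types 122, 133 and 222 use more: three points cannot be pairwise opposite, and this
    frustration raises c by 2m - m^2/(2n), where m bounds the weights rs/(r+s)^3 of the two pairs at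
    the smallest radius from below and n that of the remaining pair. *)

Section RationalInequalities.
Variable R : realFieldType.
Implicit Types (a b B d x y z r s u v h : R).

(** [poly3] with its factor [y + z] divided out (see [poly3_collinear]). The right side minus the
    left one is a concave quadratic in [y] for positive [x] and [z]. *)
Definition collinear_stable x y z :=
  x * (z ^+ 2 + 5 * y * z + y ^+ 2) + x ^+ 3 <= y * z * (z - y).

(** Convexity of 1/u. Most comparisons of sums of inverse distances below are instances of it, with
    base points of the form [r + s]. *)
Lemma ler_invB u v h : 0 < u -> u <= v -> 0 <= h ->
  v^-1 - (v + h)^-1 <= u^-1 - (u + h)^-1.
Proof.
move=> u0 uv h0.
have -> : v^-1 - (v + h)^-1 = h / (v * (v + h)) by field; apply/andP; split; lra.
have -> : u^-1 - (u + h)^-1 = h / (u * (u + h)) by field; apply/andP; split; lra.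
rewrite ler_wpM2l// lef_pV2 ?posrE ?mulr_gt0//; try lra.
by apply: ler_pM; lra.
Qed.

Lemma ler_pinv u v : 0 < u -> u <= v -> v^-1 <= u^-1.
Proof. by move=> u0 uv; rewrite lef_pV2 ?posrE//; lra. Qed.

(** The 7 comes from d^2 + 5yd + y^2 = (d - y)^2 + 7yd; dividing the stability condition by yd
    leaves the gap. *)
Lemma stable_gap a d y : 0 < a -> 0 < d ->
  0 < y -> y <= d -> collinear_stable a y d -> 7 * a <= d - y.
Proof.
rewrite /collinear_stable => a0 d0 y0 yd K.
have yd0 : 0 < y * d by rewrite mulr_gt0.
rewrite -(ler_pM2l yd0).
have : 0 <= a * (d - y) ^+ 2 by rewrite mulr_ge0 ?sqr_ge0// ltW.
have : 0 < a ^+ 3 by rewrite exprn_gt0.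
nra.
Qed.

(** Stability without the positive terms a y^2 and a^3, divided by d. This weaker form is linear in
    [a] and [d]. *)
Lemma stable_slope a d y : 0 < a -> 0 < d ->
  0 < y -> collinear_stable a y d ->
  y * (y + 5 * a) <= d * (y - a).
Proof.
rewrite /collinear_stable => a0 d0 y0 K.
rewrite -(ler_pM2l d0).
have : 0 < a ^+ 3 by rewrite exprn_gt0.
have : 0 < a * y ^+ 2 by rewrite mulr_gt0// exprn_gt0.
nra.
Qed.

Lemma stable_lt a d y : 0 < a -> 0 < d ->
  0 < y -> collinear_stable a y d -> a < y.
Proof.
move=> a0 d0 y0 K; have := stable_slope a0 d0 y0 K => K'.
have : 0 < d * (y - a) by apply: lt_le_trans _ K'; rewrite mulr_gt0//; lra.
by rewrite pmulr_rgt0//; lra.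
Qed.

Lemma stable_inv_gap a d y : 0 < a -> 0 < d ->
  0 < y -> collinear_stable a y d ->
  6 * d^-1 <= a^-1 - y^-1.
Proof.
move=> a0 d0 y0 K; have K' := stable_slope a0 d0 y0 K; have ay := stable_lt a0 d0 y0 K.
have -> : a^-1 - y^-1 = (y - a) / (a * y) by field; rewrite !gt_eqF.
rewrite ler_pdivlMr ?mulr_gt0// mulrAC ler_pdivrMr//.
nra.
Qed.

(** A lower bound on the slack left by the midpoint jump. After squaring [stable_slope] what remains
    is (y + 5a)^2 - 16a(a + y) = (y - 3a)^2. *)
Lemma stable_theta a d y : 0 < a -> 0 < d ->
  0 < y -> collinear_stable a y d ->
  4 * y / d ^+ 2 <= (a^-1 + y^-1) / 4 - (a + y)^-1.
Proof.
move=> a0 d0 y0 K; have K' := stable_slope a0 d0 y0 K; have ay := stable_lt a0 d0 y0 K.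
have -> : (a^-1 + y^-1) / 4 - (a + y)^-1 = (y - a) ^+ 2 / (4 * a * y * (a + y)).
  by field; rewrite ?gt_eqF//; lra.
rewrite ler_pdivrMr ?exprn_gt0// mulrAC ler_pdivlMr; last first.
  by rewrite !mulr_gt0//; lra.
rewrite -exprMn.
have e0 : 0 <= y * (y + 5 * a) by rewrite mulr_ge0//; lra.
have : (y * (y + 5 * a)) ^+ 2 <= (d * (y - a)) ^+ 2.
  by rewrite ler_pXn2r// nnegrE; lra.
rewrite [(y - a) * d]mulrC; apply: le_trans.
have : 0 <= y ^+ 2 * (y - 3 * a) ^+ 2 by rewrite mulr_ge0 ?sqr_ge0.
nra.
Qed.

Lemma ler_inv_sub a d : 0 < a -> 0 < d ->
  7 * a <= d -> (d - a)^-1 <= 7 / 6 * d^-1.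
Proof.
move=> a0 d0 h; rewrite -[X in X <= _]mul1r ler_pdivrMr; last by lra.
by rewrite mulrAC ler_pdivlMr//; lra.
Qed.

Lemma ler_inv_sub_gap a d Y : 0 < a -> 0 < d ->
  0 < Y -> 7 * a <= d - Y ->
  (d - a)^-1 <= d^-1 + (d - Y) / 6 / d ^+ 2.
Proof.
move=> a0 d0 Y0 h; have da : 0 < d - a by lra.
have -> : d^-1 + (d - Y) / 6 / d ^+ 2 = (7 * d - Y) / (6 * d ^+ 2).
  by field; rewrite gt_eqF.
rewrite -[X in X <= _]mul1r ler_pdivrMr// mulrAC ler_pdivlMr; last first.
  by rewrite mulr_gt0 ?exprn_gt0.
nra.
Qed.

(** Stability at two corners spreads to the whole box. In [y] the concave quadratic lies above its
    chord over [b, B], [h3] being the excess; in [z] the increment has the factor [z - d] with a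
    cofactor signed by [stable_slope]; in [x] the left side is increasing. *)
Lemma stable_mono a b B d x y z : 0 < a -> 0 < b -> 0 < d ->
  collinear_stable a b d -> collinear_stable a B d ->
  0 <= x <= a -> b <= y <= B -> d <= z -> collinear_stable x y z.
Proof.
move=> a0 b0 d0 K1 K2 /andP[x0 xa] /andP[by_ yB] dz.
have y0 : 0 < y by lra.
have Ky : collinear_stable a y d.
  have [bB|Bb] := ltP b B; last by have -> : y = b by lra.
  move: K1 K2; rewrite /collinear_stable -subr_ge0 => K1; rewrite -subr_ge0 => K2.
  rewrite -subr_ge0 -(pmulr_rge0 _ (_ : 0 < B - b)); last by lra.
  have h1 : 0 <= (B - y) * (b * d * (d - b) - (a * (d ^+ 2 + 5 * b * d + b ^+ 2) + a ^+ 3)).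
    by rewrite mulr_ge0//; lra.
  have h2 : 0 <= (y - b) * (B * d * (d - B) - (a * (d ^+ 2 + 5 * B * d + B ^+ 2) + a ^+ 3)).
    by rewrite mulr_ge0//; lra.
  have h3 : 0 <= (d + a) * ((y - b) * (B - y) * (B - b)).
    by rewrite mulr_ge0//; [lra | rewrite !mulr_ge0//; lra].
  apply: le_trans (addr_ge0 (addr_ge0 h1 h2) h3) _.
  by rewrite le_eqVlt; apply/orP; left; apply/eqP; ring.
have sl := stable_slope a0 d0 y0 Ky.
have ay := stable_lt a0 d0 y0 Ky.
have Kz : collinear_stable a y z.
  move: Ky; rewrite /collinear_stable -subr_ge0 => Ky; rewrite -subr_ge0.
  have h : 0 <= (z - d) * ((y - a) * (z + d) - y ^+ 2 - 5 * a * y).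
    by rewrite mulr_ge0//; [lra | nra].
  apply: le_trans (addr_ge0 Ky h) _.
  by rewrite le_eqVlt; apply/orP; left; apply/eqP; ring.
apply: le_trans Kz; apply: lerD.
  by rewrite ler_wpM2r// !addr_ge0 ?sqr_ge0// !mulr_ge0//; lra.
by rewrite ler_pXn2r// nnegrE; lra.
Qed.

(** The left side is the value at x = x' = a. Moving x' to a and then x to a decreases the
    expression each time, by convexity. *)
Lemma pair_low a b x x' : 0 < x <= a -> 0 < x' <= a -> a <= b ->
  (2 * a)^-1 - 2 * (a + b)^-1 <= (x + x')^-1 - (x + b)^-1 - (x' + b)^-1.
Proof.
move=> /andP[x0 xa] /andP[x'0 x'a] ab.
have h1 := @ler_invB (x + x') (x + a) (b - x) ltac:(lra) ltac:(lra) ltac:(lra).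
have h2 := @ler_invB (x + a) (2 * a) (b - a) ltac:(lra) ltac:(lra) ltac:(lra).
have e1 : x + x' + (b - x) = x' + b by ring.
have e2 : x + a + (b - x) = a + b by ring.
have e3 : x + a + (b - a) = x + b by ring.
have e4 : 2 * a + (b - a) = a + b by ring.
rewrite e1 e2 in h1; rewrite e3 e4 in h2; lra.
Qed.

(** Convexity reduces y' to y. Replacing the jump at b by the one at y then costs (1/b - 1/y)/4,
    which is paid by the decrease of 1/(a + r) from b to y. The left side is the slack bounded in
    [stable_theta]. *)
Lemma pair_high a b y y' : 0 < a -> a <= b -> b <= y -> y <= y' ->
  (a^-1 + y^-1) / 4 - (a + y)^-1 <=
  (y + y')^-1 - (a + y)^-1 - (a + y')^-1 + (a + b)^-1 + (a^-1 - b^-1) / 4.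
Proof.
move=> a0 ab by_ yy'.
have h1 := @ler_invB (a + y) (a + y') (y - a) ltac:(lra) ltac:(lra) ltac:(lra).
have e1 : a + y + (y - a) = 2 * y by ring.
have e2 : a + y' + (y - a) = y + y' by ring.
rewrite e1 e2 in h1.
have h2 := @ler_invB (a + b) (b + b) (y - b) ltac:(lra) ltac:(lra) ltac:(lra).
have e3 : a + b + (y - b) = a + y by ring.
have e4 : b + b + (y - b) = b + y by ring.
rewrite e3 e4 in h2.
have h3 : (b^-1 - y^-1) / 4 <= (b + b)^-1 - (b + y)^-1.
  rewrite -subr_ge0.
  have -> : (b + b)^-1 - (b + y)^-1 - (b^-1 - y^-1) / 4 = (y - b) ^+ 2 / (4 * b * y * (b + y)).
    by field; rewrite ?gt_eqF//; lra.
  by rewrite divr_ge0 ?sqr_ge0// !mulr_ge0//; lra.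
have e5 : (2 * y)^-1 = y^-1 / 2 by field; rewrite gt_eqF//; lra.
rewrite e5 in h1; lra.
Qed.

Lemma stable_pair_far a d y : 0 < a -> 0 < d -> 0 < y -> y <= d ->
  collinear_stable a y d ->
  (d - a)^-1 + (d + a)^-1 + (y + d)^-1 - 3 / 2 * d^-1 <= 2 * (a + y)^-1 - y^-1.
Proof.
move=> a0 d0 y0 yd K.
have gap := stable_gap a0 d0 y0 yd K.
have ay := stable_lt a0 d0 y0 K.
(* (y - a)/(y(a + y)) decreases in a; (6d + y)/N is its value at the largest a that stability allows
   once a^3 is dropped, namely a = yd(d - y)/(d^2 + 5yd + y^2). *)
set N := 2 * d ^+ 2 + 4 * d * y + y ^+ 2.
have N0 : 0 < N by rewrite /N; nra.
have h1 : (6 * d + y) / N <= 2 * (a + y)^-1 - y^-1.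
  have -> : 2 * (a + y)^-1 - y^-1 = (y - a) / (y * (a + y)).
    by field; rewrite ?gt_eqF//; lra.
  rewrite ler_pdivrMr// mulrAC ler_pdivlMr ?mulr_gt0//; last by lra.
  have a30 : 0 < a ^+ 3 by rewrite exprn_gt0.
  move: K; rewrite /collinear_stable /N; nra.
have h2 : (d - y) / (4 * d ^+ 2) + (y + d)^-1 + d^-1 / 2 <= (6 * d + y) / N.
  rewrite -subr_ge0.
  have -> : (6 * d + y) / N - ((d - y) / (4 * d ^+ 2) + (y + d)^-1 + d^-1 / 2) =
     (d - y) * (20 * d ^+ 3 + 12 * d ^+ 2 * y - 6 * d * y ^+ 2 - 2 * y ^+ 3) /
     (8 * d ^+ 2 * (d + y) * N).
    by rewrite /N; field; rewrite ?gt_eqF//; nra.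
  rewrite divr_ge0//; last by rewrite !mulr_ge0 ?exprn_ge0 ?(ltW N0)//; lra.
  rewrite mulr_ge0//; first by lra.
  have : y ^+ 2 <= d ^+ 2 by rewrite ler_pXn2r// nnegrE; lra.
  have : y ^+ 3 <= d ^+ 3 by rewrite ler_pXn2r// nnegrE; lra.
  have : 0 <= d ^+ 2 by rewrite exprn_ge0//; lra.
  nra.
have h3 : (d - a)^-1 + (d + a)^-1 - 2 * d^-1 <= (d - y) / (4 * d ^+ 2).
  have -> : (d - a)^-1 + (d + a)^-1 - 2 * d^-1 = 2 * a ^+ 2 / (d * (d ^+ 2 - a ^+ 2)).
    by field; rewrite ?gt_eqF//; nra.
  have da : 0 < d ^+ 2 - a ^+ 2 by nra.
  rewrite ler_pdivrMr ?mulr_gt0// mulrAC ler_pdivlMr; last first.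
    by rewrite mulr_gt0// exprn_gt0.
  have : 7 * a * (d ^+ 2 - a ^+ 2) <= (d - y) * (d ^+ 2 - a ^+ 2) by rewrite ler_pM2r.
  have : 0 <= 7 * d ^+ 2 - 7 * a ^+ 2 - 8 * a * d by nra.
  move=> e1 e2.
  have e3 : 8 * a ^+ 2 * d <= (d - y) * (d ^+ 2 - a ^+ 2) by nra.
  have := ler_wpM2l (ltW d0) e3; nra.
lra.
Qed.

Lemma triple_mid_close s v : 0 < v -> v <= 1 -> s <= 1 -> 1 <= 4 * s ->
  v * (2 * (1 + v)^-1 - 1 / 2 + (1 - v) / 6) <=
  (1 + s)^-1 - 1 / 2 + 3 / 16 + 4 * s * v ^+ 2.
Proof.
move=> v0 v1 s1 s4.
(* [t1] is the tangent at s = 1 and [t2] the chord over [0, 1]. *)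
have t1 : 3 / 4 - s / 4 <= (1 + s)^-1.
  rewrite -[leRHS]mul1r ler_pdivlMr; last by lra.
  have : 0 <= (s - 1) ^+ 2 by rewrite sqr_ge0.
  lra.
have t2 : (1 + v)^-1 <= 1 - v / 2.
  rewrite -[leLHS]mul1r ler_pdivrMr; last by lra.
  nra.
have t3 : v * (2 * (1 + v)^-1 - 1 / 2 + (1 - v) / 6) <= v * (5 / 3 - 7 / 6 * v).
  by rewrite ler_pM2l//; lra.
suff : v * (5 / 3 - 7 / 6 * v) <= 7 / 16 - s / 4 + 4 * s * v ^+ 2 by lra.
(* The right side is affine in s with slope 4(v^2 - 1/16), so the worst s is 1/4 or 1 according to
   this case. *)
have [vs|vs] := lerP (1 / 4) v.
  have : 0 <= (4 * s - 1) * (v ^+ 2 - 1 / 16) by rewrite mulr_ge0//; [lra|nra].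
  have := sqr_ge0 (v - 2 / 5).
  nra.
have := sqr_ge0 (v - 1 / 4).
nra.
Qed.

Lemma triple_mid_spread s v : 0 < v -> v <= 1 -> 0 < s -> 4 * s <= 1 ->
  0 <= (1 + s)^-1 - 1 + (1 - v) ^+ 2 / (2 * (1 + v)) + 17 / 6 * s * v ^+ 2.
Proof.
move=> v0 v1 s0 s4.
(* The coefficient 4/5 makes this an equality at s = 1/4, the end of the range. *)
have t1 : 1 - s + 4 / 5 * s ^+ 2 <= (1 + s)^-1.
  rewrite -[leRHS]mul1r ler_pdivlMr; last by lra.
  have : 0 <= s ^+ 2 * (1 - 4 * s) by rewrite mulr_ge0 ?sqr_ge0//; lra.
  nra.
suff : s - 4 / 5 * s ^+ 2 - 17 / 6 * s * v ^+ 2 <= (1 - v) ^+ 2 / (2 * (1 + v)) by lra.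
rewrite ler_pdivlMr; last by lra.
(* For v >= 3/5 the left side is nonpositive; for v <= 9/20 it is largest at s = 1/4. On the two
   remaining short ranges it is bounded by the constants 3/50 and 3/100. *)
have [vb|vb] := lerP (3 / 5) v.
  have : s - 4 / 5 * s ^+ 2 - 17 / 6 * s * v ^+ 2 <= 0.
    have : 0 <= s * (v ^+ 2 - 9 / 25) by rewrite mulr_ge0//; [lra|nra].
    nra.
  have := sqr_ge0 (1 - v).
  nra.
have [vc|vc] := lerP v (9 / 20).
  have v2 : v ^+ 2 <= 21 / 100 by nra.
  have : 0 <= (1 / 4 - s) * (1 - 17 / 6 * v ^+ 2 - 4 / 5 * (s + 1 / 4)).
    by rewrite mulr_ge0//; lra.
  move=> e1.
  have e2 : s - 4 / 5 * s ^+ 2 - 17 / 6 * s * v ^+ 2 <= 1 / 5 - 17 / 24 * v ^+ 2 by lra.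
  have e3 := ler_wpM2r (_ : 0 <= 2 * (1 + v)) e2.
  apply: le_trans (e3 _) _; first by lra.
  have := mulr_ge0 (ltW v0) (sqr_ge0 (v - 3 / 8)).
  have := sqr_ge0 (v - 3 / 8).
  nra.
have [vd|vd] := lerP v (1 / 2).
  have e2 : s - 4 / 5 * s ^+ 2 - 17 / 6 * s * v ^+ 2 <= 3 / 50.
    have : 0 <= s * (v ^+ 2 - 1 / 5) by rewrite mulr_ge0//; [lra|nra].
    have := sqr_ge0 (s - 1 / 4).
    nra.
  have e3 := ler_wpM2r (_ : 0 <= 2 * (1 + v)) e2.
  apply: le_trans (e3 _) _; first by lra.
  nra.
have e2 : s - 4 / 5 * s ^+ 2 - 17 / 6 * s * v ^+ 2 <= 3 / 100.
  have : 0 <= s * (v ^+ 2 - 1 / 4) by rewrite mulr_ge0//; [lra|nra].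
  have := sqr_ge0 (s - 9 / 50).
  nra.
have e3 := ler_wpM2r (_ : 0 <= 2 * (1 + v)) e2.
apply: le_trans (e3 _) _; first by lra.
nra.
Qed.

(** Scaled by s = y/Y and v = Y/d. [e] stands for the frustration gain, at least 3/(16Y) for radii
    within a factor 4 of each other. For more spread radii the term 1/(y + Y) is itself large
    enough; the 17/6 there is 4 - 7/6, where 7/6 bounds the error of replacing d - a by d. *)
Lemma triple_mid a d y Y e : 0 < a -> 0 < d -> a <= y -> y <= Y -> Y <= d ->
  7 * a <= d - Y ->
  0 <= e -> (Y <= 4 * y -> e = 3 / 16 / Y) ->
  (d - a)^-1 + 2 * (Y + d)^-1 - 3 / 2 * d^-1 <=
  (y + Y)^-1 - (2 * Y)^-1 + e + 4 * y / d ^+ 2.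
Proof.
move=> a0 d0 ay yY Yd gap e0 eE.
have y0 : 0 < y by lra.
have Y0 : 0 < Y by lra.
pose v := Y / d; pose s := y / Y.
have v0 : 0 < v by rewrite divr_gt0.
have v1 : v <= 1 by rewrite ler_pdivrMr// mul1r.
have s0 : 0 < s by rewrite divr_gt0.
have s1 : s <= 1 by rewrite ler_pdivrMr// mul1r.
have EY : Y = v * d by rewrite /v divfK// gt_eqF.
have Ey : y = s * Y by rewrite /s divfK// gt_eqF.
have E4 : (Y <= 4 * y) = (1 <= 4 * s) by rewrite /s mulrA ler_pdivlMr// mul1r.
clearbody v s.
have [h4|h4] := lerP Y (4 * y).
  have h := ler_inv_sub_gap a0 d0 Y0 gap.
  suff : d^-1 + (d - Y) / 6 / d ^+ 2 + 2 * (Y + d)^-1 - 3 / 2 * d^-1 <=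
    (y + Y)^-1 - (2 * Y)^-1 + e + 4 * y / d ^+ 2 by lra.
  rewrite -(ler_pM2l Y0) -subr_ge0.
  have -> : Y * ((y + Y)^-1 - (2 * Y)^-1 + e + 4 * y / d ^+ 2) -
    Y * (d^-1 + (d - Y) / 6 / d ^+ 2 + 2 * (Y + d)^-1 - 3 / 2 * d^-1) =
    (1 + s)^-1 - 1 / 2 + e * Y + 4 * s * v ^+ 2 -
     (v * (2 * (1 + v)^-1 - 1 / 2 + (1 - v) / 6)).
    by rewrite Ey EY; field; rewrite ?gt_eqF//; try lra; nra.
  rewrite (eE h4) divfK ?gt_eqF//.
  have s4 : 1 <= 4 * s by rewrite -E4.
  by have := triple_mid_close v0 v1 s1 s4; lra.
have s4 : 4 * s <= 1 by rewrite leNgt; apply/negP => /ltW; rewrite -E4; lra.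
have h : (d - a)^-1 <= d^-1 + 7 / 6 * y / d ^+ 2.
  rewrite -[leLHS]mul1r ler_pdivrMr; last by lra.
  have -> : d^-1 + 7 / 6 * y / d ^+ 2 = (d + 7 / 6 * y) / d ^+ 2 by field; rewrite gt_eqF.
  rewrite mulrAC ler_pdivlMr ?exprn_gt0// mul1r.
  nra.
suff : d^-1 + 7 / 6 * y / d ^+ 2 + 2 * (Y + d)^-1 - 3 / 2 * d^-1 <=
  (y + Y)^-1 - (2 * Y)^-1 + 4 * y / d ^+ 2 by lra.
rewrite -(ler_pM2l Y0) -subr_ge0.
have -> : Y * ((y + Y)^-1 - (2 * Y)^-1 + 4 * y / d ^+ 2) -
  Y * (d^-1 + 7 / 6 * y / d ^+ 2 + 2 * (Y + d)^-1 - 3 / 2 * d^-1) =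
  (1 + s)^-1 - 1 + (1 - v) ^+ 2 / (2 * (1 + v)) + 17 / 6 * s * v ^+ 2.
  by rewrite Ey EY; field; rewrite ?gt_eqF//; try lra; nra.
exact: triple_mid_spread.
Qed.

End RationalInequalities.

(** * Rational inequalities for the types 333 and 133 *)

Section FineUpperBound.
Variable R : realFieldType.
Implicit Types (a b B d x y z r s u v h : R).

Lemma high_constant a b d : 0 < a -> a <= b -> 7 * a <= d - b ->
  11 / 3 * d^-1 <= (a + b)^-1 + (a^-1 - b^-1) / 4.
Proof.
move=> a0 ab gap.
have d0 : 0 < d by lra.
(* The worst d is the smallest one, b + 7a. *)
have h : (b + 7 * a) * ((a + b)^-1 + (a^-1 - b^-1) / 4) >= 11 / 3.
  rewrite -subr_ge0.
  have -> : (b + 7 * a) * ((a + b)^-1 + (a^-1 - b^-1) / 4) - 11 / 3 =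
     (3 * b ^+ 3 - 11 * a * b ^+ 2 + 37 * a ^+ 2 * b - 21 * a ^+ 3) /
     (12 * a * b * (a + b)).
    by field; rewrite ?gt_eqF//; lra.
  have b0 : 0 < b by lra.
  rewrite divr_ge0//; last by rewrite !mulr_ge0//; lra.
  have e1 : 0 <= a ^+ 2 * (b - a) by rewrite mulr_ge0 ?sqr_ge0//; lra.
  have e2 : 0 <= b * (b - 2 * a) ^+ 2 by rewrite mulr_ge0 ?sqr_ge0//; lra.
  have e3 : 0 <= a * (b - a) ^+ 2 by rewrite mulr_ge0 ?sqr_ge0//; lra.
  have e4 : 0 < a ^+ 3 by rewrite exprn_gt0.
  lra.
have b0 : 0 < b by lra.
have i0 : 0 <= (a + b)^-1 + (a^-1 - b^-1) / 4.
  have := ler_pinv a0 ab.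
  have : 0 < (a + b)^-1 by rewrite invr_gt0; lra.
  lra.
rewrite ler_pdivrMr//; apply: le_trans h _.
by rewrite [leRHS]mulrC ler_wpM2r//; lra.
Qed.

(** An expansion in x. To first order 1/(z' - x) - 1/(z' + x) cancels against twice the weight of
    (x, z'), leaving at most 6x^2/d^3; the quadratic loss is at most 4x^2/d^3. The gap B <= d - 7x
    makes 1/B - 1/(x + B) exceed x/d^2 by the required 10x^2/d^3. *)
Lemma fine_high B d x z z' : 0 < x -> 0 < B -> 7 * x <= d - B ->
  d <= z -> z <= z' ->
  (x + B)^-1 - B^-1 + (z' - x)^-1 + z^-1
   <= (x + z)^-1 + (x + z')^-1 + 2 * (x * z' / (x + z') ^+ 3)
      - (x * z' / (x + z') ^+ 3) ^+ 2 / (2 * (z * z' / (z + z') ^+ 3)).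
Proof.
move=> x0 B0 gap dz zz'.
have d0 : 0 < d by lra.
have z0 : 0 < z by lra.
have z'0 : 0 < z' by lra.
have e1 := @ler_invB R d z x d0 dz (ltW x0).
have e2 : (z' - x)^-1 - (x + z')^-1 - 2 * (x * z' / (x + z') ^+ 3) <= 6 * x ^+ 2 / d ^+ 3.
  have xz : 0 < z' - x by lra.
  apply: (@le_trans _ _ (6 * x ^+ 2 / z' ^+ 3)); last first.
    rewrite ler_wpM2l//; first by rewrite mulr_ge0 ?sqr_ge0.
    by rewrite lef_pV2 ?posrE ?exprn_gt0// ler_pXn2r// ?nnegrE; lra.
  have -> : (z' - x)^-1 - (x + z')^-1 - 2 * (x * z' / (x + z') ^+ 3) =
    2 * x ^+ 2 * (x + 3 * z') / ((z' - x) * (x + z') ^+ 3).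
    by field; rewrite ?gt_eqF//; lra.
  rewrite ler_pdivrMr; last by rewrite mulr_gt0// exprn_gt0//; lra.
  rewrite [leRHS]mulrAC ler_pdivlMr ?exprn_gt0//.
  have k1 : x ^+ 2 * z' <= z' ^+ 3 / 49.
    rewrite [z' ^+ 3]exprSr [leRHS]mulrAC ler_pM2r//.
    have : (7 * x) ^+ 2 <= z' ^+ 2 by rewrite ler_pXn2r// ?nnegrE; lra.
    lra.
  have k2 : x ^+ 3 <= z' ^+ 3 by rewrite ler_pXn2r// ?nnegrE; lra.
  have z30 : 0 < z' ^+ 3 by rewrite exprn_gt0.
  have k3 : 0 <= x * (5 * z' ^+ 3 - 6 * (x ^+ 2 * z') - 3 * x ^+ 3).
    by rewrite mulr_ge0//; lra.
  have k4 : (x + 3 * z') * z' ^+ 3 <= 3 * ((z' - x) * (x + z') ^+ 3) by lra.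
  have := ler_wpM2l (_ : 0 <= 2 * x ^+ 2) k4.
  by rewrite pmulr_rge0// sqr_ge0 => /(_ isT); lra.
have e3 : (x * z' / (x + z') ^+ 3) ^+ 2 / (2 * (z * z' / (z + z') ^+ 3)) <= 4 * x ^+ 2 / d ^+ 3.
  have -> : (x * z' / (x + z') ^+ 3) ^+ 2 / (2 * (z * z' / (z + z') ^+ 3)) =
     x ^+ 2 * (z' * (z + z') ^+ 3) / (2 * z * (x + z') ^+ 6).
    by field; rewrite ?gt_eqF//; lra.
  rewrite ler_pdivrMr; last by rewrite !mulr_gt0 ?exprn_gt0//; lra.
  rewrite [leRHS]mulrAC ler_pdivlMr ?exprn_gt0//.
  have -> : 4 * x ^+ 2 * (2 * z * (x + z') ^+ 6) = x ^+ 2 * (8 * z * (x + z') ^+ 6) by ring.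
  rewrite -[leLHS]mulrA ler_wpM2l ?sqr_ge0//.
  apply: (@le_trans _ _ (z' * (2 * z') ^+ 3 * (z * z' ^+ 2))).
    apply: ler_pM; rewrite ?mulr_ge0 ?exprn_ge0//; try lra.
      by rewrite ler_pM2l// ler_pXn2r// ?nnegrE; lra.
    rewrite exprS; apply: ler_pM; rewrite ?exprn_ge0//; try lra.
    by rewrite ler_pXn2r// ?nnegrE; lra.
  have -> : z' * (2 * z') ^+ 3 * (z * z' ^+ 2) = 8 * z * z' ^+ 6 by ring.
  by rewrite ler_wpM2l//; [lra | rewrite ler_pXn2r// ?nnegrE; lra].
have e4 : x / d ^+ 2 + 10 * x ^+ 2 / d ^+ 3 <= B^-1 - (x + B)^-1.
  have -> : B^-1 - (x + B)^-1 = x / (B * (x + B)) by field; rewrite ?gt_eqF//; lra.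
  have -> : x / d ^+ 2 + 10 * x ^+ 2 / d ^+ 3 = x * ((d + 10 * x) / d ^+ 3).
    by field; rewrite gt_eqF.
  rewrite ler_pM2l// ler_pdivrMr ?exprn_gt0// [leRHS]mulrC ler_pdivlMr; last first.
    by rewrite mulr_gt0//; lra.
  apply: (@le_trans _ _ ((d + 10 * x) * ((d - 7 * x) * (d - 6 * x)))).
    by rewrite ler_wpM2l//; [lra | apply: ler_pM; lra].
  have k0 : 0 <= x * d ^+ 2 by rewrite mulr_ge0 ?sqr_ge0// ltW.
  have k1 : 0 <= x ^+ 2 * (d - 7 * x) by rewrite mulr_ge0 ?sqr_ge0//; lra.
  have k2 : 0 <= x ^+ 2 * d by rewrite mulr_ge0 ?sqr_ge0//; lra.
  lra.
have e5 : d^-1 - (d + x)^-1 <= x / d ^+ 2.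
  have -> : d^-1 - (d + x)^-1 = x / (d * (d + x)) by field; rewrite ?gt_eqF//; lra.
  rewrite ler_pM2l// lef_pV2 ?posrE ?mulr_gt0 ?exprn_gt0//; try lra.
  by rewrite expr2 ler_pM2l//; lra.
have e6 : 10 * x ^+ 2 / d ^+ 3 = 6 * x ^+ 2 / d ^+ 3 + 4 * x ^+ 2 / d ^+ 3 by lra.
rewrite e6 in e4; rewrite [z + x]addrC in e1; lra.
Qed.

End FineUpperBound.

(** * Rational inequalities for type 122 *)

Section FineLowerBound.
Variable R : realFieldType.
Implicit Types (a b B d x y z r s t u v h : R).

(** With s = x/r this is r times 1/(x+r) - 1/r + 2m - m^2/(2n) for the radii x, r, r, where m =
    xr/(x+r)^3 and n = 1/(8r). *)
Let psi s := (1 + s)^-1 - 1 + 2 * s / (1 + s) ^+ 3 - 4 * s ^+ 2 / (1 + s) ^+ 6.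

(** One factor (1 + s)^3 of the last denominator is replaced by a truncation [p] of its expansion,
    which keeps the later polynomial inequalities of low degree. *)
Lemma psi_cubic s p : 0 < s -> 0 < p -> p <= (1 + s) ^+ 3 ->
  s * (((1 - 2 * s - s ^+ 2) * p - 4 * s) / ((1 + s) ^+ 3 * p)) <= psi s.
Proof.
move=> s0 p0 pl; rewrite /psi.
have q0 : 0 < (1 + s) ^+ 3 by rewrite exprn_gt0//; lra.
have -> : s * (((1 - 2 * s - s ^+ 2) * p - 4 * s) / ((1 + s) ^+ 3 * p)) =
  (1 + s)^-1 - 1 + 2 * s / (1 + s) ^+ 3 - 4 * s ^+ 2 / ((1 + s) ^+ 3 * p).
  by field; rewrite ?gt_eqF//; lra.
rewrite lerD2l lerN2 ler_wpM2l//; first by rewrite mulr_ge0 ?sqr_ge0.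
have -> : (1 + s) ^+ 6 = (1 + s) ^+ 3 * (1 + s) ^+ 3 by ring.
by apply: ler_pinv; [exact: mulr_gt0 | rewrite ler_pM2l].
Qed.

Lemma psi_linear s : 0 < s -> s <= 1 -> - (s / 3) <= psi s.
Proof.
move=> s0 s1.
have p0 : 0 < 1 + 3 * s + 3 * s ^+ 2 by nra.
have s3 : 0 <= s ^+ 3 by rewrite exprn_ge0// ltW.
apply: le_trans (psi_cubic s0 p0 _); last by lra.
rewrite -mulrN ler_pM2l// ler_pdivlMr; last by rewrite mulr_gt0// exprn_gt0//; lra.
have s2 : 0 <= s ^+ 2 * (1 - s) by rewrite mulr_ge0 ?sqr_ge0//; lra.
have s4 : 0 <= s ^+ 3 * (1 - s) by rewrite mulr_ge0//; lra.
have s5 : 0 <= s ^+ 5 by rewrite exprn_ge0// ltW.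
have s6 : 0 <= s ^+ 2 * (1 - s) ^+ 2 by rewrite mulr_ge0 ?sqr_ge0//; lra.
nra.
Qed.

(** Near 0, psi s = s - 9 s^2 + ...; the minorant has the same slope at 0 and a slightly worse
    second coefficient 19/2, damped by 1 + 4s. *)
Lemma psi_quadratic s : 0 < s ->
  s - 19 / 2 * s ^+ 2 / (1 + 4 * s) <= psi s.
Proof.
move=> s0.
have p0 : 0 < 1 + 3 * s by nra.
have s2 : 0 <= s ^+ 2 by rewrite exprn_ge0// ltW.
have s3 : 0 <= s ^+ 3 by rewrite exprn_ge0// ltW.
have s4 : 0 <= s ^+ 4 by rewrite exprn_ge0// ltW.
have s5 : 0 <= s ^+ 5 by rewrite exprn_ge0// ltW.
have s6 : 0 <= s ^+ 6 by rewrite exprn_ge0// ltW.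
apply: le_trans (psi_cubic s0 p0 _); last by lra.
have -> : s - 19 / 2 * s ^+ 2 / (1 + 4 * s) = s * ((1 - 11 / 2 * s) / (1 + 4 * s)).
  by field; rewrite gt_eqF//; lra.
rewrite ler_pM2l// ler_pdivrMr; last by lra.
rewrite [leRHS]mulrAC ler_pdivlMr; last by rewrite mulr_gt0// exprn_gt0//; lra.
lra.
Qed.

Lemma fine_low_small s v : 0 < s -> 0 < v -> v <= 2 / 5 ->
  s * (1 + 5 * v + v ^+ 2) <= 1 - v ->
  s / 3 + 7 / 6 * v ^+ 2 * s <= (1 - v) ^+ 2 / (2 * (1 + v)).
Proof.
move=> s0 v0 v25 K.
have D0 : 0 < 1 + 5 * v + v ^+ 2 by nra.
apply: (@le_trans _ _ ((1 - v) / (1 + 5 * v + v ^+ 2) * (1 / 3 + 7 / 6 * v ^+ 2))).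
  have -> : s / 3 + 7 / 6 * v ^+ 2 * s = s * (1 / 3 + 7 / 6 * v ^+ 2) by ring.
  by rewrite ler_wpM2r ?ler_pdivlMr//; nra.
rewrite ler_pdivlMr; last by lra.
rewrite -[leLHS]mulrA [leLHS]mulrAC ler_pdivrMr// expr2 -[leRHS]mulrA ler_pM2l; last by lra.
nra.
Qed.

Lemma fine_low_large s v : 0 < s -> 2 / 5 <= v -> v <= 1 ->
  s * (1 + 5 * v + v ^+ 2) <= 1 - v ->
  0 <= (1 - v) ^+ 2 / (2 * (1 + v)) + (s - 19 / 2 * s ^+ 2 / (1 + 4 * s))
       - v ^+ 2 * s * (1 + (1 - v) / 6).
Proof.
move=> s0 v25 v1 K.
have E0 : 0 < 5 + v + v ^+ 2 by nra.
(* The value at the largest s allowed by [K]: 5 + v + v^2 = (1 + 5v + v^2) + 4(1 - v). *)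
have h1 : s / (1 + 4 * s) <= (1 - v) / (5 + v + v ^+ 2).
  rewrite ler_pdivrMr; last by lra.
  by rewrite [leRHS]mulrAC ler_pdivlMr//; nra.
have h2 : 19 / 2 * s ^+ 2 / (1 + 4 * s) <= 19 / 2 * s * ((1 - v) / (5 + v + v ^+ 2)).
  have -> : 19 / 2 * s ^+ 2 / (1 + 4 * s) = 19 / 2 * s * (s / (1 + 4 * s)) by ring.
  by rewrite ler_wpM2l//; lra.
suff : 0 <= (1 - v) * ((1 - v) / (2 * (1 + v)) +
   s * (1 + v - v ^+ 2 / 6 - 19 / 2 / (5 + v + v ^+ 2))).
  have -> : (1 - v) * ((1 - v) / (2 * (1 + v)) +
   s * (1 + v - v ^+ 2 / 6 - 19 / 2 / (5 + v + v ^+ 2))) =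
   (1 - v) ^+ 2 / (2 * (1 + v)) + s - 19 / 2 * s * ((1 - v) / (5 + v + v ^+ 2))
   - v ^+ 2 * s * (1 + (1 - v) / 6).
    by field; rewrite ?gt_eqF//; lra.
  lra.
rewrite mulr_ge0//; first by lra.
have [h|h] := lerP 0 (1 + v - v ^+ 2 / 6 - 19 / 2 / (5 + v + v ^+ 2)).
  by rewrite addr_ge0 ?divr_ge0 ?mulr_ge0//; lra.
have D0 : 0 < 1 + 5 * v + v ^+ 2 by nra.
have h3 : s <= (1 - v) / 3.
  rewrite ler_pdivlMr//; nra.
have h4 : 19 / 2 / (5 + v + v ^+ 2) <= 19 / 11 by rewrite ler_pdivrMr//; nra.
have h5 : (1 - v) / 4 <= (1 - v) / (2 * (1 + v)).
  by rewrite ler_wpM2l//; [lra | rewrite lef_pV2 ?posrE; lra].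
have h6 : - (1 / 2) <= 1 + v - v ^+ 2 / 6 - 19 / 2 / (5 + v + v ^+ 2) by nra.
have h7 : - ((1 - v) / 6) <= s * (1 + v - v ^+ 2 / 6 - 19 / 2 / (5 + v + v ^+ 2)).
  have := ler_wpM2l (ltW s0) h6; lra.
lra.
Qed.

Lemma fine_low_spread s v : 0 < s -> 0 < v -> v <= 1 ->
  s * (1 + 5 * v + v ^+ 2) <= 1 - v ->
  s * (1 / 2 + 7 / 6 * v ^+ 2) <= (1 - v) * (16 / 25 - v / (2 * (1 + v))).
Proof.
move=> s0 v0 v1 K.
have D0 : 0 < 1 + 5 * v + v ^+ 2 by nra.
apply: (@le_trans _ _ ((1 - v) / (1 + 5 * v + v ^+ 2) * (1 / 2 + 7 / 6 * v ^+ 2))).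
  by rewrite ler_wpM2r ?ler_pdivlMr//; nra.
rewrite -mulrA ler_wpM2l//; first by lra.
have -> : 16 / 25 - v / (2 * (1 + v)) = (32 + 7 * v) / (50 * (1 + v)).
  by field; rewrite gt_eqF//; lra.
rewrite mulrC ler_pdivrMr// [leRHS]mulrAC ler_pdivlMr; last by lra.
have v3 : 0 <= v * (1 - v) by rewrite mulr_ge0//; lra.
have v4 : 0 <= v ^+ 2 * (1 - v) by rewrite mulr_ge0 ?sqr_ge0//; lra.
nra.
Qed.

(** The inequality of [fine_low] times r, in the variables s = x/r, t = y/r, v = r/d. The last
    hypothesis is stability of (x, r, d) without its cubic term. *)
Lemma fine_low_scaled s t v : 0 < s -> s <= t -> t <= 1 -> 0 < v -> v <= 1 ->
  s * (1 + 5 * v + v ^+ 2) <= 1 - v ->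
  0 <= (1 + s)^-1 - 1 + 2 * s / (1 + s) ^+ 3
       - s ^+ 2 * (1 + t) ^+ 3 / (2 * t * (1 + s) ^+ 6)
       + (1 - v) * (((1 + t) * (1 + t * v))^-1 - v / (2 * (1 + v)))
       - v ^+ 2 * s / (1 - v * s).
Proof.
move=> s0 st t1 v0 v1 K.
have t0 : 0 < t by lra.
have vs0 : 0 < v * s by rewrite mulr_gt0.
have gap : 7 * (v * s) <= 1 - v.
  have : 0 <= s * (1 - v) ^+ 2 by rewrite mulr_ge0 ?sqr_ge0// ltW.
  lra.
have c1 : v ^+ 2 * s / (1 - v * s) <= v ^+ 2 * s * (1 + (1 - v) / 6).
  rewrite ler_wpM2l ?mulr_ge0 ?(ltW s0) ?(ltW v0)//.
  rewrite -[leLHS]mul1r ler_pdivrMr; last by lra.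
  nra.
have c2 : v ^+ 2 * s * (1 + (1 - v) / 6) <= 7 / 6 * v ^+ 2 * s.
  have : 0 <= v ^+ 2 * s * v by rewrite !mulr_ge0 ?(ltW s0) ?(ltW v0).
  lra.
have t3 : 0 < (1 + t) * (1 + t * v) by rewrite mulr_gt0//; nra.
have s3 : 1 <= (1 + s) ^+ 3 by rewrite exprn_ege1//; lra.
have s60 : 0 < (1 + s) ^+ 6 by rewrite exprn_gt0//; lra.
have s2 : 0 <= s ^+ 2 by rewrite sqr_ge0.
(* On [1/4, 1] one has (1 + t)^3 <= 8t, so t = 1 is the worst case and [psi] appears. For smaller t
   the quadratic loss is at most half of the gain 2s/(1+s)^3, and (1 + t)(1 + tv) is at most
   (5/4)^2. *)
have [t4|t4] := lerP (1 / 4) t.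
  have b1 : (1 - v) ^+ 2 / (2 * (1 + v)) <=
      (1 - v) * (((1 + t) * (1 + t * v))^-1 - v / (2 * (1 + v))).
    have -> : (1 - v) ^+ 2 / (2 * (1 + v)) =
        (1 - v) * ((2 * (1 + v))^-1 - v / (2 * (1 + v))).
      by field; rewrite ?gt_eqF//; lra.
    rewrite ler_wpM2l//; first by lra.
    by rewrite lerD2r; apply: ler_pinv => //; apply: ler_pM; nra.
  have l1 : s ^+ 2 * (1 + t) ^+ 3 / (2 * t * (1 + s) ^+ 6) <= 4 * s ^+ 2 / (1 + s) ^+ 6.
    have -> : s ^+ 2 * (1 + t) ^+ 3 / (2 * t * (1 + s) ^+ 6) =
       ((1 + t) ^+ 3 / (2 * t)) * (s ^+ 2 / (1 + s) ^+ 6).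
      by field; rewrite ?gt_eqF//; lra.
    rewrite -[leRHS]mulrA ler_wpM2r ?divr_ge0// ?(ltW s60)// ler_pdivrMr; last by lra.
    have : 0 <= (1 - t) * (t ^+ 2 + 4 * t - 1).
      by rewrite mulr_ge0//; nra.
    lra.
  have [v2|v2] := lerP v (2 / 5).
    have s1 : s <= 1 by lra.
    have := psi_linear s0 s1; have := fine_low_small s0 v0 v2 K; rewrite /psi; lra.
  have := psi_quadratic s0; have := fine_low_large s0 (ltW v2) v1 K; rewrite /psi; lra.
have b1 : (1 - v) * (16 / 25 - v / (2 * (1 + v))) <=
    (1 - v) * (((1 + t) * (1 + t * v))^-1 - v / (2 * (1 + v))).
  rewrite ler_wpM2l//; first by lra.
  rewrite lerD2r (_ : 16 / 25 = (25 / 16)^-1); last by rewrite invf_div.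
  by apply: ler_pinv => //; rewrite (_ : 25 / 16 = (5 / 4) * (5 / 4)); [apply: ler_pM; nra | lra].
have l1 : s ^+ 2 * (1 + t) ^+ 3 / (2 * t * (1 + s) ^+ 6) <= s / (1 + s) ^+ 3.
  have -> : s ^+ 2 * (1 + t) ^+ 3 / (2 * t * (1 + s) ^+ 6) =
     s / (1 + s) ^+ 3 * ((s * (1 + t) ^+ 3) / (2 * t * (1 + s) ^+ 3)).
    by field; rewrite ?gt_eqF//; lra.
  rewrite ler_piMr//; first by rewrite divr_ge0//; lra.
  rewrite ler_pdivrMr; last by rewrite mulr_gt0//; lra.
  rewrite mul1r [2 * t]mulrC -mulrA; apply: ler_pM; rewrite ?exprn_ge0//; try lra.
  have : 0 <= t * (1 / 4 - t) by rewrite mulr_ge0//; lra.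
  have : 0 <= t ^+ 2 * (1 / 4 - t) by rewrite mulr_ge0 ?sqr_ge0//; lra.
  nra.
have l2 : - (s / 2) <= (1 + s)^-1 - 1 + s / (1 + s) ^+ 3.
  have -> : (1 + s)^-1 - 1 + s / (1 + s) ^+ 3 = - (s * (s * (2 + s) / (1 + s) ^+ 3)).
    by field; rewrite ?gt_eqF//; lra.
  rewrite lerN2 ler_pM2l// ler_pdivrMr; last by lra.
  have : 0 <= s ^+ 3 by rewrite exprn_ge0// ltW.
  nra.
have := fine_low_spread s0 v0 v1 K.
lra.
Qed.

Lemma fine_low d x y r : 0 < x -> x <= y -> y <= r -> r <= d ->
  collinear_stable x r d ->
  (d - x)^-1 + (y + d)^-1 + r^-1 + (r + d)^-1 - 3 / 2 * d^-1 <=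
  (x + r)^-1 + (y + r)^-1 + 2 * (x * r / (x + r) ^+ 3)
    - (x * r / (x + r) ^+ 3) ^+ 2 / (2 * (y * r / (y + r) ^+ 3)).
Proof.
move=> x0 xy yr rd K.
have r0 : 0 < r by lra.
have d0 : 0 < d by lra.
have y0 : 0 < y by lra.
have gap := stable_gap x0 d0 r0 rd K.
pose v := r / d; pose s := x / r; pose t := y / r.
have v0 : 0 < v by rewrite divr_gt0.
have v1 : v <= 1 by rewrite ler_pdivrMr// mul1r.
have s0 : 0 < s by rewrite divr_gt0.
have st : s <= t by rewrite ler_pM2r// invr_gt0.
have t1 : t <= 1 by rewrite ler_pdivrMr// mul1r.
have Er : r = v * d by rewrite /v divfK// gt_eqF.
have Ex : x = s * r by rewrite /s divfK// gt_eqF.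
have Ey : y = t * r by rewrite /t divfK// gt_eqF.
clearbody v s t.
have K' : s * (1 + 5 * v + v ^+ 2) <= 1 - v.
  have D0 : 0 < v * d ^+ 3 by rewrite mulr_gt0// exprn_gt0.
  have : 0 < x ^+ 3 by rewrite exprn_gt0.
  rewrite -(ler_pM2l D0); move: K; rewrite /collinear_stable Ex Er; lra.
have vs : v * s < 1 by have : 0 <= s * (1 - v) ^+ 2; [rewrite mulr_ge0 ?sqr_ge0// ltW | lra].
have := fine_low_scaled s0 st t1 v0 v1 K'.
have -> : (1 + s)^-1 - 1 + 2 * s / (1 + s) ^+ 3
       - s ^+ 2 * (1 + t) ^+ 3 / (2 * t * (1 + s) ^+ 6)
       + (1 - v) * (((1 + t) * (1 + t * v))^-1 - v / (2 * (1 + v)))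
       - v ^+ 2 * s / (1 - v * s) =
  r * ((x + r)^-1 + (y + r)^-1 + 2 * (x * r / (x + r) ^+ 3)
    - (x * r / (x + r) ^+ 3) ^+ 2 / (2 * (y * r / (y + r) ^+ 3)) -
  ((d - x)^-1 + (y + d)^-1 + r^-1 + (r + d)^-1 - 3 / 2 * d^-1)).
  clear K; rewrite Ex Ey Er; field.
  have tv0 : 0 < t * v by rewrite mulr_gt0//; lra.
  by rewrite -Er -Ex -Ey !gt_eqF//; lra.
by rewrite pmulr_rge0// subr_ge0.
Qed.

End FineLowerBound.

(** * Upper bounds for sums of potentials, by type of triple *)

Section Types.
Variable R : realFieldType.

(** The energy if all three pairs could be opposite at once. *)
Definition crude (r s t : R) := (r + s)^-1 + (r + t)^-1 + (s + t)^-1.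

Record well_separated (a b B d : R) : Prop := WellSeparated {
  ws_a : 0 < a; ws_b : 0 < b; ws_bB : b <= B; ws_Bd : B <= d;
  ws_Kb : collinear_stable a b d; ws_KB : collinear_stable a B d }.

(** The four bounds after [ap_good] are the largest increments possible for sums of pair potentials:
    an unknown partner is put at the most favourable end of its range (0 for the aligned partner in
    [ap_high]). In [ap_low] and [ap_midb] the second pair potential enters only through its
    monotonicity. *)
Record admissible_potentials (a b B d : R) (U1 U2 U3 : R -> R) : Prop :=
  AdmissiblePotentials {
  ap_good : forall x y z, 0 < x <= a -> b <= y <= B -> d <= z ->
    U1 x + U2 y + U3 z <= (x + y)^-1 + (z - x)^-1 + (y + z)^-1;
  ap_low : forall x, 0 < x <= a -> U1 x <= U1 a + (x + b)^-1 - (a + b)^-1;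
  ap_midb : forall y, b <= y <= B -> U2 y <= U2 b + (a + y)^-1 - (a + b)^-1;
  ap_midB : forall y, b <= y <= B ->
    U2 y <= U2 B + y^-1 - B^-1 + (y + d)^-1 - (B + d)^-1;
  ap_high : forall z, d <= z ->
    U3 z <= U3 d - d^-1 + z^-1 - (d + B)^-1 + (z + B)^-1;
  ap_lowmid : U1 a - U2 b = (a^-1 - b^-1) / 4;
  ap_midhigh : U2 B - U3 d = B^-1 - d^-1 + (B + d)^-1 - (2 * d)^-1 }.

Local Ltac order_lra :=
  repeat match goal with
  | h : collinear_stable _ _ _ |- _ => clear h
  | h : context [GRing.inv] |- _ => clear h
  end; lra.

Section bounds.
Variables (a b B d : R) (U1 U2 U3 : R -> R).
Hypothesis W : well_separated a b B d.
Hypothesis P : admissible_potentials a b B d U1 U2 U3.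

Lemma inv2 (x : R) : (2 * x)^-1 = x^-1 / 2.
Proof. by rewrite invfM mulrC. Qed.

Lemma ws_facts : [/\ a < b, 0 < d, 7 * a <= d - b, 7 * a <= d - B &
  6 * d^-1 <= a^-1 - b^-1].
Proof.
case: W => a0 b0 bB Bd Kb KB.
have d0 : 0 < d by lra.
have B0 : 0 < B by lra.
split=> //.
- exact: stable_lt Kb.
- by apply: stable_gap Kb => //; lra.
- by apply: stable_gap KB => //; lra.
- exact: stable_inv_gap Kb.
Qed.

(** Comparison with the good triple (x, b, d): x' crosses the first gap to b, and x'' both gaps to
    d, each at the price of a growth bound and of the jumps. *)
Lemma bound111 x x' x'' : 0 < x <= a -> 0 < x' <= a -> 0 < x'' <= a ->
  U1 x + U1 x' + U1 x'' <= crude x x' x''.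
Proof.
move=> hx hx' hx''; case: ws_facts => ab d0 gb gB iab.
case: W P => a0 b0 bB Bd _ _ [good low midb midB high lm mh].
have hb : b <= b <= B by rewrite lexx.
have := good x b d hx hb (lexx d); have := low _ hx'; have := low _ hx''.
have := midB _ hb.
have := pair_low hx hx' (ltW ab).
case/andP: hx => x0 xa; case/andP: hx' => x'0 x'a; case/andP: hx'' => x''0 x''a.
have := @ler_invB R (a + x'') (2 * a) (b - a) ltac:(order_lra) ltac:(order_lra) ltac:(order_lra).
rewrite (_ : a + x'' + (b - a) = x'' + b); last by ring.
rewrite (_ : 2 * a + (b - a) = a + b); last by ring.
have := @ler_pinv R (x + x'') (a + x'') ltac:(order_lra) ltac:(order_lra).
have := @ler_pinv R (x' + x'') (a + x'') ltac:(order_lra) ltac:(order_lra).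
have := @ler_pinv R (a + x'') (2 * a) ltac:(order_lra) ltac:(order_lra).
have := @ler_pinv R (d - a) (d - x) ltac:(order_lra) ltac:(order_lra).
have := @ler_inv_sub R a d a0 d0 ltac:(order_lra).
have := @ler_pinv R d (b + d) ltac:(order_lra) ltac:(order_lra).
have := @ler_invB R (a + a) (a + b) (b - a) ltac:(order_lra) ltac:(order_lra) ltac:(order_lra).
rewrite (_ : a + b + (b - a) = 2 * b); last by ring.
rewrite (_ : a + a + (b - a) = a + b); last by ring.
rewrite (_ : a + a = 2 * a); last by ring.
have : 0 < d^-1 by rewrite invr_gt0.
rewrite !inv2 in mh *; rewrite /crude; lra.
Qed.

Lemma bound112 x x' y : 0 < x <= a -> 0 < x' <= a -> b <= y <= B ->
  U1 x + U1 x' + U2 y <= crude x x' y.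
Proof.
move=> hx hx' hy; case: ws_facts => ab d0 gb gB iab.
case: (W) P => a0 b0 bB Bd Kb KB [good low midb midB high lm mh].
have hb : b <= b <= B by rewrite lexx.
have Ky : collinear_stable a y d by apply: (stable_mono a0 b0 d0 Kb KB) => //; order_lra.
have := good x b d hx hb (lexx d); have := low _ hx'; have := midB _ hy.
have := pair_low hx hx' (ltW ab).
case/andP: hx => x0 xa; case/andP: hx' => x'0 x'a; case/andP: hy => y1 y2.
have := @stable_pair_far R a d y a0 d0 ltac:(order_lra) ltac:(order_lra) Ky.
have := @stable_theta R a d b a0 d0 ltac:(order_lra) Kb.
have : 0 <= 4 * b / d ^+ 2 by rewrite divr_ge0 ?sqr_ge0//; order_lra.
have := @ler_pinv R (x + y) (a + y) ltac:(order_lra) ltac:(order_lra).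
have := @ler_pinv R (x' + y) (a + y) ltac:(order_lra) ltac:(order_lra).
have := @ler_pinv R (d - a) (d - x) ltac:(order_lra) ltac:(order_lra).
have := @ler_pinv R (d + a) (b + d) ltac:(order_lra) ltac:(order_lra).
rewrite !inv2 in mh *; rewrite /crude; lra.
Qed.

Lemma bound113 x x' z : 0 < x <= a -> 0 < x' <= a -> d <= z ->
  U1 x + U1 x' + U3 z <= crude x x' z.
Proof.
move=> hx hx' hz; case: ws_facts => ab d0 gb gB iab.
case: (W) P => a0 b0 bB Bd Kb KB [good low midb midB high lm mh].
have hb : b <= b <= B by rewrite lexx.
have := good x b z hx hb hz; have := low _ hx'.
have := pair_low hx hx' (ltW ab).
case/andP: hx => x0 xa; case/andP: hx' => x'0 x'a.
have := @stable_theta R a d b a0 d0 ltac:(order_lra) Kb.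
have : (z - x)^-1 - (x + z)^-1 <= 4 * b / d ^+ 2.
  have -> : (z - x)^-1 - (x + z)^-1 = 2 * x / ((z - x) * (z + x)).
    by field; rewrite ?gt_eqF//; order_lra.
  rewrite ler_pdivrMr; last by rewrite mulr_gt0//; order_lra.
  rewrite [leRHS]mulrAC ler_pdivlMr ?exprn_gt0//.
  have k : d ^+ 2 <= 2 * ((z - x) * (z + x)).
    have : (6 / 7 * d) * d <= (z - x) * (z + x) by apply: ler_pM; order_lra.
    rewrite expr2; have : 0 < d * d by rewrite mulr_gt0.
    lra.
  have -> : 4 * b * ((z - x) * (z + x)) = 2 * b * (2 * ((z - x) * (z + x))) by ring.
  by apply: ler_pM; rewrite ?sqr_ge0//; order_lra.
have := @ler_pinv R (x' + z) (b + z) ltac:(order_lra) ltac:(order_lra).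
rewrite !inv2 in mh *; rewrite /crude; lra.
Qed.

(** Comparison with (a, y', z): here a middle radius moves down, so the first jump enters with the
    opposite sign to [bound112]. *)
Lemma bound223 y y' z : b <= y -> y <= y' -> y' <= B -> d <= z ->
  U2 y + U2 y' + U3 z <= crude y y' z.
Proof.
move=> h1 h2 h3 hz; case: ws_facts => ab d0 gb gB iab.
case: (W) P => a0 b0 bB Bd Kb KB [good low midb midB high lm mh].
have hy : b <= y <= B by order_lra.
have hy' : b <= y' <= B by order_lra.
have ha : 0 < a <= a by order_lra.
have Ky : collinear_stable a y d by apply: (stable_mono a0 b0 d0 Kb KB) => //; order_lra.
have := good a y' z ha hy' hz; have := midb _ hy.
have := pair_high a0 (ltW ab) h1 h2.
have := @stable_theta R a d y a0 d0 ltac:(order_lra) Ky.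
have : (z - a)^-1 - (y + z)^-1 <= 4 * y / d ^+ 2.
  have -> : (z - a)^-1 - (y + z)^-1 = (a + y) / ((z - a) * (y + z)).
    by field; rewrite ?gt_eqF//; order_lra.
  rewrite ler_pdivrMr; last by rewrite mulr_gt0//; order_lra.
  rewrite [leRHS]mulrAC ler_pdivlMr ?exprn_gt0//.
  have k : d ^+ 2 <= 2 * ((z - a) * (y + z)).
    have : (6 / 7 * d) * d <= (z - a) * (y + z) by apply: ler_pM; order_lra.
    rewrite expr2; have : 0 < d * d by rewrite mulr_gt0.
    lra.
  have -> : 4 * y * ((z - a) * (y + z)) = 2 * y * (2 * ((z - a) * (y + z))) by ring.
  by apply: ler_pM; rewrite ?sqr_ge0//; order_lra.
rewrite /crude; lra.
Qed.

Lemma bound233 y z z' : b <= y <= B -> d <= z -> z <= z' ->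
  U2 y + U3 z + U3 z' <= crude y z z'.
Proof.
move=> hy hz hz'; case: ws_facts => ab d0 gb gB iab.
case: (W) P => a0 b0 bB Bd Kb KB [good low midb midB high lm mh].
have hB : b <= B <= B by order_lra.
have ha : 0 < a <= a by order_lra.
have hdz' : d <= z' by order_lra.
have := good a B z' ha hB hdz'; have := midb _ hy; have := high _ hz.
case/andP: hy => y1 y2.
have := @ler_pinv R (y + z) (z + B) ltac:(order_lra) ltac:(order_lra).
have := @ler_pinv R (y + z') (B + z') ltac:(order_lra) ltac:(order_lra).
have := @ler_pinv R (a + b) (a + y) ltac:(order_lra) ltac:(order_lra).
have := @ler_pinv R B (a + B) ltac:(order_lra) ltac:(order_lra).
have := @ler_pinv R (d + B) (2 * d) ltac:(order_lra) ltac:(order_lra).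
have := @ler_invB R (z - a) (z' - a) (z + a) ltac:(order_lra) ltac:(order_lra) ltac:(order_lra).
rewrite (_ : z - a + (z + a) = 2 * z); last by ring.
rewrite (_ : z' - a + (z + a) = z + z'); last by ring.
have := @ler_pinv R (d - a) (z - a) ltac:(order_lra) ltac:(order_lra).
have := @ler_pinv R d z ltac:(order_lra) ltac:(order_lra).
have := @ler_inv_sub R a d a0 d0 ltac:(order_lra).
have : 0 < d^-1 by rewrite invr_gt0.
rewrite [B + d]addrC !inv2 in mh *; rewrite /crude; lra.
Qed.

(** Comparison with (a, B, z''): one radius goes down to B, another through B and b to a. *)
Lemma bound333 z z' z'' : d <= z -> d <= z' -> d <= z'' ->
  U3 z + U3 z' + U3 z'' <= crude z z' z''.
Proof.
move=> hz hz' hz''; case: ws_facts => ab d0 gb gB iab.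
case: (W) P => a0 b0 bB Bd Kb KB [good low midb midB high lm mh].
have hB : b <= B <= B by order_lra.
have ha : 0 < a <= a by order_lra.
have := good a B z'' ha hB hz''; have := midb _ hB; have := high _ hz; have := high _ hz'.
have := @high_constant R a b d a0 (ltW ab) gb.
have := @ler_pinv R B (a + B) ltac:(order_lra) ltac:(order_lra).
have := @ler_pinv R (d + B) (2 * d) ltac:(order_lra) ltac:(order_lra).
have := @ler_pinv R (d + B) (z + B) ltac:(order_lra) ltac:(order_lra).
have := @ler_pinv R (d + B) (z' + B) ltac:(order_lra) ltac:(order_lra).
have := @ler_pinv R (d + B) (B + z'') ltac:(order_lra) ltac:(order_lra).
have := @ler_pinv R (d - a) (z'' - a) ltac:(order_lra) ltac:(order_lra).
have := @ler_pinv R d z ltac:(order_lra) ltac:(order_lra).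
have := @ler_pinv R d z' ltac:(order_lra) ltac:(order_lra).
have := @ler_inv_sub R a d a0 d0 ltac:(order_lra).
have : 0 < (z + z')^-1 by rewrite invr_gt0; order_lra.
have : 0 < (z + z'')^-1 by rewrite invr_gt0; order_lra.
have : 0 < (z' + z'')^-1 by rewrite invr_gt0; order_lra.
rewrite [B + d]addrC !inv2 in mh *; rewrite /crude; lra.
Qed.

(** Comparison with (x, B, z'). In the good triple x and z' are aligned, so 1/(z' - x) must be
    beaten; the weight terms compensate its excess over 1/(x + z') to first order in x. *)
Lemma bound133 x z z' : 0 < x <= a -> d <= z -> z <= z' ->
  U1 x + U3 z + U3 z' <= crude x z z' + 2 * (x * z' / (x + z') ^+ 3)
      - (x * z' / (x + z') ^+ 3) ^+ 2 / (2 * (z * z' / (z + z') ^+ 3)).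
Proof.
move=> hx hz hz'; case: ws_facts => ab d0 gb gB iab.
case: (W) P => a0 b0 bB Bd Kb KB [good low midb midB high lm mh].
have hB : b <= B <= B by order_lra.
have hdz' : d <= z' by order_lra.
have := good x B z' hx hB hdz'; have := high _ hz.
case/andP: hx => x0 xa.
have := @fine_high R B d x z z' x0 ltac:(order_lra) ltac:(order_lra) hz hz'.
have := @ler_invB R (B + d) (B + z') (z - B) ltac:(order_lra) ltac:(order_lra) ltac:(order_lra).
rewrite (_ : B + d + (z - B) = d + z); last by ring.
rewrite (_ : B + z' + (z - B) = z + z'); last by ring.
have := @ler_invB R (B + d) (z + B) (d - B) ltac:(order_lra) ltac:(order_lra) ltac:(order_lra).
rewrite (_ : B + d + (d - B) = 2 * d); last by ring.
rewrite (_ : z + B + (d - B) = d + z); last by ring.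
rewrite [d + B]addrC in mh *; rewrite /crude; lra.
Qed.

Lemma bound122 x y y' : 0 < x <= a -> b <= y -> y <= y' -> y' <= B ->
  U1 x + U2 y + U2 y' <= crude x y y' + 2 * (x * y' / (x + y') ^+ 3)
      - (x * y' / (x + y') ^+ 3) ^+ 2 / (2 * (y * y' / (y + y') ^+ 3)).
Proof.
move=> hx h1 h2 h3; case: ws_facts => ab d0 gb gB iab.
case: (W) P => a0 b0 bB Bd Kb KB [good low midb midB high lm mh].
have hy : b <= y <= B by order_lra.
have hy' : b <= y' <= B by order_lra.
have K : collinear_stable x y' d by apply: (stable_mono a0 b0 d0 Kb KB) => //; order_lra.
have := good x y d hx hy (lexx d); have := midB _ hy'.
case/andP: hx => x0 xa.
have := @fine_low R d x y y' x0 ltac:(order_lra) ltac:(order_lra) ltac:(order_lra) K.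
rewrite !inv2 in mh *; rewrite /crude; lra.
Qed.

(** Comparison with (a, y', d), the only type where both outer radii leave their third while the
    inner one stays. *)
Lemma bound222 y y' Y e : b <= y -> y <= y' -> y' <= Y -> Y <= B ->
  0 <= e -> (Y <= 4 * y -> e = 3 / 16 / Y) ->
  U2 y + U2 y' + U2 Y <= crude y y' Y + e.
Proof.
move=> h1 h2 h3 h4 e0 eE; case: ws_facts => ab d0 gb gB iab.
case: (W) P => a0 b0 bB Bd Kb KB [good low midb midB high lm mh].
have hy : b <= y <= B by order_lra.
have hy' : b <= y' <= B by order_lra.
have hY : b <= Y <= B by order_lra.
have ha : 0 < a <= a by order_lra.
have Ky : collinear_stable a y d by apply: (stable_mono a0 b0 d0 Kb KB) => //; order_lra.
have := good a y' d ha hy' (lexx d); have := midb _ hy; have := midB _ hY.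
have := pair_high a0 (ltW ab) h1 h2.
have := @stable_theta R a d y a0 d0 ltac:(order_lra) Ky.
have := @triple_mid R a d y Y e a0 d0 ltac:(order_lra) ltac:(order_lra) ltac:(order_lra) ltac:(order_lra) e0 eE.
have := @ler_invB R (y' + Y) (2 * Y) (d - Y) ltac:(order_lra) ltac:(order_lra) ltac:(order_lra).
rewrite (_ : y' + Y + (d - Y) = y' + d); last by ring.
rewrite (_ : 2 * Y + (d - Y) = Y + d); last by ring.
rewrite !inv2 in mh *; rewrite /crude; lra.
Qed.

End bounds.
End Types.

(** * Potentials for antimonotone pairs *)

Section PairPotential.
Variable R : realType.
Variables (G : set (R * R)) (pl ph ql : R).

(** Rockafellar's construction for the cost 1/(p + q), restricted to ascending chains. A step from
    p' to p keeps the partner q' of p'; for antimonotone [G] later partners are no larger, so chain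
    values act as upper sums for the integral of -1/(u + q(u))^2. [fpot] is their infimum and [gpot]
    its conjugate over [pl, ph]. *)
Inductive chain : R -> R -> Prop :=
| chain0 p : pl <= p -> chain p 0
| chainS p' q' p v : chain p' v -> G (p', q') -> p' <= p ->
    chain p (v + (p + q')^-1 - (p' + q')^-1).

Definition fpot p := inf [set v | chain p v].
Definition gpot q := inf [set (p + q)^-1 - fpot p | p in [set p | pl <= p <= ph]].

Hypothesis Glow : forall p q, G (p, q) -> [/\ pl <= p, p <= ph & ql <= q].
Hypothesis Ganti : forall p q p' q', G (p, q) -> G (p', q') -> p < p' -> q' <= q.
Hypothesis plql : 0 < pl + ql.
Hypothesis plph : pl <= ph.

Lemma chain_ge p v : chain p v -> pl <= p.
Proof. by elim=> // p' q' p0 v0 _ h _; apply: le_trans. Qed.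

Lemma chain_lb p v : chain p v -> - (p - pl) / (pl + ql) ^+ 2 <= v.
Proof.
have D0 := plql.
elim=> [p0 h|p' q' p0 v0 c h g p'p].
  by rewrite mulNr oppr_le0 divr_ge0 ?sqr_ge0//; lra.
have := chain_ge c => lp'; have [_ _ lq] := Glow g.
have : (p' + q')^-1 - (p0 + q')^-1 <= (p0 - p') / (pl + ql) ^+ 2.
  have -> : (p' + q')^-1 - (p0 + q')^-1 = (p0 - p') / ((p' + q') * (p0 + q')).
    by field; rewrite ?gt_eqF//; lra.
  rewrite ler_wpM2l//; first by lra.
  by apply: ler_pinv; rewrite ?exprn_gt0// expr2; apply: ler_pM; lra.
rewrite (_ : - (p0 - pl) / (pl + ql) ^+ 2 =
  - (p' - pl) / (pl + ql) ^+ 2 - (p0 - p') / (pl + ql) ^+ 2); last by ring.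
lra.
Qed.

Lemma chain_has_inf p : pl <= p -> has_inf [set v | chain p v].
Proof.
move=> h; split; first by exists 0; exact: chain0.
by exists (- (p - pl) / (pl + ql) ^+ 2) => v; exact: chain_lb.
Qed.

Lemma fpot_le p v : chain p v -> fpot p <= v.
Proof. by move=> c; apply: ge_inf => //; have [] := chain_has_inf (chain_ge c). Qed.

Lemma fpot_ge p w : pl <= p -> (forall v, chain p v -> w <= v) -> w <= fpot p.
Proof. by move=> h H; apply: lb_le_inf => //; have [] := chain_has_inf h. Qed.

Lemma fpot_le0 p : pl <= p -> fpot p <= 0.
Proof. by move=> h; apply: fpot_le; apply: chain0. Qed.

Lemma fpot_step p q t : G (p, q) -> p <= t ->
  fpot t <= fpot p + (t + q)^-1 - (p + q)^-1.
Proof.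
move=> g pt; have [h _ _] := Glow g.
suff : fpot t - (t + q)^-1 + (p + q)^-1 <= fpot p by lra.
apply: fpot_ge => // v c; have := fpot_le (chainS c g pt); lra.
Qed.

(** The chain is cut at p. All steps beyond p use partners q' >= q, and by convexity replacing them
    by the single partner q can only lower the total. *)
Lemma chain_back t v p q : chain t v -> pl <= p -> p <= t -> ql <= q ->
  (forall p' q', G (p', q') -> p' < t -> q <= q') ->
  exists2 w, chain p w & w + (t + q)^-1 - (p + q)^-1 <= v.
Proof.
move=> c hp pt hq; have D0 := plql; elim: c p hp pt => [t0 h|p' q' t0 v0 c IH g p't] p hp pt H.
  exists 0; first exact: chain0.
  have := @ler_pinv R (p + q) (t0 + q) ltac:(lra) ltac:(lra); lra.
have lp' := chain_ge c; have [_ _ lq'] := Glow g.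
have [pp'|p'p] := ltP p p'.
  have H' r s : G (r, s) -> r < p' -> q <= s by move=> gr rp'; apply: H gr _; lra.
  have [w cw hw] := IH p hp (ltW pp') H'.
  exists w => //.
  (* A step of length zero changes nothing; its partner escapes [H], which only speaks of points
     strictly below t. *)
  have [e|ne] := eqVneq p' t0; first by subst; lra.
  have qq' : q <= q' by apply: H g _; rewrite lt_neqAle ne.
  have := @ler_invB R (p' + q) (p' + q') (t0 - p') ltac:(lra) ltac:(lra) ltac:(lra).
  rewrite (_ : p' + q + (t0 - p') = t0 + q); last by ring.
  rewrite (_ : p' + q' + (t0 - p') = t0 + q'); last by ring.
  lra.
exists (v0 + (p + q')^-1 - (p' + q')^-1); first exact: chainS.
have [e|ne] := eqVneq p t0; first by subst; lra.
have qq' : q <= q' by apply: H g _; rewrite (le_lt_trans p'p)// lt_neqAle ne.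
have := @ler_invB R (p + q) (p + q') (t0 - p) ltac:(lra) ltac:(lra) ltac:(lra).
rewrite (_ : p + q + (t0 - p) = t0 + q); last by ring.
rewrite (_ : p + q' + (t0 - p) = t0 + q'); last by ring.
lra.
Qed.

Lemma fpot_back p t q : pl <= p -> p <= t -> ql <= q ->
  (forall p' q', G (p', q') -> p' < t -> q <= q') ->
  fpot p + (t + q)^-1 - (p + q)^-1 <= fpot t.
Proof.
move=> hp pt hq H; apply: fpot_ge; first by lra.
move=> v c; have [w cw] := chain_back c hp pt hq H.
have := fpot_le cw; lra.
Qed.

Lemma fpot_slope p t : pl <= p -> p <= t ->
  fpot p - fpot t <= (p + ql)^-1 - (t + ql)^-1.
Proof.
move=> hp pt; have := fpot_back hp pt (lexx ql) (fun p' q' g _ => let: And3 _ _ h := Glow g in h).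
lra.
Qed.

Lemma fpot_nonincr p t : pl <= p -> p <= t -> fpot t <= fpot p.
Proof.
move=> hp pt; have D0 := plql; apply: fpot_ge => // v c.
case: c pt {hp} => [p0 h pt|p' q' p0 v0 c g p'p pt].
  by apply: fpot_le0; lra.
apply: le_trans (fpot_le (chainS c g (le_trans p'p pt))) _.
have lp' := chain_ge c; have [_ _ lq'] := Glow g.
have := @ler_pinv R (p0 + q') (t + q') ltac:(lra) ltac:(lra); lra.
Qed.

Lemma gpot_has_inf q : ql <= q ->
  has_inf [set (p + q)^-1 - fpot p | p in [set p | pl <= p <= ph]].
Proof.
move=> hq; have D0 := plql; split; first by exists ((pl + q)^-1 - fpot pl); exists pl => //=; rewrite lexx plph.
exists 0 => _ [p /= /andP[hp _] <-].
have := fpot_le0 hp; have : 0 <= (p + q)^-1 by rewrite invr_ge0; lra.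
lra.
Qed.

Lemma gpot_le p q : pl <= p <= ph -> ql <= q -> fpot p + gpot q <= (p + q)^-1.
Proof.
move=> hp hq; suff : gpot q <= (p + q)^-1 - fpot p by lra.
by apply: ge_inf; [have [] := gpot_has_inf hq | exists p].
Qed.

Lemma gpot_ge q w : ql <= q ->
  (forall p, pl <= p <= ph -> w <= (p + q)^-1 - fpot p) -> w <= gpot q.
Proof.
move=> hq H; apply: lb_le_inf; first by have [] := gpot_has_inf hq.
by move=> _ [p hp <-]; exact: H.
Qed.

(** p attains the infimum defining [gpot q]: points below p are handled by [fpot_back], with
    antimonotonicity, and points above by one more chain step. *)
Lemma pot_eq p q : G (p, q) -> fpot p + gpot q = (p + q)^-1.
Proof.
move=> g; have [hp hp' hq] := Glow g.
apply/eqP; rewrite eq_le gpot_le//= ?hp//.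
suff : (p + q)^-1 - fpot p <= gpot q by lra.
apply: gpot_ge => // t /andP[tl th].
have [tp|pt] := leP t p.
  have := fpot_back tl tp hq (fun p' q' g' h => Ganti g' g h); lra.
have := fpot_step g (ltW pt); lra.
Qed.

Lemma gpot_upper q q' : ql <= q -> q <= q' ->
  gpot q' <= gpot q + (ph + q')^-1 - (ph + q)^-1.
Proof.
move=> hq qq'; have D0 := plql; have pp := plph.
suff : gpot q' - (ph + q')^-1 + (ph + q)^-1 <= gpot q by lra.
apply: gpot_ge => // p /[dup] hp /andP[p1 p2].
have := gpot_le hp (le_trans hq qq').
have := @ler_invB R (p + q) (ph + q) (q' - q) ltac:(lra) ltac:(lra) ltac:(lra).
rewrite (_ : p + q + (q' - q) = p + q'); last by ring.
rewrite (_ : ph + q + (q' - q) = ph + q'); last by ring.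
lra.
Qed.

Lemma gpot_lower q q' : ql <= q -> q <= q' ->
  gpot q <= gpot q' + (pl + q)^-1 - (pl + q')^-1.
Proof.
move=> hq qq'; have D0 := plql; have pp := plph.
suff : gpot q - (pl + q)^-1 + (pl + q')^-1 <= gpot q' by lra.
apply: gpot_ge => [|p /[dup] hp /andP[p1 p2]]; first by lra.
have := gpot_le hp hq.
have := @ler_invB R (pl + q) (p + q) (q' - q) ltac:(lra) ltac:(lra) ltac:(lra).
rewrite (_ : p + q + (q' - q) = p + q'); last by ring.
rewrite (_ : pl + q + (q' - q) = pl + q'); last by ring.
lra.
Qed.

Lemma gpot_nonincr q q' : ql <= q -> q <= q' -> gpot q' <= gpot q.
Proof.
move=> hq qq'; have D0 := plql; have pp := plph.
have := gpot_upper hq qq'.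
have := @ler_pinv R (ph + q) (ph + q') ltac:(lra) ltac:(lra); lra.
Qed.

Lemma gpot_ge0 q : ql <= q -> 0 <= gpot q.
Proof.
move=> hq; have D0 := plql; apply: gpot_ge => // p /andP[hp _].
have := fpot_le0 hp; have : 0 <= (p + q)^-1 by rewrite invr_ge0; lra.
lra.
Qed.

End PairPotential.

(** * The radial cost *)

Section Cost.
Variable R : realType.
Implicit Types r s t x y z m n alpha beta : R.

Lemma invsq_tangent s A : 0 <= s -> 0 < A ->
  ((A^-1 + (A ^+ 2 - s) / (2 * A ^+ 3))%:E <= invsq s)%E.
Proof.
move=> s0 A0; rewrite /invsq; case: eqVneq => [_|sn0]; first by rewrite leey.
have t0 : 0 < Num.sqrt s by rewrite sqrtr_gt0 lt_neqAle eq_sym sn0.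
rewrite lee_fin -{1}(sqr_sqrtr s0); move: (Num.sqrt s) t0 => t t0.
rewrite -subr_ge0.
have -> : t^-1 - (A^-1 + (A ^+ 2 - t ^+ 2) / (2 * A ^+ 3)) =
  (A - t) ^+ 2 * (2 * A + t) / (2 * A ^+ 3 * t) by field; rewrite !gt_eqF.
rewrite divr_ge0//; first by rewrite mulr_ge0 ?sqr_ge0//; lra.
by apply: mulr_ge0; [rewrite mulr_ge0 ?exprn_ge0// ltW | exact: ltW].
Qed.

Lemma sqd_ge0 r s t : 0 <= r -> 0 <= s -> 0 <= sqd r s t.
Proof.
move=> r0 s0; rewrite /sqd.
have := mulr_ge0 (mulr_ge0 r0 s0) (_ : 0 <= 1 - cos t).
by have := cos_le1 t => h /(_ ltac:(lra)); have := sqr_ge0 (r - s); lra.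
Qed.

Lemma Ccost_tangent r1 r2 r3 A1 A2 A3 alpha beta :
  0 <= r1 -> 0 <= r2 -> 0 <= r3 -> 0 < A1 -> 0 < A2 -> 0 < A3 ->
  ((A1^-1 + (A1 ^+ 2 - sqd r1 r2 alpha) / (2 * A1 ^+ 3)
    + (A2^-1 + (A2 ^+ 2 - sqd r1 r3 beta) / (2 * A2 ^+ 3))
    + (A3^-1 + (A3 ^+ 2 - sqd r2 r3 (alpha - beta)) / (2 * A3 ^+ 3)))%:E
   <= Ccost r1 r2 r3 alpha beta)%E.
Proof.
move=> *; rewrite /Ccost !EFinD -!EFinD.
by rewrite 2!EFinD !leeD// invsq_tangent// sqd_ge0.
Qed.

Lemma sqd_opposite r s t : 0 < r -> 0 < s ->
  ((r + s) ^+ 2 - sqd r s t) / (2 * (r + s) ^+ 3) =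
  r * s / (r + s) ^+ 3 * (1 + cos t).
Proof. by move=> r0 s0; rewrite /sqd; field; rewrite gt_eqF//; lra. Qed.

Lemma sqd_aligned r s t : 0 < r -> r < s ->
  ((s - r) ^+ 2 - sqd r s t) / (2 * (s - r) ^+ 3) =
  - (r * s / (s - r) ^+ 3 * (1 - cos t)).
Proof. by move=> r0 s0; rewrite /sqd; field; rewrite gt_eqF//; lra. Qed.

(** The last hypothesis says that the determinant (m1 - m2)(m3 - m2) - m2^2 is nonnegative;
    multiplying by the pivot m1 - m2 completes the square. *)
Lemma collinear_form m1 m2 m3 p q p' q' : 0 < m2 -> m2 < m1 ->
  m2 * (m1 + m3) <= m1 * m3 ->
  m2 * ((p - p') ^+ 2 + (q - q') ^+ 2) <=
  m1 * (p ^+ 2 + q ^+ 2) + m3 * (p' ^+ 2 + q' ^+ 2).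
Proof.
move=> m20 m21 h; rewrite -subr_ge0.
have D0 : 0 < m1 - m2 by lra.
rewrite -(pmulr_rge0 _ D0).
have -> : (m1 - m2) * (m1 * (p ^+ 2 + q ^+ 2) + m3 * (p' ^+ 2 + q' ^+ 2) -
   m2 * ((p - p') ^+ 2 + (q - q') ^+ 2)) =
  ((m1 - m2) * p + m2 * p') ^+ 2 + ((m1 - m2) * q + m2 * q') ^+ 2 +
  (m1 * m3 - m2 * (m1 + m3)) * (p' ^+ 2 + q' ^+ 2) by ring.
apply: addr_ge0; first by rewrite addr_ge0 ?sqr_ge0.
by apply: mulr_ge0; [rewrite subr_ge0 | rewrite addr_ge0 ?sqr_ge0].
Qed.

Lemma ccost_collinear x y z : 0 < x -> 0 < y -> x < z ->
  collinear_stable x y z ->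
  (((x + y)^-1 + (z - x)^-1 + (y + z)^-1)%:E <= ccost x y z)%E.
Proof.
move=> x0 y0 xz K; apply: le_ereal_inf_tmp => _ [[alpha beta] _ <-] /=.
have z0 : 0 < z by lra.
apply: (le_trans _ (@Ccost_tangent x y z (x + y) (z - x) (y + z) alpha beta ltac:(lra) ltac:(lra) ltac:(lra) ltac:(lra) ltac:(lra) ltac:(lra))).
rewrite !sqd_opposite// sqd_aligned// lee_fin.
set m1 := x * y / _; set m2 := x * z / _; set m3 := y * z / _.
have m1_gt0 : 0 < m1 by rewrite divr_gt0 ?exprn_gt0 ?(mulr_gt0 x0) ?(mulr_gt0 y0)//; lra.
have m2_gt0 : 0 < m2 by rewrite divr_gt0 ?exprn_gt0 ?(mulr_gt0 x0) ?(mulr_gt0 y0)//; lra.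
have m3_gt0 : 0 < m3 by rewrite divr_gt0 ?exprn_gt0 ?(mulr_gt0 x0) ?(mulr_gt0 y0)//; lra.
(* Clearing denominators turns this determinant condition into stability. *)
have M : m2 * (m1 + m3) <= m1 * m3.
  rewrite -subr_ge0.
  have -> : m1 * m3 - m2 * (m1 + m3) =
    x * y * z * ((y + z) * (y * z * (z - y) - (x * (z ^+ 2 + 5 * y * z + y ^+ 2) + x ^+ 3))) /
    ((x + y) ^+ 3 * (z - x) ^+ 3 * (y + z) ^+ 3).
    by rewrite /m1 /m2 /m3; field; rewrite !gt_eqF//; lra.
  apply: divr_ge0; last by rewrite !mulr_ge0 ?exprn_ge0//; lra.
  by rewrite !mulr_ge0 ?subr_ge0//; lra.
have m21 : m2 < m1.
  rewrite -(ltr_pM2r m3_gt0); apply: lt_le_trans M.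
  by rewrite mulrDr ltrDr mulr_gt0.
have := collinear_form (cos alpha + 1) (sin alpha)
   (cos (alpha - beta) + 1) (sin (alpha - beta)) m2_gt0 m21 M.
have -> : cos beta = cos alpha * cos (alpha - beta) + sin alpha * sin (alpha - beta).
  by rewrite -cosB opprB addrC subrK.
have e1 := cos2Dsin2 alpha; have e2 := cos2Dsin2 (alpha - beta).
move: (cos alpha) (sin alpha) (cos (alpha - beta)) (sin (alpha - beta)) e1 e2 => ca sa cb sb e1 e2.
have -> : (ca + 1 - (cb + 1)) ^+ 2 + (sa - sb) ^+ 2 = 2 * (1 - (ca * cb + sa * sb)).
  by rewrite (_ : (_ + _) = (ca ^+ 2 + sa ^+ 2) + (cb ^+ 2 + sb ^+ 2) - 2 * (ca * cb + sa * sb)); [rewrite e1 e2; ring | ring].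
have -> : (ca + 1) ^+ 2 + sa ^+ 2 = 2 * (1 + ca).
  by rewrite (_ : _ + _ = (ca ^+ 2 + sa ^+ 2) + 2 * ca + 1); [rewrite e1; ring | ring].
have -> : (cb + 1) ^+ 2 + sb ^+ 2 = 2 * (1 + cb).
  by rewrite (_ : _ + _ = (cb ^+ 2 + sb ^+ 2) + 2 * cb + 1); [rewrite e2; ring | ring].
lra.
Qed.

(** Tangents at the three opposite distances leave m(1 + cos alpha) + m(1 + cos beta) + n(1 +
    cos(alpha - beta)), whose excess over the bound is n/2 times the squared modulus of m/n + e^(i
    alpha) + e^(i beta). *)
Lemma ccost_fine r1 r2 r3 m n : 0 < r1 -> 0 < r2 -> 0 < r3 -> 0 <= m -> 0 < n ->
  m <= r1 * r2 / (r1 + r2) ^+ 3 -> m <= r1 * r3 / (r1 + r3) ^+ 3 ->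
  n <= r2 * r3 / (r2 + r3) ^+ 3 ->
  ((crude r1 r2 r3 + 2 * m - m ^+ 2 / (2 * n))%:E <= ccost r1 r2 r3)%E.
Proof.
move=> r10 r20 r30 m0 n0 h1 h2 h3; apply: le_ereal_inf_tmp => _ [[alpha beta] _ <-] /=.
apply: (le_trans _ (@Ccost_tangent r1 r2 r3 (r1 + r2) (r1 + r3) (r2 + r3) alpha beta ltac:(lra) ltac:(lra) ltac:(lra) ltac:(lra) ltac:(lra) ltac:(lra))).
rewrite !sqd_opposite// lee_fin.
have c1 := cos_geN1 alpha; have c2 := cos_geN1 beta; have c3 := cos_geN1 (alpha - beta).
have k1 := ler_wpM2r (_ : 0 <= 1 + cos alpha) h1.
have k2 := ler_wpM2r (_ : 0 <= 1 + cos beta) h2.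
have k3 := ler_wpM2r (_ : 0 <= 1 + cos (alpha - beta)) h3.
have {}k1 := k1 ltac:(lra); have {}k2 := k2 ltac:(lra); have {}k3 := k3 ltac:(lra).
suff : 2 * m - m ^+ 2 / (2 * n) <=
  m * (1 + cos alpha) + m * (1 + cos beta) + n * (1 + cos (alpha - beta)).
  by rewrite /crude; lra.
rewrite cosB.
have e1 := cos2Dsin2 alpha; have e2 := cos2Dsin2 beta.
clear -n0 e1 e2; move: (cos alpha) (sin alpha) (cos beta) (sin beta) e1 e2 => ca sa cb sb e1 e2.
rewrite -subr_ge0.
have -> : m * (1 + ca) + m * (1 + cb) + n * (1 + (ca * cb + sa * sb)) -
  (2 * m - m ^+ 2 / (2 * n)) =
  n / 2 * ((m / n + ca + cb) ^+ 2 + (sa + sb) ^+ 2 + (1 - (ca ^+ 2 + sa ^+ 2)) + (1 - (cb ^+ 2 + sb ^+ 2))).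
  by field; rewrite gt_eqF.
by rewrite e1 e2 subrr !addr0 mulr_ge0 ?addr_ge0 ?sqr_ge0//; lra.
Qed.

Lemma ccost_crude r1 r2 r3 : 0 < r1 -> 0 < r2 -> 0 < r3 ->
  ((crude r1 r2 r3)%:E <= ccost r1 r2 r3)%E.
Proof.
move=> r10 r20 r30.
have n0 : 0 < r2 * r3 / (r2 + r3) ^+ 3 by rewrite divr_gt0 ?exprn_gt0 ?(mulr_gt0 r20)//; lra.
have := @ccost_fine r1 r2 r3 0 _ r10 r20 r30 (lexx 0) n0 _ _ (lexx _).
rewrite mulr0 expr0n mul0r subr0 addr0; apply.
  by rewrite divr_ge0 ?mulr_ge0 ?exprn_ge0//; lra.
by rewrite divr_ge0 ?mulr_ge0 ?exprn_ge0//; lra.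
Qed.

Lemma sqdC r s t : sqd r s t = sqd s r (- t).
Proof. by rewrite /sqd cosN; ring. Qed.

Lemma sqdN r s t : sqd r s (- t) = sqd r s t.
Proof. by rewrite /sqd cosN. Qed.

(** Rotating by -alpha puts the second point on the axis. *)
Lemma ccost_swap12 r1 r2 r3 : (ccost r1 r2 r3 <= ccost r2 r1 r3)%E.
Proof.
apply: le_ereal_inf_tmp => _ [[alpha beta] _ <-] /=.
apply: ereal_inf_lbound; exists (- alpha, beta - alpha) => //=.
have -> : Ccost r1 r2 r3 (- alpha) (beta - alpha) =
  (invsq (sqd r2 r1 alpha) + invsq (sqd r1 r3 (alpha - beta)) + invsq (sqd r2 r3 beta))%E.
  rewrite /Ccost -sqdC -(sqdN r1 r3 (beta - alpha)) opprB.
  by rewrite -(sqdN r2 r3 beta); congr (_ + invsq (sqd _ _ _))%E; ring.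
by rewrite /Ccost -!addeA; congr (_ + _)%E; exact: addeC.
Qed.

Lemma ccost_swap23 r1 r2 r3 : (ccost r1 r2 r3 <= ccost r1 r3 r2)%E.
Proof.
apply: le_ereal_inf_tmp => _ [[alpha beta] _ <-] /=.
apply: ereal_inf_lbound; exists (beta, alpha) => //=.
rewrite /Ccost; congr (_ + _)%E; first exact: addeC.
by rewrite sqdC opprB.
Qed.

Lemma ccost_le_collinear x y z : 0 < x -> 0 < y -> x < z ->
  (ccost x y z <= ((x + y)^-1 + (z - x)^-1 + (y + z)^-1)%:E)%E.
Proof.
move=> x0 y0 xz; apply: ereal_inf_lbound; exists (pi, 0) => //=.
have E r : 0 < r -> invsq (r ^+ 2) = (r^-1)%:E.
  by move=> r0; rewrite /invsq expf_eq0/= gt_eqF// sqrtr_sqr gtr0_norm.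
rewrite /Ccost /sqd subr0 cospi cos0.
have -> : x ^+ 2 + y ^+ 2 - 2 * x * y * -1 = (x + y) ^+ 2 by ring.
have -> : x ^+ 2 + z ^+ 2 - 2 * x * z * 1 = (z - x) ^+ 2 by ring.
have -> : y ^+ 2 + z ^+ 2 - 2 * y * z * -1 = (y + z) ^+ 2 by ring.
by rewrite !E//; lra.
Qed.

Lemma ccost_ge0 r1 r2 r3 : (0 <= ccost r1 r2 r3)%E.
Proof.
have i0 s : (0 <= @invsq R s)%E.
  by rewrite /invsq; case: ifP => // _; rewrite lee_fin invr_ge0 sqrtr_ge0.
by apply: le_ereal_inf_tmp => _ [ab _ <-]; rewrite /Ccost !adde_ge0.
Qed.

End Cost.

(** * The dual potential *)

Section Certificate.
Variable R : realType.

Lemma weight_nonincr (x y y' : R) : 0 < x -> x <= y -> y <= y' ->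
  x * y' / (x + y') ^+ 3 <= x * y / (x + y) ^+ 3.
Proof.
move=> x0 xy yy'.
rewrite ler_pdivrMr; last by rewrite exprn_gt0//; lra.
rewrite [leRHS]mulrAC ler_pdivlMr; last by rewrite exprn_gt0//; lra.
rewrite -!mulrA ler_pM2l// -subr_ge0.
have -> : y * (x + y') ^+ 3 - y' * (x + y) ^+ 3 =
  (y' - y) * (x * (y * y' - x ^+ 2) + 2 * x * y * y' + y * y' * (y + y')) by ring.
rewrite mulr_ge0//; first by lra.
have y0 : 0 < y by lra.
have : x ^+ 2 <= y * y' by rewrite expr2; apply: ler_pM; lra.
move=> h; rewrite !addr_ge0 ?mulr_ge0//; lra.
Qed.

(** 1/(8Y) is the weight of two equal radii Y. The factor 4 ensures s^2 <= r^2 + 4rs, which would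
    hold up to s = (2 + sqrt 5) r. *)
Lemma weight_ge (Y r s : R) : 0 < r -> r <= s -> s <= 4 * r -> s <= Y ->
  1 / 8 / Y <= r * s / (r + s) ^+ 3.
Proof.
move=> r0 rs s4 sY.
have s0 : 0 < s by lra.
have Y0 : 0 < Y by lra.
rewrite ler_pdivrMr// [leRHS]mulrAC ler_pdivlMr; last by rewrite exprn_gt0//; lra.
have h : (r + s) ^+ 3 <= 8 * (r * s * s).
  have : 0 <= (s - r) * (r ^+ 2 + 4 * r * s - s ^+ 2).
    by rewrite mulr_ge0//; [lra | nra].
  lra.
have : r * s * s <= r * s * Y by rewrite ler_pM2l// mulr_gt0.
lra.
Qed.

Section pointwise.
Variables (a b B d : R) (U1 U2 U3 : R -> R).
Hypothesis W : well_separated a b B d.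
Hypothesis P : admissible_potentials a b B d U1 U2 U3.

Definition glue (r : R) : R := if r <= a then U1 r else if r <= B then U2 r else U3 r.

Definition spread (r : R) := [|| 0 < r <= a, b <= r <= B | d <= r].

Variant spread_spec (r : R) : R -> Prop :=
| SpreadLow of 0 < r <= a : spread_spec r (U1 r)
| SpreadMid of b <= r <= B : spread_spec r (U2 r)
| SpreadHigh of d <= r : spread_spec r (U3 r).

Lemma spreadP r : spread r -> spread_spec r (glue r).
Proof.
have [ab d0 gb gB _] := ws_facts W; case: W => a0 b0 bB Bd _ _.
case/or3P => h; rewrite /glue.
- by case/andP: (h) => _ ->; apply: SpreadLow.
- case/andP: (h) => h1 h2; rewrite leNgt (lt_le_trans ab h1)/= h2; exact: SpreadMid.
- have -> : (r <= a) = false by apply/negbTE; rewrite -ltNge; lra.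
  have -> : (r <= B) = false by apply/negbTE; rewrite -ltNge; lra.
  exact: SpreadHigh.
Qed.

Lemma spread_gt0 r : spread r -> 0 < r.
Proof.
have [ab d0 _ _ _] := ws_facts W; have b0 := ws_b W.
case/or3P => [/andP[]//|/andP[h _]|h]; exact: lt_le_trans h.
Qed.

Lemma glue_le_ccost_sorted r1 r2 r3 : spread r1 -> spread r2 -> spread r3 ->
  r1 <= r2 -> r2 <= r3 -> ((glue r1 + glue r2 + glue r3)%:E <= ccost r1 r2 r3)%E.
Proof.
have [ab d0 gb gB _] := ws_facts W; case: (W) => a0 b0 bB Bd Kb KB.
have Bd' : B < d by lra.
have ad : a < d by lra.
move=> /[dup]/spread_gt0 p1 /spreadP S1 /[dup]/spread_gt0 p2 /spreadP S2.
move=> /[dup]/spread_gt0 p3 /spreadP S3 r12 r23.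
have c21 x y : b <= x <= B -> 0 < y <= a -> x <= y -> False.
  by move=> /andP[h _] /andP[_ k] l; have := le_trans h (le_trans l k); rewrite leNgt ab.
have c32 x y : d <= x -> b <= y <= B -> x <= y -> False.
  by move=> h /andP[_ k] l; have := le_trans h (le_trans l k); rewrite leNgt Bd'.
have c31 x y : d <= x -> 0 < y <= a -> x <= y -> False.
  by move=> h /andP[_ k] l; have := le_trans h (le_trans l k); rewrite leNgt ad.
case: S1 => h1; case: S2 => h2; try by [case: (c21 _ _ h1 h2 r12) |
  case: (c31 _ _ h1 h2 r12) | case: (c32 _ _ h1 h2 r12)]; case: S3 => h3;
  try by [case: (c21 _ _ h2 h3 r23) | case: (c31 _ _ h2 h3 r23) |
  case: (c32 _ _ h2 h3 r23)].
- apply: le_trans (@ccost_crude _ r1 r2 r3 p1 p2 p3).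
  by rewrite lee_fin; exact: (bound111 W P).
- apply: le_trans (@ccost_crude _ r1 r2 r3 p1 p2 p3).
  by rewrite lee_fin; exact: (bound112 W P).
- apply: le_trans (@ccost_crude _ r1 r2 r3 p1 p2 p3).
  by rewrite lee_fin; exact: (bound113 W P).
- have n0 : 0 < r2 * r3 / (r2 + r3) ^+ 3.
    by apply: divr_gt0; [apply: mulr_gt0|rewrite exprn_gt0// addr_gt0].
  have m0 : 0 <= r1 * r3 / (r1 + r3) ^+ 3.
    by apply/ltW/divr_gt0; [apply: mulr_gt0|rewrite exprn_gt0// addr_gt0].
  have := @ccost_fine R r1 r2 r3 _ _ p1 p2 p3 m0 n0
    (@weight_nonincr r1 r2 r3 p1 r12 r23) (lexx _) (lexx _).
  apply: le_trans; rewrite lee_fin; apply: (bound122 W P) => //; lra.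
- apply: le_trans (@ccost_collinear R r1 r2 r3 p1 p2 ltac:(lra) _).
    by rewrite lee_fin; exact: (ap_good P).
  by apply: (stable_mono a0 b0 d0 Kb KB) => //; lra.
- have n0 : 0 < r2 * r3 / (r2 + r3) ^+ 3.
    by apply: divr_gt0; [apply: mulr_gt0|rewrite exprn_gt0// addr_gt0].
  have m0 : 0 <= r1 * r3 / (r1 + r3) ^+ 3.
    by apply/ltW/divr_gt0; [apply: mulr_gt0|rewrite exprn_gt0// addr_gt0].
  have := @ccost_fine R r1 r2 r3 _ _ p1 p2 p3 m0 n0
    (@weight_nonincr r1 r2 r3 p1 r12 r23) (lexx _) (lexx _).
  by apply: le_trans; rewrite lee_fin; exact: (bound133 W P).
(* Within a factor 4 all weights are at least 1/(8 r3); taking m = n equal to it gives the gain 3m/2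
   = 3/(16 r3). *)
- have [r4|r4] := leP r3 (4 * r1).
    have w0 : 0 < 1 / 8 / r3 by rewrite !divr_gt0.
    have := @ccost_fine R r1 r2 r3 _ _ p1 p2 p3 (ltW w0) w0
      (@weight_ge r3 r1 r2 p1 r12 (le_trans r23 r4) r23)
      (@weight_ge r3 r1 r3 p1 (le_trans r12 r23) r4 (lexx _))
      (@weight_ge r3 r2 r3 p2 r23 ltac:(lra) (lexx _)).
    apply: le_trans; rewrite lee_fin.
    have -> : crude r1 r2 r3 + 2 * (1 / 8 / r3) - (1 / 8 / r3) ^+ 2 / (2 * (1 / 8 / r3)) =
      crude r1 r2 r3 + 3 / 16 / r3.
      rewrite -addrA; congr (_ + _).
      by field; rewrite gt_eqF.
    have e0 : 0 <= 3 / 16 / r3 by rewrite ltW// !divr_gt0.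
    by apply: (bound222 W P) => //; lra.
  apply: le_trans (@ccost_crude _ r1 r2 r3 p1 p2 p3).
  by rewrite lee_fin -[leRHS]addr0; apply: (bound222 W P) => //; lra.
- apply: le_trans (@ccost_crude _ r1 r2 r3 p1 p2 p3).
  rewrite lee_fin; apply: (bound223 W P) => //; lra.
- apply: le_trans (@ccost_crude _ r1 r2 r3 p1 p2 p3).
  by rewrite lee_fin; exact: (bound233 W P).
- apply: le_trans (@ccost_crude _ r1 r2 r3 p1 p2 p3).
  by rewrite lee_fin; exact: (bound333 W P).
Qed.

Lemma glue_le_ccost r1 r2 r3 : spread r1 -> spread r2 -> spread r3 ->
  ((glue r1 + glue r2 + glue r3)%:E <= ccost r1 r2 r3)%E.
Proof.
move=> h1 h2 h3.
have s12 r s t : ((glue r + glue s + glue t)%:E <= ccost r s t)%E ->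
  ((glue s + glue r + glue t)%:E <= ccost s r t)%E.
  by rewrite [glue s + _]addrC => h; apply: le_trans h (ccost_swap12 _ _ _).
have s23 r s t : ((glue r + glue s + glue t)%:E <= ccost r s t)%E ->
  ((glue r + glue t + glue s)%:E <= ccost r t s)%E.
  by rewrite addrAC => h; apply: le_trans h (ccost_swap23 _ _ _).
have [r12|/ltW r12] := leP r1 r2; have [r23|/ltW r23] := leP r2 r3; have [r13|/ltW r13] := leP r1 r3.
- exact: glue_le_ccost_sorted.
- exact: glue_le_ccost_sorted.
- by apply/s23; apply: glue_le_ccost_sorted.
- by apply/s23/s12; apply: glue_le_ccost_sorted.
- by apply/s12; apply: glue_le_ccost_sorted.
- by apply/s12/s23; apply: glue_le_ccost_sorted.
- by apply/s12/s23/s12; apply: glue_le_ccost_sorted => //; lra.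
- by apply/s12/s23/s12; apply: glue_le_ccost_sorted.
Qed.

End pointwise.
End Certificate.

(** * Assembling the potential from pair potentials *)

Section Existence.
Variable R : realType.

(** Freezing the argument at the ends of a third extends each pair potential to a monotone, hence
    measurable, function on the line. *)
Definition clamp (l h r : R) : R := Num.max l (Num.min r h).

Lemma clamp_in l h r : l <= h -> l <= clamp l h r <= h.
Proof. by move=> lh; rewrite /clamp le_max lexx/= ge_max lh/= ge_min lexx orbT. Qed.

Lemma clamp_id l h r : l <= r <= h -> clamp l h r = r.
Proof. by case/andP=> lr rh; rewrite /clamp (min_idPl rh) (max_idPr lr). Qed.

Lemma clamp_homo l h : {homo clamp l h : r s / r <= s}.
Proof.
move=> r s rs; rewrite /clamp ge_max !le_max lexx/= le_min.
by apply/orP; right; rewrite !ge_min rs lexx orbT.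
Qed.

Lemma exists_dual_potential (a b B d : R) (G : R -> R -> R -> Prop) :
  well_separated a b B d ->
  (forall x y z, G x y z -> [/\ 0 <= x <= a, b <= y <= B & d <= z]) ->
  (forall x y z x' y' z', G x y z -> G x' y' z' -> x < x' -> y' <= y /\ z <= z') ->
  (forall x y z x' y' z', G x y z -> G x' y' z' -> y < y' -> z' <= z) ->
  exists U : R -> R, [/\ measurable_fun setT U, exists M, forall r, `|U r| <= M,
    forall r1 r2 r3, spread a b B d r1 -> spread a b B d r2 -> spread a b B d r3 ->
      ((U r1 + U r2 + U r3)%:E <= ccost r1 r2 r3)%E &
    forall x y z, G x y z -> 0 < x ->
      U x + U y + U z = (x + y)^-1 + (z - x)^-1 + (y + z)^-1].
Proof.
move=> W Gin Gx Gy.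
have [ab d0 gb gB _] := ws_facts W; case: (W) => a0 b0 bB Bd _ _.
pose G12 : set (R * R) := [set pq | exists z, G pq.1 pq.2 z].
(* The first and third radii are aligned and move together; with p = -x their energy is 1/(p + z)
   and the pairs become antimonotone. *)
pose G13 : set (R * R) := [set pq | exists y, G (- pq.1) y pq.2].
pose G23 : set (R * R) := [set pq | exists x, G x pq.1 pq.2].
have L12 p q : G12 (p, q) -> [/\ 0 <= p, p <= a & b <= q].
  by case=> z /Gin[/andP[? ?] /andP[? ?] ?]; split.
have L13 p q : G13 (p, q) -> [/\ - a <= p, p <= 0 & d <= q].
  by case=> y /Gin[/= /andP[? ?] /andP[? ?] ?]; split => //; lra.
have L23 p q : G23 (p, q) -> [/\ b <= p, p <= B & d <= q].
  by case=> x /Gin[/andP[? ?] /andP[? ?] ?]; split.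
have A12 p q p' q' : G12 (p, q) -> G12 (p', q') -> p < p' -> q' <= q.
  by case=> z g [z' g'] /(Gx _ _ _ _ _ _ g g')[].
have A13 p q p' q' : G13 (p, q) -> G13 (p', q') -> p < p' -> q' <= q.
  by case=> y g [y' g']; rewrite -ltrN2 => /(Gx _ _ _ _ _ _ g' g)[].
have A23 p q p' q' : G23 (p, q) -> G23 (p', q') -> p < p' -> q' <= q.
  by case=> x g [x' g'] /(Gy _ _ _ _ _ _ g g').
have P12 : 0 < 0 + b by lra.
have P13 : 0 < - a + d by lra.
have P23 : 0 < b + d by lra.
have ad : a < d by lra.
have Bd' : B < d by lra.
have a0' : 0 <= a by lra.
have Na0 : - a <= 0 by lra.
pose f12 := fpot G12 0; pose g12 := gpot G12 0 a.
pose f13 := fpot G13 (- a); pose g13 := gpot G13 (- a) 0.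
pose f23 := fpot G23 b; pose g23 := gpot G23 b B.
pose c1 := clamp 0 a; pose c2 := clamp b B; pose c3 r := Num.max d r.
(* The missing parts of the two prescribed jumps. The constants satisfy k1 - k2 = D12, k2 - k3 = D23
   and have sum zero, so that equality on [G] survives. *)
pose D12 := (a^-1 - b^-1) / 4 - (f12 a + f13 (- a) - (g12 b + f23 b)).
pose D23 := B^-1 - d^-1 + (B + d)^-1 - (2 * d)^-1 - (g12 B + f23 B - (g13 d + g23 d)).
pose k2 := (D23 - D12) / 3; pose k1 := k2 + D12; pose k3 := k2 - D23.
have k123 : k1 + k2 + k3 = 0 by rewrite /k1 /k3 /k2; lra.
pose U1 r := f12 (c1 r) + f13 (- c1 r) + k1.
pose U2 r := g12 (c2 r) + f23 (c2 r) + k2.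
pose U3 r := g13 (c3 r) + g23 (c3 r) + k3.
have c1E r : 0 <= r <= a -> c1 r = r by exact: clamp_id.
have c2E r : b <= r <= B -> c2 r = r by exact: clamp_id.
have c3E r : d <= r -> c3 r = r by move=> h; rewrite /c3; exact/max_idPr.
have c1I r : 0 <= c1 r <= a by exact: clamp_in.
have c2I r : b <= c2 r <= B by exact: clamp_in.
have c3I r : d <= c3 r by rewrite /c3 le_max lexx.
have U1E r : 0 <= r <= a -> U1 r = f12 r + f13 (- r) + k1 by move=> h; rewrite /U1 c1E.
have U2E r : b <= r <= B -> U2 r = g12 r + f23 r + k2 by move=> h; rewrite /U2 c2E.
have U3E r : d <= r -> U3 r = g13 r + g23 r + k3 by move=> h; rewrite /U3 c3E.
have aa : 0 <= a <= a by rewrite lexx a0'.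
have bb : b <= b <= B by rewrite lexx bB.
have BB : b <= B <= B by rewrite lexx bB.
have P : admissible_potentials a b B d U1 U2 U3.
  split.
  - move=> x y z /andP[x0 xa] hy hz.
    have hx : 0 <= x <= a by rewrite (ltW x0).
    have hnx : - a <= - x <= 0 by rewrite lerN2 xa oppr_le0 (ltW x0).
    rewrite U1E// U2E// U3E//.
    have := gpot_le L12 P12 a0' hx (proj1 (andP hy)).
    have := gpot_le L13 P13 Na0 hnx hz.
    have := gpot_le L23 P23 bB hy hz.
    rewrite [- x + z]addrC -/f12 -/g12 -/f13 -/g13 -/f23 -/g23; lra.
  - move=> x /andP[x0 xa].
    have hx : 0 <= x <= a by rewrite (ltW x0).
    rewrite !U1E//.
    have := fpot_slope L12 P12 (ltW x0) xa.
    have Nxa : - a <= - x by lra.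
    have := fpot_nonincr L13 P13 (lexx _) Nxa.
    rewrite -/f12 -/f13; lra.
  - move=> y /[dup] hy /andP[y1 y2]; rewrite !U2E//.
    have := gpot_upper L12 P12 a0' (lexx b) y1.
    have := fpot_nonincr L23 P23 (lexx b) y1.
    rewrite -/g12 -/f23; lra.
  - move=> y /[dup] hy /andP[y1 y2]; rewrite !U2E//.
    have := gpot_lower L12 P12 a0' y1 y2.
    have := fpot_slope L23 P23 y1 y2.
    rewrite -/g12 -/f23 !add0r; lra.
  - move=> z hz; rewrite !U3E//.
    have := gpot_upper L13 P13 Na0 (lexx d) hz.
    have := gpot_upper L23 P23 bB (lexx d) hz.
    rewrite -/g13 -/g23 !add0r ![B + _]addrC; lra.
  - by rewrite U1E// U2E// /k1 /D12; lra.
  - by rewrite U2E// U3E// /k3 /D23; lra.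
exists (glue a B U1 U2 U3); split.
- have m1 : measurable_fun setT U1.
    apply: measurable_funD => //; apply: measurable_funD.
      apply: nonincreasing_measurable => // r s rs.
      apply: (fpot_nonincr L12 P12); first by case/andP: (c1I r).
      exact: clamp_homo.
    apply: nondecreasing_measurable => // r s rs.
    have := c1I s; have : c1 r <= c1 s by exact: clamp_homo.
    by move=> ? /andP[? ?]; apply: (fpot_nonincr L13 P13); rewrite lerN2.
  have m2 : measurable_fun setT U2.
    apply: measurable_funD => //; apply: measurable_funD.
      apply: nonincreasing_measurable => // r s rs.
      apply: (gpot_nonincr L12 P12 a0'); first by case/andP: (c2I r).
      exact: clamp_homo.
    apply: nonincreasing_measurable => // r s rs.
    apply: (fpot_nonincr L23 P23); first by case/andP: (c2I r).
    exact: clamp_homo.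
  have m3 : measurable_fun setT U3.
    have c3h r s : r <= s -> c3 r <= c3 s.
      by move=> rs; rewrite /c3 ge_max !le_max lexx rs/= orbT.
    apply: measurable_funD => //; apply: measurable_funD.
      apply: nonincreasing_measurable => // r s rs.
      by apply: (gpot_nonincr L13 P13 Na0) => //; exact: c3h.
    apply: nonincreasing_measurable => // r s rs.
    by apply: (gpot_nonincr L23 P23 bB) => //; exact: c3h.
  apply: measurable_fun_ifT => //; first exact: measurable_fun_ler.
  by apply: measurable_fun_ifT => //; exact: measurable_fun_ler.
- exists (`|f12 a| + `|f13 0| + `|k1| + (g12 b + `|f23 B| + `|k2|)
          + (g13 d + g23 d + `|k3|)) => r.
  have fn (F : R -> R) m t : F m <= F t -> F t <= 0 -> `|F t| <= `|F m|.
    by move=> h1 h2; rewrite !ler0_norm ?lerN2//; lra.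
  have b1 : `|U1 r| <= `|f12 a| + `|f13 0| + `|k1|.
    have /andP[l h] := c1I r.
    apply: le_trans (ler_normD _ _) _; rewrite lerD2r.
    apply: le_trans (ler_normD _ _) _; apply: lerD; apply: fn.
    - exact: (fpot_nonincr L12 P12).
    - exact: (fpot_le0 L12 P12).
    - by apply: (fpot_nonincr L13 P13); rewrite ?lerN2 ?oppr_le0.
    - by apply: (fpot_le0 L13 P13); rewrite ?lerN2 ?oppr_le0.
  have b2 : `|U2 r| <= g12 b + `|f23 B| + `|k2|.
    have /andP[l h] := c2I r.
    apply: le_trans (ler_normD _ _) _; rewrite lerD2r.
    apply: le_trans (ler_normD _ _) _; apply: lerD; last apply: fn.
    - by rewrite ger0_norm; [exact: (gpot_nonincr L12 P12 a0') | exact: (gpot_ge0 L12 P12 a0')].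
    - exact: (fpot_nonincr L23 P23).
    - exact: (fpot_le0 L23 P23).
  have b3 : `|U3 r| <= g13 d + g23 d + `|k3|.
    have l := c3I r.
    apply: le_trans (ler_normD _ _) _; rewrite lerD2r.
    apply: le_trans (ler_normD _ _) _; apply: lerD.
    - by rewrite ger0_norm; [exact: (gpot_nonincr L13 P13 Na0) | exact: (gpot_ge0 L13 P13 Na0)].
    - by rewrite ger0_norm; [exact: (gpot_nonincr L23 P23 bB) | exact: (gpot_ge0 L23 P23 bB)].
  have t1 := le_trans (normr_ge0 _) b1; have t2 := le_trans (normr_ge0 _) b2.
  have t3 := le_trans (normr_ge0 _) b3.
  rewrite /glue; case: ifP => _; [|case: ifP => _].
  - by apply: (le_trans b1); rewrite -[leRHS]addrA lerDl addr_ge0.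
  - by apply: (le_trans b2); rewrite [leRHS]addrAC lerDr addr_ge0.
  - by apply: (le_trans b3); rewrite lerDr addr_ge0.
- exact: (glue_le_ccost W P).
- move=> x y z g x0.
  have [/andP[_ xa] /andP[y1 y2] hz] := Gin _ _ _ g.
  rewrite /glue xa.
  have -> : (y <= a) = false by rewrite leNgt (lt_le_trans ab y1).
  have -> : (z <= a) = false by rewrite leNgt (lt_le_trans ad hz).
  have -> : (z <= B) = false by rewrite leNgt (lt_le_trans Bd' hz).
  have hx : 0 <= x <= a by rewrite (ltW x0) xa.
  have hy : b <= y <= B by rewrite y1 y2.
  rewrite y2 (U1E _ hx) (U2E _ hy) (U3E _ hz).
  have g1 : G12 (x, y) by exists z.
  have g2 : G13 (- x, z) by exists y; rewrite /= opprK.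
  have g3 : G23 (y, z) by exists x.
  have := pot_eq L12 A12 P12 a0' g1.
  have := pot_eq L13 A13 P13 Na0 g2.
  have := pot_eq L23 A23 P23 bB g3.
  rewrite [- x + z]addrC -/f12 -/g12 -/f13 -/g13 -/f23 -/g23; lra.
Qed.

End Existence.

(** * Quantiles and the DDI map *)

Section Quantile.
Variables (R : realType) (rho : probability (measurableTypeR R) R).
Hypothesis rho_pos : rho `[0, +oo[%classic = 1%E.
Hypothesis rho_ac : rho `<< (@lebesgue_measure R).

Let F := Defs.cdf rho.
Let G := Defs.cdf_inv rho.

Lemma atomless x : rho [set x] = 0%E.
Proof.
have h : (@lebesgue_measure R).-null_set [set x].
  apply: negligible_null_set; exists [set x]; split => //.
  exact: lebesgue_measure_set1.
exact: (rho_ac h).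
Qed.

Lemma rho_fine (A : set (measurableTypeR R)) : measurable A -> (fine (rho A))%:E = rho A.
Proof. by move=> mA; rewrite fineK// fin_num_measure. Qed.

Lemma cdf_le0 r : r <= 0 -> F r = 0.
Proof. by move=> r0; rewrite /F /Defs.cdf set_itv_ge ?measure0// bnd_simp -leNgt. Qed.

Lemma cdf_itv x y : 0 <= x -> x <= y -> rho `[x, y[%classic = (F y - F x)%:E.
Proof.
move=> x0 xy; rewrite /F /Defs.cdf.
have -> : `[0, y[%classic = `[0, x[%classic `|` `[x, y[%classic :> set R.
  by rewrite -itv_bndbnd_setU// bnd_simp.
rewrite measureU//; last first.
  by apply/seteqP; split => // z /= []; rewrite !in_itv/= => /andP[_ h1] /andP[h2 _]; lra.
by rewrite fineD ?fin_num_measure// EFinB EFinD !rho_fine// addeAC subee ?add0e// fin_num_measure.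
Qed.

Lemma cdf_homo : {homo F : x y / x <= y}.
Proof.
move=> x y xy; have [x0|x0] := leP x 0.
  by rewrite (cdf_le0 x0); exact: fine_ge0.
have : (0 <= rho `[x, y[%classic)%E by exact: measure_ge0.
by rewrite (cdf_itv (ltW x0) xy) lee_fin subr_ge0.
Qed.

Lemma cdf_ge0 x : 0 <= F x. Proof. exact: fine_ge0. Qed.

Lemma cdf_le1 x : F x <= 1.
Proof. by rewrite -lee_fin rho_fine//; exact: probability_le1. Qed.

(** Continuity of F, from the absence of atoms: the intervals around r shrink to a null point. *)
Lemma cdf_local r (e : R) : 0 < e ->
  exists2 h, 0 < h & forall x y, 0 <= x -> r - h < x -> x <= y -> y < r + h -> F y - F x < e.
Proof.
move=> e0.
pose S (n : nat) : set R := `]r - n.+1%:R^-1, r + n.+1%:R^-1[%classic.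
have capS : \bigcap_n S n = [set r].
  apply/seteqP; split => [z /= Sz|_ -> n _] /=; last first.
    have : 0 < n.+1%:R^-1 :> R by rewrite invr_gt0.
    by rewrite /S/= in_itv/=; move: n.+1%:R^-1 => u; lra.
  apply/eqP; rewrite -subr_eq0 -normr_eq0; apply/negP => /negP nz.
  have z0 : 0 < `|z - r| by rewrite lt_neqAle eq_sym nz normr_ge0.
  have [n _ hn] := near_infty_natSinv_lt (PosNum z0).
  have := Sz n I; have /= := hn n (leqnn n).
  rewrite /S/= in_itv/=; move: n.+1%:R^-1 => u h1 h2; move: h1.
  by rewrite ltNge => /negP; apply; rewrite ler_norml; lra.
have cvS : rho (S n) @[n --> \oo] --> 0%E.
  rewrite -(atomless r) -capS; apply: nonincreasing_cvg_mu.
  - by rewrite ltey_eq fin_num_measure//; exact: measurable_itv.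
  - by move=> n; exact: measurable_itv.
  - by rewrite capS.
  - move=> m n mn; apply/subsetPset => z; rewrite /S/= !in_itv/=.
    have : n.+1%:R^-1 <= m.+1%:R^-1 :> R by rewrite lef_pV2 ?posrE// ler_nat.
    by move: n.+1%:R^-1 m.+1%:R^-1 => u v; lra.
have /fine_cvgP[_ /cvgrPdist_lt/(_ e e0)[n _ /(_ n (leqnn n))]] : rho (S n) @[n --> \oo] --> (0:R)%:E by [].
rewrite /= sub0r normrN ger0_norm ?fine_ge0// => hn.
exists n.+1%:R^-1; first by rewrite invr_gt0.
move=> x y x0 h1 xy h2; apply: le_lt_trans hn.
rewrite -lee_fin -cdf_itv// rho_fine//; last exact: measurable_itv.
apply: le_measure; rewrite ?inE//; try exact: measurable_itv.
by move=> z; move: h1 h2; rewrite /S/= !in_itv/=; move: n.+1%:R^-1 => u; lra.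
Qed.

Lemma cdf_cvg1 t : t < 1 -> exists2 x, 0 <= x & t <= F x.
Proof.
move=> t1.
pose S (n : nat) : set R := `[0, n%:R[%classic.
have cupS : \bigcup_n S n = `[0, +oo[%classic.
  apply/seteqP; split => [z [n _]|z]; first by rewrite /S/= !in_itv/= andbT => /andP[].
  rewrite /= in_itv/= andbT => z0; exists (Num.truncn z).+1 => //.
  by rewrite /S/= in_itv/= z0/= truncnS_gt.
have : rho (S n) @[n --> \oo] --> 1%E.
  rewrite -rho_pos -cupS; apply: nondecreasing_cvg_mu.
  - by move=> n; exact: measurable_itv.
  - by rewrite cupS; exact: measurable_itv.
  - move=> m n mn; apply/subsetPset => z; rewrite /S/= !in_itv/= => /andP[-> /=] h.
    by rewrite (lt_le_trans h)// ler_nat.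
move=> /fine_cvgP[_ /cvgrPdist_lt/(_ (1 - t))].
rewrite subr_gt0 => /(_ t1)[n _ /(_ n (leqnn n))] /=.
move=> /ltr_distlBl h; exists n%:R => //.
by rewrite /F /Defs.cdf; rewrite -/(S n); lra.
Qed.

Let E t := [set x : R | 0 <= x /\ t <= F x].

Lemma quantile_has_inf t : t < 1 -> has_inf (E t).
Proof.
move=> /cdf_cvg1[x x0 tx]; split; first by exists x.
by exists 0 => y [].
Qed.

Lemma quantile_ge0 t : 0 <= G t.
Proof.
(* If level t is never reached, the infimum of the empty set is 0 by default. *)
rewrite /G /Defs.cdf_inv -/F -/(E t); have [->|/set0P ne] := eqVneq (E t) set0.
  by rewrite inf0.
by apply: lb_le_inf => // y [].
Qed.

Lemma quantile_le t x : t < 1 -> 0 <= x -> t <= F x -> G t <= x.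
Proof.
by move=> t1 x0 tx; apply: ge_inf; [case: (quantile_has_inf t1) | split].
Qed.

Lemma cdf_quantile_ge t : t < 1 -> t <= F (G t).
Proof.
move=> t1; rewrite leNgt; apply/negP => lt.
have e0 : 0 < t - F (G t) by lra.
have [h h0 H] := @cdf_local (G t) _ e0.
have h20 : 0 < h / 2 by lra.
have [x [x0 tx] xh] := inf_adherent h20 (quantile_has_inf t1).
have gx : G t <= x by exact: quantile_le.
have := H (G t) x (quantile_ge0 t); rewrite /G /Defs.cdf_inv -/F -/(E t) in xh gx *.
by move=> /(_ ltac:(lra) gx ltac:(lra)); rewrite -/F; lra.
Qed.

Lemma cdf_quantile t : 0 <= t -> t < 1 -> F (G t) = t.
Proof.
move=> t0 t1; apply/eqP; rewrite eq_le cdf_quantile_ge// andbT leNgt; apply/negP => lt.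
have e0 : 0 < F (G t) - t by lra.
have [h h0 H] := @cdf_local (G t) _ e0.
have G0 : 0 < G t.
  by rewrite ltNge; apply/negP => g0; move: lt; rewrite (cdf_le0 g0); lra.
pose x := Num.max 0 (G t - h / 2).
have x0 : 0 <= x by rewrite /x le_max lexx.
have xG : x < G t by rewrite /x gt_max G0/=; lra.
have xh : G t - h < x by rewrite /x lt_max; apply/orP; right; lra.
have := H x (G t) x0 xh (ltW xG) ltac:(lra) => hx.
have := @quantile_le t x t1 x0 ltac:(lra); lra.
Qed.

Lemma quantile_galois t x : t < 1 -> 0 <= x -> (G t <= x) = (t <= F x).
Proof.
move=> t1 x0; apply/idP/idP; last exact: quantile_le.
by move=> h; apply: le_trans (cdf_quantile_ge t1) (cdf_homo h).
Qed.

Lemma quantile_homo s t : s <= t -> t < 1 -> G s <= G t.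
Proof.
move=> st t1; rewrite quantile_galois ?quantile_ge0//; first by apply: le_trans st (cdf_quantile_ge t1).
exact: le_lt_trans st t1.
Qed.

End Quantile.

#[local] Instance ae_probability_filter (R : realType)
    (rho : probability (measurableTypeR R) R) :
  Filter (nbhs (almost_everywhere rho)) := ae_filter_ringOfSetsType _.

Lemma nonincreasing_in_measurable (R : realType) (D : set R) (f : R -> R) :
  measurable D -> is_interval D ->
  (forall s t, D s -> D t -> s <= t -> f t <= f s) -> measurable_fun D f.
Proof.
move=> mD iD fD.
apply: (measurability (@RGenCInfty.G R)) => [|/= _ [_] [r] -> <-].
  exact: RGenCInfty.measurableE.
apply: is_interval_measurable => s t/= [Ds fs] [Dt ft] u /andP[su ut].
have Du : D u by apply: iD Ds Dt _ _; rewrite su ut.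
move: fs ft; rewrite !in_itv/= !andbT => fs ft; split => //.
by rewrite (le_trans ft)// fD.
Qed.

Lemma eq_measure_ae d (T : measurableType d) (R : realType)
    (mu : {measure set T -> \bar R}) (A B : set T) :
  measurable A -> measurable B -> {ae mu, forall x, A x <-> B x} -> mu A = mu B.
Proof.
move=> mA mB [N [mN N0 sub]].
have half (X Y : set T) : measurable X -> measurable Y ->
    (forall x, ~ N x -> X x -> Y x) -> (mu X <= mu Y)%E.
  move=> mX mY XY; rewrite -[leRHS]adde0 -N0.
  apply: le_trans _ (measureU2 mu mY mN); rewrite le_measure ?inE//; first exact: measurableU.
  by move=> x Xx; have [Nx|Nx] := pselect (N x); [right|left; exact: XY].
have AB x : ~ N x -> (A x <-> B x) by move=> /(contra_not (@sub x)); rewrite notK.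
by apply/eqP; rewrite eq_le !half// => x /AB[].
Qed.

(** * Levels of the distribution function under rho *)

Section Law.
Variables (R : realType) (rho : probability (measurableTypeR R) R).
Hypothesis rho_pos : rho `[0, +oo[%classic = 1%E.
Hypothesis rho_ac : rho `<< (@lebesgue_measure R).

Let F := Defs.cdf rho.
Let G := Defs.cdf_inv rho.

Let FG u : 0 <= u -> u < 1 -> F (G u) = u.
Proof. exact: cdf_quantile. Qed.

Lemma cdf0 : F 0 = 0. Proof. exact: cdf_le0. Qed.

(** The other end of the stretch where F equals u. The null interval from [G u] to [H u] is the gap
    of the support at level u. *)
Definition upper_quantile (u : R) : R := sup [set x | F x <= u].
Let H := upper_quantile.

Lemma upper_has_sup u : 0 <= u -> u < 1 -> has_sup [set x | F x <= u].
Proof.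
move=> u0 u1; split; first by exists 0; rewrite /= cdf0.
have v1 : (u + 1) / 2 < 1 by lra.
have [y y0 hy] := cdf_cvg1 rho_pos v1.
exists y => x /= Fx; rewrite leNgt; apply/negP => /ltW/(cdf_homo rho).
by rewrite -/F => h; move: hy; rewrite -/F; lra.
Qed.

Lemma le_upper u x : 0 <= u -> u < 1 -> F x <= u -> x <= H u.
Proof. by move=> u0 u1 Fx; apply: ub_le_sup => //; case: (upper_has_sup u0 u1). Qed.

Lemma upper_ge0 u : 0 <= u -> u < 1 -> 0 <= H u.
Proof. by move=> u0 u1; apply: le_upper => //; rewrite cdf0. Qed.

Lemma cdf_upper u : 0 <= u -> u < 1 -> F (H u) = u.
Proof.
move=> u0 u1; have g := upper_ge0 u0 u1.
have gF : F (G u) = u by exact: cdf_quantile.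
apply/eqP; rewrite eq_le; apply/andP; split; last first.
  rewrite -{1}gF; apply: cdf_homo; apply: le_upper => //.
  by rewrite gF.
rewrite leNgt; apply/negP => lt.
have e0 : 0 < F (H u) - u by lra.
have [h h0 Hh] := @cdf_local _ _ rho_ac (H u) _ e0.
have [x Fx xh] := sup_adherent h0 (upper_has_sup u0 u1).
have xH : x <= H u by exact: le_upper.
have [x0|x0] := leP 0 x.
  have := Hh x (H u) x0 xh xH; rewrite -/F => /(_ ltac:(lra)).
  by move: Fx => /=; lra.
have {}xh : H u - h < x by exact: xh.
have := Hh 0 (H u) (lexx 0) ltac:(lra) g ltac:(lra); rewrite -/F cdf0; lra.
Qed.

Lemma ae_ge0 : {ae rho, forall x, 0 <= x}.
Proof.
exists (~` `[0, +oo[%classic); split; first by apply: measurableC; exact: measurable_itv.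
  by rewrite probability_setC ?rho_pos ?subee//; exact: measurable_itv.
by move=> x /= nx; rewrite in_itv/= andbT.
Qed.

Lemma ae_not_itv (x y : R) : 0 <= x -> x <= y -> F x = F y ->
  {ae rho, forall r, ~ (x <= r < y)}.
Proof.
move=> x0 xy e; exists `[x, y[%classic; split; first exact: measurable_itv.
  by rewrite cdf_itv// -/F e subrr.
by move=> r /= /contrapT; rewrite in_itv.
Qed.

Lemma ae_not_point (x : R) : {ae rho, forall r, r != x}.
Proof.
exists [set x]; split => //; first exact: (atomless rho_ac).
by move=> r /= /negP; rewrite negbK => /eqP.
Qed.

Lemma ae_level u : 0 <= u -> u < 1 -> {ae rho, forall r, F r != u}.
Proof.
move=> u0 u1.
have G0 : 0 <= G u by exact: quantile_ge0.
have GH : G u <= H u by apply: le_upper => //; rewrite FG.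
have e : F (G u) = F (H u) by rewrite cdf_upper// FG.
near=> r; apply/eqP => Fr.
have r0 : 0 <= r by near: r; exact: ae_ge0.
have n1 : ~ (G u <= r < H u) by near: r; exact: ae_not_itv.
have /eqP n2 : r != H u by near: r; exact: ae_not_point.
have r1 : G u <= r by apply: quantile_le => //; rewrite -/F Fr.
have r2 : r <= H u by apply: le_upper => //; rewrite Fr.
by apply: n1; rewrite r1 lt_neqAle r2 andbT; apply/eqP.
Unshelve. all: by end_near. Qed.

Lemma measurable_cdf : measurable_fun setT F.
Proof. by apply: nondecreasing_measurable => //; exact: cdf_homo. Qed.

Definition level_itv (p q : R) : set R := [set x | 0 <= x /\ p <= F x < q].

Lemma level_itvE p q : p < 1 -> q < 1 -> level_itv p q = `[G p, G q[%classic.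
Proof.
move=> p1 q1; apply/seteqP; split => x /=; rewrite in_itv/=.
  by case=> x0; rewrite -(quantile_galois rho_pos rho_ac p1 x0) !ltNge (quantile_galois rho_pos rho_ac q1 x0).
move=> /andP[h1 h2].
have x0 : 0 <= x by apply: le_trans h1; exact: quantile_ge0.
by split => //; rewrite -(quantile_galois rho_pos rho_ac p1 x0) h1 ltNge -(quantile_galois rho_pos rho_ac q1 x0) -ltNge.
Qed.

Lemma level_itv_lt1 p q : 0 <= p -> p <= q -> q < 1 -> rho (level_itv p q) = (q - p)%:E.
Proof.
move=> p0 pq q1; have p1 : p < 1 by lra.
rewrite level_itvE// cdf_itv ?quantile_ge0//; last exact: quantile_homo.
by rewrite -/F -/G !FG//; lra.
Qed.

Lemma measurable_level p q : measurable (level_itv p q).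
Proof.
have -> : level_itv p q = `[0, +oo[%classic `&` (F @^-1` `[p, q[%classic).
  by apply/seteqP; split => x /=; rewrite !in_itv/= andbT.
apply: measurableI; first exact: measurable_itv.
by rewrite -[X in measurable X]setTI; apply: measurable_cdf => //; exact: measurable_itv.
Qed.

(** If the levels >= 1 had mass m > 0, the disjoint levels below 1 - m/2 would bring the total to 1
    + m/2. *)
Lemma ae_lt1 : {ae rho, forall r, F r < 1}.
Proof.
pose A : set R := [set x | 1 <= F x].
have mA : measurable A.
  rewrite (_ : A = F @^-1` `[1, +oo[%classic); last by apply/seteqP; split => x /=; rewrite in_itv/= andbT.
  by rewrite -[X in measurable X]setTI; apply: measurable_cdf => //; exact: measurable_itv.
exists A; split => //; last by move=> x /= /negP; rewrite -leNgt.
apply/eqP; rewrite eq_le measure_ge0 andbT -rho_fine// lee_fin leNgt; apply/negP => a0.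
have a1 : fine (rho A) <= 1 by rewrite -lee_fin rho_fine// probability_le1.
pose u := 1 - fine (rho A) / 2.
have u0 : 0 <= u by rewrite /u; lra.
have u1 : u < 1 by rewrite /u; lra.
have d : A `&` level_itv 0 u = set0.
  by apply/seteqP; split => // x [/= h1 [_ /andP[_ h2]]]; have := lt_trans (le_lt_trans h1 h2) u1; rewrite ltxx.
have le1 : (rho (A `|` level_itv 0 u) <= 1)%E.
  by apply: probability_le1; apply: measurableU => //; exact: measurable_level.
have e : (rho (A `|` level_itv 0 u) = rho A + rho (level_itv 0 u))%E.
  by apply: measureU => //; exact: measurable_level.
move: le1; rewrite e -(rho_fine rho mA) level_itv_lt1// -EFinD lee_fin /u; lra.
Qed.

Lemma level_itv_measure p q : 0 <= p -> p <= q -> q <= 1 -> rho (level_itv p q) = (q - p)%:E.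
Proof.
move=> p0 pq; rewrite le_eqVlt => /orP[/eqP qe|]; last exact: level_itv_lt1.
rewrite qe in pq *.
have [p1|p1] := ltP p 1; last first.
  have -> : p = 1 by lra.
  rewrite subrr (_ : level_itv 1 1 = set0) ?measure0//.
  by apply/seteqP; split => // x [_ /andP[h1 h2]]; have := le_lt_trans h1 h2; rewrite ltxx.
(* [cdf_inv] at level 1 may be the default infimum of an empty set, so q = 1 is reached through the
   complement. *)
have e : rho (~` level_itv 0 p) = rho (level_itv p 1).
  apply: eq_measure_ae; [by apply: measurableC; exact: measurable_level|exact: measurable_level|].
  near=> x.
  have x0 : 0 <= x by near: x; exact: ae_ge0.
  have x1 : F x < 1 by near: x; exact: ae_lt1.
  have f0 : 0 <= F x by exact: cdf_ge0.
  split; last by move=> [_ /andP[h1 h2]] [_ /andP[h3 h4]]; have := le_lt_trans h1 h4; rewrite ltxx.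
  move=> h; split => //; rewrite x1 andbT leNgt; apply/negP => h2.
  by apply: h; split => //; rewrite h2 f0.
rewrite -e probability_setC; last exact: measurable_level.
by rewrite level_itv_lt1 ?subr0// -EFinB.
Unshelve. all: by end_near. Qed.

(** If G (F r) < r, a rational q between them has F q = F r, so r lies in one of countably many null
    level sets. *)
Lemma ae_quantile_cdf : {ae rho, forall r, G (F r) = r}.
Proof.
have : {ae rho, forall r, forall n : nat,
    if unpickle n is Some q then F r != F (ratr (q : rat)) else true}.
  apply: ae_foralln => n; case: unpickle => [q|]; last exact: aeW.
  have [q1|q1] := ltP (F (ratr q)) 1; first by apply: ae_level => //; exact: cdf_ge0.
  by apply: filterS ae_lt1 => r r1; rewrite lt_eqF// (lt_le_trans r1).
move=> aeq; apply: filterS3 ae_ge0 ae_lt1 aeq => r r0 r1 rq.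
have Gr : G (F r) <= r by exact: quantile_le.
apply/eqP; rewrite eq_le Gr leNgt; apply/negP => lt.
have [q] := rat_in_itvoo lt; rewrite in_itv/= => /andP[q1 q2].
have := rq (pickle q); rewrite pickleK => /eqP; apply.
apply/eqP; rewrite eq_le [X in _ && X](cdf_homo _ (ltW q2)) andbT.
rewrite -{1}(@FG (F r))//; last exact: cdf_ge0.
exact: cdf_homo (ltW q1).
Qed.

End Law.

(** With w = F r and f = F x, the condition [T x <= r] cuts each third of levels at p1, p2 or p3,
    the clipped solutions of 2/3 - f = w, 4/3 - f = w and f - 2/3 = w. The pieces have total length
    w, which is why T preserves rho. The level w + 2/3 is excluded because the last piece is
    half-open. *)
Lemma DDI_levels (R : realFieldType) (w : R) : 0 <= w <= 1 ->
  exists p1 p2 p3, [/\ 0 <= p1 <= 1 / 3, 1 / 3 <= p2 <= 2 / 3, 2 / 3 <= p3 <= 1,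
    (1 / 3 - p1) + (2 / 3 - p2) + (p3 - 2 / 3) = w &
    [/\ forall f, 0 <= f -> f < 1 / 3 -> (p1 <= f) = (2 / 3 - f <= w),
       forall f, 1 / 3 < f -> f < 2 / 3 -> (p2 <= f) = (4 / 3 - f <= w) &
       forall f, 2 / 3 < f -> f < 1 -> f != w + 2 / 3 -> (f < p3) = (f - 2 / 3 <= w)]].
Proof.
move=> /andP[w0 w1].
have [w3|w3] := leP w (1 / 3).
  exists (1 / 3), (2 / 3), (w + 2 / 3); split; try lra.
  split=> f *; [by apply/idP/idP; lra|by apply/idP/idP; lra|].
  by rewrite lt_neqAle (_ : f != _)//=; apply/idP/idP; lra.
have [w23|w23] := leP w (2 / 3).
  exists (2 / 3 - w), (2 / 3), 1; split; try lra.
  by split=> f *; apply/idP/idP; lra.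
exists 0, (4 / 3 - w), 1; split; try lra.
by split=> f *; apply/idP/idP; lra.
Qed.

Lemma three_levels (R : realFieldType) (p1 p2 p3 f : R) :
  0 <= p1 <= 1 / 3 -> 1 / 3 <= p2 <= 2 / 3 -> 2 / 3 <= p3 <= 1 ->
  let L := [|| p1 <= f < 1 / 3, p2 <= f < 2 / 3 | 2 / 3 <= f < p3] in
  [/\ f < 1 / 3 -> L = (p1 <= f), 1 / 3 < f -> f < 2 / 3 -> L = (p2 <= f) &
     2 / 3 < f -> L = (f < p3)].
Proof.
move=> /andP[a1 b1] /andP[a2 b2] /andP[a3 b3] /=; split.
- move=> h; apply/or3P/idP => [[] /andP[k1 k2]|k]; try lra.
  by constructor 1; rewrite k h.
- move=> h1 h2; apply/or3P/idP => [[] /andP[k1 k2]|k]; try lra.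
  by constructor 2; rewrite k h2.
- move=> h; apply/or3P/idP => [[] /andP[k1 k2]|k]; try lra.
  by constructor 3; rewrite k ltW.
Qed.

Lemma DDI_values_lt1 (R : realFieldType) (f : R) : 0 <= f -> f < 1 ->
  [/\ 2 / 3 - f < 1, 1 / 3 < f -> 4 / 3 - f < 1 & f - 2 / 3 < 1].
Proof. by move=> *; split=> *; lra. Qed.

(** * The DDI map: measurability, invariance of rho, orbits *)

Section DDImap.
Variables (R : realType) (rho : probability (measurableTypeR R) R) (s1 s2 : R).
Hypothesis rho_pos : rho `[0, +oo[%classic = 1%E.
Hypothesis rho_ac : rho `<< (@lebesgue_measure R).
Hypothesis s12 : s1 < s2.
Hypothesis rho1 : rho `[0, s1[%classic = (1 / 3)%:E.
Hypothesis rho2 : rho `[s1, s2[%classic = (1 / 3)%:E.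

Let F := Defs.cdf rho.
Let G := Defs.cdf_inv rho.
Let T := DDI rho s1 s2.

Let FG u : 0 <= u -> u < 1 -> F (G u) = u.
Proof. exact: cdf_quantile. Qed.

Lemma cdf_s1 : F s1 = 1 / 3.
Proof. by rewrite /F /Defs.cdf rho1. Qed.

Lemma s1_ge0 : 0 <= s1.
Proof.
rewrite leNgt; apply/negP => /ltW/(cdf_le0 rho); rewrite -/F cdf_s1; lra.
Qed.

Lemma cdf_s2 : F s2 = 2 / 3.
Proof.
have := rho2; rewrite (cdf_itv _ s1_ge0 (ltW s12)) -/F cdf_s1 => -[]; lra.
Qed.

Lemma cdf_lt x y : F x < F y -> x < y.
Proof. by rewrite !ltNge; apply: contra => /(cdf_homo rho). Qed.

Lemma DDI_low x : F x < 1 / 3 -> T x = G (2 / 3 - F x).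
Proof. by move=> h; rewrite /T /DDI (@cdf_lt x s1) ?cdf_s1. Qed.

Lemma DDI_mid x : 1 / 3 < F x -> F x < 2 / 3 -> T x = G (4 / 3 - F x).
Proof.
move=> h1 h2; rewrite /T /DDI (@cdf_lt x s2) ?cdf_s2//.
by rewrite ltNge ltW//= cdf_lt// cdf_s1.
Qed.

Lemma DDI_high x : 2 / 3 < F x -> T x = G (F x - 2 / 3).
Proof.
move=> h; have x2 : s2 < x by apply: cdf_lt; rewrite cdf_s2.
by rewrite /T /DDI ltNge (ltW (lt_trans s12 x2))/= ltNge (ltW x2).
Qed.

Lemma DDI_ge0 x : 0 <= T x.
Proof. by rewrite /T /DDI; case: ifP => _; [|case: ifP => _]; exact: quantile_ge0. Qed.

Lemma measurable_DDI : measurable_fun setT T.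
Proof.
have mF := measurable_cdf rho.
(* Where F is still 1/3 to the right of s1, the middle branch evaluates G at level 1, possibly a
   default value; beyond, the level is below 1 and monotonicity of G applies. *)
pose T2 x := if F x <= 1 / 3 then G 1 else G (4 / 3 - F x).
have -> : T = fun x => if x < s1 then G (2 / 3 - F x)
    else if x < s2 then T2 x else G (F x - 2 / 3).
  apply/funext => x; rewrite /T /DDI; case: ltP => // xs1; case: ifP => // _.
  rewrite /T2; case: ifPn => // h.
  have := cdf_homo rho xs1; rewrite -/F cdf_s1 => h'.
  have e : F x = 1 / 3 by lra.
  by rewrite -/F -/G e; congr G; lra.
apply: measurable_fun_ifT; first exact: measurable_fun_ltr.
  apply: nonincreasing_measurable => // x y xy.
  have h := cdf_homo rho xy; have h0 := cdf_ge0 rho x.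
  by apply: quantile_homo => //; rewrite -/F in h h0 *; lra.
apply: measurable_fun_ifT; first exact: measurable_fun_ltr.
  apply: measurable_fun_if => //; first exact: measurable_fun_ler.
  rewrite setTI; apply: nonincreasing_in_measurable.
  - rewrite -[X in measurable X]setTI; exact: measurable_fun_ler.
  - move=> x y /= /negbT; rewrite -ltNge => hx _ z /andP[xz _].
    by apply/negbTE; rewrite -ltNge (lt_le_trans hx)// cdf_homo.
  - move=> x y /= /negbT; rewrite -ltNge => hx _ xy.
    have h := cdf_homo rho xy; rewrite -/F in h.
    by apply: quantile_homo => //; lra.
apply: nondecreasing_measurable => // x y xy.
have h := cdf_homo rho xy; have h1 := cdf_le1 rho y.
by apply: quantile_homo => //; rewrite -/F in h h1 *; lra.
Qed.

Lemma DDI_cdf r : 0 <= r -> rho [set x | T x <= r] = (F r)%:E.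
Proof.
move=> r0; pose w := F r.
have w0 : 0 <= w by exact: cdf_ge0.
have w1 : w <= 1 by exact: cdf_le1.
have [|p1 [p2 [p3 [q1 q2 q3 p123 [P1 P2 P3]]]]] := @DDI_levels R w; first by rewrite w0 w1.
pose A1 := level_itv rho p1 (1 / 3); pose A2 := level_itv rho p2 (2 / 3).
pose A3 := level_itv rho (2 / 3) p3.
have mA1 : measurable A1 by exact: measurable_level.
have mA2 : measurable A2 by exact: measurable_level.
have mA3 : measurable A3 by exact: measurable_level.
have -> : rho [set x | T x <= r] = rho ((A1 `|` A2) `|` A3).
  apply: eq_measure_ae.
  - have -> : [set x | T x <= r] = T @^-1` `]-oo, r]%classic.
      by apply/seteqP; split => x /=; rewrite in_itv.
    by rewrite -[X in measurable X]setTI; apply: measurable_DDI => //; exact: measurable_itv.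
  - by apply: measurableU => //; exact: measurableU.
  have h4 : {ae rho, forall x, F x != w + 2 / 3}.
    have [h|h] := ltP (w + 2 / 3) 1; first by apply: ae_level => //; lra.
    by apply: filterS (ae_lt1 rho_pos rho_ac) => x; rewrite -/F => hx; apply/eqP; lra.
  have h2 : {ae rho, forall x, F x != 1 / 3} by apply: ae_level => //; lra.
  have h3 : {ae rho, forall x, F x != 2 / 3} by apply: ae_level => //; lra.
  near=> x.
  have x0 : 0 <= x by near: x; exact: ae_ge0.
  have x1 : F x < 1 by near: x; exact: ae_lt1.
  have x2 : F x != 1 / 3 by near: x.
  have x3 : F x != 2 / 3 by near: x.
  have x4 : F x != w + 2 / 3 by near: x.
  have f0 : 0 <= F x by exact: cdf_ge0.
  have L p q : level_itv rho p q x = (p <= F x < q) :> Prop.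
    by apply/propext; split => [[]|].
  rewrite /A1 /A2 /A3 /setU /= !L.
  have gal t : t < 1 -> (G t <= r) = (t <= w) by move=> t1; exact: quantile_galois.
  have [v1 v2 v3] := DDI_values_lt1 f0 x1.
  have [Q1 Q2 Q3] := three_levels (F x) q1 q2 q3.
  suff -> : (T x <= r) = [|| p1 <= F x < 1 / 3, p2 <= F x < 2 / 3 | 2 / 3 <= F x < p3].
    split=> [/or3P[] h|[[h|h]|h]]; first [by left; left | by left; right | by right | idtac].
    - by rewrite h.
    - by rewrite h orbT.
    - by rewrite h !orbT.
  have /orP[l|g] := lt_total x2; first by rewrite Q1// DDI_low// gal// P1.
  have /orP[l|g2] := lt_total x3; first by rewrite Q2// DDI_mid// gal ?v2// P2.
  by rewrite Q3// DDI_high// gal// P3.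
have m1 : rho A1 = (1 / 3 - p1)%:E by apply: level_itv_measure => //; lra.
have m2 : rho A2 = (2 / 3 - p2)%:E by apply: level_itv_measure => //; lra.
have m3 : rho A3 = (p3 - 2 / 3)%:E by apply: level_itv_measure => //; lra.
have -> : (rho ((A1 `|` A2) `|` A3) = rho A1 + rho A2 + rho A3)%E.
  have e : (rho (A1 `|` A2) = rho A1 + rho A2)%E.
    apply: measureU => //; apply/seteqP; split => // x [[_ /andP[_ h1]] [_ /andP[h2 _]]].
    by move: h1 h2; move: (Defs.cdf rho x) => f; lra.
  rewrite -e; apply: measureU => //; first exact: measurableU.
  by apply/seteqP; split => // x [[|] [_ /andP[_ h1]] [_ /andP[h2 _]]];
    move: h1 h2; move: (Defs.cdf rho x) => f; lra.
by rewrite m1 m2 m3 -!EFinD p123.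
Unshelve. all: by end_near. Qed.

Lemma DDI_preserves (A : set (measurableTypeR R)) : measurable A -> rho (T @^-1` A) = rho A.
Proof.
have mT : measurable_fun setT (T : measurableTypeR R -> measurableTypeR R).
  exact: measurable_DDI.
pose X : {mfun (measurableTypeR R) >-> (measurableTypeR R)} :=
  HB.pack (T : measurableTypeR R -> measurableTypeR R) (isMeasurableFun.Build _ _ _ _ _ mT).
suff : forall A, measurable A -> distribution rho X A = rho A by apply.
have itvE r : (rho `]r, +oo[%classic = (1 - F r)%:E)%E.
  have -> : rho `]r, +oo[%classic = rho (~` `[0, r[%classic).
    apply: eq_measure_ae.
    - exact: measurable_itv.
    - by apply: measurableC; exact: measurable_itv.
    apply: filterS2 (ae_ge0 rho_pos) (ae_not_point rho_ac r) => x x0 xr /=.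
    have e : (r < x) = (r <= x) by rewrite lt_neqAle eq_sym xr.
    by rewrite !in_itv/= andbT x0/= e leNgt; split => /negP.
  rewrite probability_setC; last exact: measurable_itv.
  by rewrite EFinB; congr (_ - _)%E; apply/esym/rho_fine; exact: measurable_itv.
move=> {}A mA; apply: (@measure_unique _ R (measurableTypeR R) (@RGenOInfty.G R)
  (fun n => `] - n%:R, +oo[%classic) _ _ _ _ (distribution rho X) rho _ _ A mA).
- exact: (RGenOInfty.measurableE R).
- move=> _ _ [x ->] [y ->]; exists (Num.max x y).
  apply/seteqP; split => z /=; rewrite !in_itv/= !andbT gt_max; last by case/andP.
  by case=> -> ->.
- by move=> n; exists (- n%:R).
- apply/seteqP; split => // z _; exists (Num.truncn `|z|).+1 => //=.
  rewrite in_itv/= andbT ltrNl; apply: le_lt_trans (truncnS_gt _).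
  by rewrite -normrN ler_norm.
- move=> _ [r ->]; apply: (@eq_trans _ _ (1 - F r)%:E); last exact/esym/itvE.
  change (rho (T @^-1` `]r, +oo[%classic) = (1 - F r)%:E).
  have -> : T @^-1` `]r, +oo[%classic = ~` [set x | T x <= r].
    by apply/seteqP; split => x /=; rewrite in_itv/= andbT ltNge => /negP.
  have mT' : measurable ([set x | T x <= r] : set (measurableTypeR R)).
    have -> : [set x | T x <= r] = T @^-1` `]-oo, r]%classic.
      by apply/seteqP; split => x /=; rewrite in_itv.
    by rewrite -[X in measurable X]setTI; exact: (mT measurableT _ (measurable_itv _)).
  rewrite probability_setC// EFinB; congr (_ - _)%E.
  have [r0|r0] := leP 0 r; first exact: DDI_cdf.
  have -> : F r = 0 by exact: cdf_le0 (ltW r0).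
  rewrite (_ : [set x | T x <= r] = set0) ?measure0//.
  apply/seteqP; split => // x /=; have := DDI_ge0 x; lra.
- by move=> n; rewrite ltey_eq fin_num_measure//; exact: measurable_itv.
Qed.

(** An orbit is determined by the level t of its lowest point; the three cases say where in the
    orbit x sits. *)
Lemma DDI_triple x : 0 < F x -> F x < 1 -> F x != 1 / 3 -> F x != 2 / 3 -> G (F x) = x ->
  exists2 t, 0 < t < 1 / 3 &
   [\/ [/\ x = G t, T x = G (2 / 3 - t) & T (T x) = G (2 / 3 + t)],
       [/\ x = G (2 / 3 - t), T x = G (2 / 3 + t) & T (T x) = G t] |
       [/\ x = G (2 / 3 + t), T x = G t & T (T x) = G (2 / 3 - t)]].
Proof.
move=> f0 f1 f2 f3 Gx.
have [l|g] := ltP (F x) (1 / 3).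
  exists (F x); first by rewrite f0.
  have e := DDI_low l; have fe : F (T x) = 2 / 3 - F x by rewrite e FG//; lra.
  constructor 1; split => //; rewrite DDI_mid ?fe; try lra.
  by congr G; lra.
have {}g : 1 / 3 < F x by rewrite lt_neqAle eq_sym f2.
have [l|g2] := ltP (F x) (2 / 3).
  exists (2 / 3 - F x); first by lra.
  have e := DDI_mid g l; have fe : F (T x) = 4 / 3 - F x by rewrite e FG//; lra.
  constructor 2; split; first by rewrite -{1}Gx; congr G; lra.
    by rewrite e; congr G; lra.
  by rewrite DDI_high ?fe; [congr G; lra | lra].
have {}g2 : 2 / 3 < F x by rewrite lt_neqAle eq_sym f3.
exists (F x - 2 / 3); first by lra.
have e := DDI_high g2; have fe : F (T x) = F x - 2 / 3 by rewrite e FG//; lra.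
constructor 3; split => //; first by rewrite -{1}Gx; congr G; lra.
by rewrite DDI_low ?fe//; lra.
Qed.

End DDImap.

(** * Separation of the three thirds *)

Lemma poly3_collinear (R : realType) (x y z : R) : 0 < y + z ->
  (0 <= poly3 x y z) = collinear_stable x y z.
Proof.
move=> yz; have -> : poly3 x y z =
  (y + z) * (y * z * (z - y) - (x * (z ^+ 2 + 5 * y * z + y ^+ 2) + x ^+ 3)).
  by rewrite /poly3; ring.
by rewrite pmulr_rge0// subr_ge0.
Qed.

Lemma poly3_closed (R : realType) (a b d : R) :
  (forall e, 0 < e -> exists x y z, [/\ `|a - x| <= e, `|b - y| <= e, `|d - z| <= e
     & 0 <= poly3 x y z]) -> 0 <= poly3 a b d.
Proof.
move=> H.
have /choice[f fP] : forall n : nat, exists p : R * R * R, [/\ `|a - p.1.1| <= n.+1%:R^-1,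
   `|b - p.1.2| <= n.+1%:R^-1, `|d - p.2| <= n.+1%:R^-1 & 0 <= poly3 p.1.1 p.1.2 p.2].
  move=> n; have e0 : 0 < n.+1%:R^-1 :> R by rewrite invr_gt0.
  by have [x [y [z h]]] := H _ e0; exists (x, y, z).
have cv (g : nat -> R) (l : R) : (forall n, `|l - g n| <= n.+1%:R^-1) -> g n @[n --> \oo] --> l.
  move=> gl; apply/cvgrPdist_le => e e0.
  have [N _ hN] := near_infty_natSinv_lt (PosNum e0).
  by exists N => // n /hN /ltW; apply: le_trans.
have c1 : (f n).1.1 @[n --> \oo] --> a by apply: cv => n; have [] := fP n.
have c2 : (f n).1.2 @[n --> \oo] --> b by apply: cv => n; have [] := fP n.
have c3 : (f n).2 @[n --> \oo] --> d by apply: cv => n; have [] := fP n.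
have E (x y z : R) : poly3 x y z = y * ((z - x) * (z - x) * (z - x))
   - x * ((z + y) * (z + y) * (z + y)) - z * ((x + y) * (x + y) * (x + y)).
  by rewrite /poly3; ring.
have c : poly3 (f n).1.1 (f n).1.2 (f n).2 @[n --> \oo] --> poly3 a b d.
  rewrite E; under eq_fun do rewrite E.
  have c31 : (f n).2 - (f n).1.1 @[n --> \oo] --> d - a by exact: cvgB.
  have c32 : (f n).2 + (f n).1.2 @[n --> \oo] --> d + b by exact: cvgD.
  have c12 : (f n).1.1 + (f n).1.2 @[n --> \oo] --> a + b by exact: cvgD.
  apply: cvgB; last by apply: cvgM => //; apply: cvgM => //; apply: cvgM.
  apply: cvgB; first by apply: cvgM => //; apply: cvgM => //; apply: cvgM.
  by apply: cvgM => //; apply: cvgM => //; apply: cvgM.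
by apply: (cvgr_to_ge c); apply: nearW => n; have [] := fP n.
Qed.

Lemma ae_product_meet (R : realType) (rho : probability (measurableTypeR R) R)
    (A1 A2 A3 : set (measurableTypeR R)) (P : R3 R -> Prop) :
  measurable A1 -> measurable A2 -> measurable A3 ->
  (0 < rho A1)%E -> (0 < rho A2)%E -> (0 < rho A3)%E ->
  {ae ((rho \x rho) \x rho)%E, forall x, P x} ->
  exists x y z, [/\ A1 x, A2 y, A3 z & P ((x, y), z)].
Proof.
move=> m1 m2 m3 p1 p2 p3 [N [mN N0 sub]]; apply: contrapT => H.
have sN : (A1 `*` A2) `*` A3 `<=` N.
  move=> [[x y] z] [[/= Ax Ay] Az]; apply: sub => /= Pxyz.
  by apply: H; exists x, y, z.
have : (((rho \x rho) \x rho) ((A1 `*` A2) `*` A3) <= ((rho \x rho) \x rho) N)%E.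
  by apply: le_measure; rewrite ?inE//; apply: measurableX => //; exact: measurableX.
have e2 : (((rho \x rho) \x rho) ((A1 `*` A2) `*` A3) = rho A1 * rho A2 * rho A3)%E.
  rewrite product_measure1E//; last exact: measurableX.
  by congr (_ * _)%E; exact: product_measure1E.
by rewrite N0 e2; apply/negP; rewrite -ltNge !mule_gt0.
Qed.

Section Separation.
Variables (R : realType) (rho : probability (measurableTypeR R) R) (s1 s2 : R).
Hypothesis rho_pos : rho `[0, +oo[%classic = 1%E.
Hypothesis rho_ac : rho `<< (@lebesgue_measure R).
Hypothesis s12 : s1 < s2.
Hypothesis rho1 : rho `[0, s1[%classic = (1 / 3)%:E.
Hypothesis rho2 : rho `[s1, s2[%classic = (1 / 3)%:E.
Hypothesis stable : {ae ((rho \x rho) \x rho)%E, forall x : R3 R,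
     (0 <= x.1.1 <= s1) && (s1 <= x.1.2 <= s2) && (s2 <= x.2) ->
     0 <= poly3 x.1.1 x.1.2 x.2}.

Let F := Defs.cdf rho.
Let G := Defs.cdf_inv rho.
Let H := upper_quantile rho.

Let FG u : 0 <= u -> u < 1 -> F (G u) = u. Proof. exact: cdf_quantile. Qed.
Let FH u : 0 <= u -> u < 1 -> F (H u) = u. Proof. exact: cdf_upper. Qed.
Let Flt x y : F x < F y -> x < y. Proof. exact: cdf_lt. Qed.
Let Gle t x : t < 1 -> 0 <= x -> t <= F x -> G t <= x. Proof. exact: quantile_le. Qed.
Let leH u x : 0 <= u -> u < 1 -> F x <= u -> x <= H u. Proof. exact: le_upper. Qed.
Let Fs1 : F s1 = 1 / 3. Proof. exact: cdf_s1. Qed.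
Let Fs2 : F s2 = 2 / 3. Proof. exact: (cdf_s2 s12 rho1 rho2). Qed.
Let s10 : 0 <= s1. Proof. exact: s1_ge0 rho1. Qed.

Lemma rho_itv_gt0 x y : 0 <= x -> F x < F y -> (0 < rho `[x, y[%classic)%E.
Proof.
by move=> x0 xy; rewrite (cdf_itv rho x0 (ltW (Flt xy))) lte_fin subr_gt0.
Qed.

(** F is below 1/3 left of a and above it right of b, and likewise at B and d for 2/3. So short
    intervals on those sides have positive mass, their products meet the almost sure condition, and
    continuity of [poly3] carries it to the corners. *)
Lemma well_separated_support :
  well_separated (G (1 / 3)) (H (1 / 3)) (G (2 / 3)) (H (2 / 3)).
Proof.
have t0 : 0 <= 1 / 3 :> R by lra.
have t1 : 1 / 3 < 1 :> R by lra.
have u0 : 0 <= 2 / 3 :> R by lra.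
have u1 : 2 / 3 < 1 :> R by lra.
have Fa := FG t0 t1; have FB := FG u0 u1; have Fb := FH t0 t1; have Fd := FH u0 u1.
have a1 : G (1 / 3) <= s1 by apply: Gle => //; rewrite Fs1.
have b1 : s1 <= H (1 / 3) by apply: leH => //; rewrite Fs1.
have B2 : G (2 / 3) <= s2 by apply: Gle => //; [have := s10; have := s12; lra | rewrite Fs2].
have d2 : s2 <= H (2 / 3) by apply: leH => //; rewrite Fs2.
have bB : H (1 / 3) < G (2 / 3) by apply: Flt; rewrite Fb FB; lra.
have F0 : F 0 = 0 by exact: cdf0.
have a0 : 0 < G (1 / 3) by apply: Flt; rewrite Fa F0; lra.
have s1p := s10.
have lowF x : 0 <= x -> x < G (1 / 3) -> F x < 1 / 3.
  by move=> x0; apply: contraTT; rewrite -!leNgt => h; exact: Gle.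
have midF x : 0 <= x -> x < G (2 / 3) -> F x < 2 / 3.
  by move=> x0; apply: contraTT; rewrite -!leNgt => h; exact: Gle.
have midF' x : H (1 / 3) < x -> 1 / 3 < F x.
  by apply: contraTT; rewrite -!leNgt => h; exact: leH.
have highF x : H (2 / 3) < x -> 2 / 3 < F x.
  by apply: contraTT; rewrite -!leNgt => h; exact: leH.
move: (G (1 / 3)) (H (1 / 3)) (G (2 / 3)) (H (2 / 3)) Fa FB Fb Fd a1 b1 B2 d2 bB a0 lowF midF midF' highF.
move=> a b B d Fa FB Fb Fd a1 b1 B2 d2 bB a0 lowF midF midF' highF.
have p1 (e : R) : 0 < e -> (0 < rho `[(Num.max 0 (a - e))%R, a[%classic)%E.
  move=> e0; apply: rho_itv_gt0; first by rewrite le_max lexx.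
  by rewrite Fa; apply: lowF; [rewrite le_max lexx | rewrite gt_max a0/=; lra].
have p2 (e : R) : 0 < e -> (0 < rho `[b, (Num.min (b + e) B)%R[%classic)%E.
  move=> e0; apply: rho_itv_gt0; first lra.
  by rewrite Fb; apply: midF'; rewrite lt_min bB andbT; lra.
have p2' (e : R) : 0 < e -> (0 < rho `[(Num.max b (B - e))%R, B[%classic)%E.
  move=> e0; apply: rho_itv_gt0; first by rewrite le_max; apply/orP; left; lra.
  rewrite FB; apply: midF; last by rewrite gt_max bB/=; lra.
  by rewrite le_max; apply/orP; left; lra.
have p3 (e : R) : 0 < e -> (0 < rho `[d, (d + e)%R[%classic)%E.
  move=> e0; apply: rho_itv_gt0; first lra.
  by rewrite Fd; apply: highF; lra.
have mI x y : measurable (`[x, y[%classic : set (measurableTypeR R)) by exact: measurable_itv.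
split; [exact: a0|lra|exact: ltW|lra| |].
- rewrite -poly3_collinear; last lra.
  apply: poly3_closed => e e0.
  have [x [y [z [hx hy hz P]]]] := ae_product_meet (mI _ _) (mI _ _) (mI _ _)
    (p1 e e0) (p2 e e0) (p3 e e0) stable.
  exists x, y, z; move: hx hy hz; rewrite /= !in_itv/= ge_max lt_min.
  move=> /andP[/andP[x0 xe] xa] /andP[yb /andP[ye yB]] /andP[zd ze].
  split; [by rewrite ler_distlC xe/= (le_trans (ltW xa))// lerDl ltW|by rewrite ler_distlC (ltW ye) andbT; apply: le_trans yb; rewrite gerBl ltW
    |by rewrite ler_distlC (ltW ze) andbT; apply: le_trans zd; rewrite gerBl ltW|].
  by apply: P; rewrite /= ?x0 ?(le_trans (ltW xa) a1) ?(le_trans b1 yb)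
    ?(le_trans (ltW yB) B2) ?(le_trans d2 zd).
- rewrite -poly3_collinear; last lra.
  apply: poly3_closed => e e0.
  have [x [y [z [hx hy hz P]]]] := ae_product_meet (mI _ _) (mI _ _) (mI _ _)
    (p1 e e0) (p2' e e0) (p3 e e0) stable.
  exists x, y, z; move: hx hy hz; rewrite /= !in_itv/= !ge_max.
  move=> /andP[/andP[x0 xe] xa] /andP[/andP[yb ye] yB] /andP[zd ze].
  split; [by rewrite ler_distlC xe/= (le_trans (ltW xa))// lerDl ltW|by rewrite ler_distlC ye/= (le_trans (ltW yB))// lerDl ltW
    |by rewrite ler_distlC (ltW ze) andbT; apply: le_trans zd; rewrite gerBl ltW|].
  by apply: P; rewrite /= ?x0 ?(le_trans (ltW xa) a1) ?(le_trans b1 yb)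
    ?(le_trans (ltW yB) B2) ?(le_trans d2 zd).
Qed.

Lemma ae_spread :
  {ae rho, forall r, spread (G (1 / 3)) (H (1 / 3)) (G (2 / 3)) (H (2 / 3)) r}.
Proof.
have t0 : 0 <= 1 / 3 :> R by lra.
have t1 : 1 / 3 < 1 :> R by lra.
have u0 : 0 <= 2 / 3 :> R by lra.
have u1 : 2 / 3 < 1 :> R by lra.
have Fa := FG t0 t1; have FB := FG u0 u1; have Fb := FH t0 t1; have Fd := FH u0 u1.
have G0 t : 0 <= G t by exact: quantile_ge0.
have gap1 : {ae rho, forall r, ~ (G (1 / 3) <= r < H (1 / 3))}.
  by apply: ae_not_itv => //; [apply: leH => //; rewrite Fa | rewrite -/F -/H Fb].
have gap2 : {ae rho, forall r, ~ (G (2 / 3) <= r < H (2 / 3))}.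
  by apply: ae_not_itv => //; [apply: leH => //; rewrite FB | rewrite -/F -/H Fd].
apply: filterS2 (filterI (ae_ge0 rho_pos) (ae_not_point rho_ac 0)) (filterI gap1 gap2) => r [r0 rn0] [h1 h2].
have {}r0 : 0 < r by rewrite lt_neqAle eq_sym rn0.
rewrite /spread; apply/or3P.
have [ra|ra] := leP r (G (1 / 3)); first by constructor 1; rewrite r0.
have [rb|rb] := leP (H (1 / 3)) r; last first.
  by exfalso; apply: h1; rewrite (ltW ra).
have [rB|rB] := leP r (G (2 / 3)); first by constructor 2.
constructor 3; rewrite leNgt; apply/negP => rd; apply: h2.
by rewrite (ltW rB).
Qed.

End Separation.

(** * Integration against plans *)

Section NonMeasurable.
Import HBNNSimple.
Context d (T : measurableType d) (R : realType) (mu : {measure set T -> \bar R}).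
Local Open Scope ereal_scope.

(** The integral is a supremum over simple functions below the integrand. This suits the radial
    cost, an infimum over uncountably many angles whose measurability is not established here. *)
Lemma ge0_integral_homo (D : set T) (f g : T -> \bar R) :
  (forall x, D x -> 0 <= f x) -> (forall x, D x -> f x <= g x) ->
  \int[mu]_(x in D) f x <= \int[mu]_(x in D) g x.
Proof.
move=> f0 fg; have g0 x : D x -> 0 <= g x by move=> Dx; exact: le_trans (f0 _ Dx) (fg _ Dx).
rewrite !ge0_integralE//; apply: ereal_sup_le => _ [h hf <-]; exists h => // x.
by apply: le_trans (hf x) _; rewrite !patchE; case: ifPn => // /set_mem /fg.
Qed.

Lemma ge0_integral_ae_le (D : set T) (f g : T -> \bar R) :
  (forall x, D x -> 0 <= f x) -> (forall x, 0 <= g x) -> measurable_fun setT g ->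
  {ae mu, forall x, f x <= g x} -> \int[mu]_(x in D) f x <= \int[mu]_x g x.
Proof.
move=> f0 g0 mg fg; rewrite ge0_integralE//; apply: ge_ereal_sup => _ [h hf <-].
rewrite -integralT_nnsfun; apply: ae_ge0_le_integral => //.
- by move=> x _; rewrite lee_fin.
- exact/measurable_EFinP.
- apply: filterS fg => x fx _; apply: le_trans (hf x) _.
  by rewrite patchE; case: ifPn.
Qed.

End NonMeasurable.

Section Plans.
Variables (R : realType) (rho : probability (measurableTypeR R) R).
Variables (U : R -> R) (M : R).
Hypothesis mU : measurable_fun setT U.
Hypothesis bU : forall r, `|U r| <= M.

Definition pot3 (x : R3 R) : R := U x.1.1 + U x.1.2 + U x.2.

Let p1 (x : R3 R) : measurableTypeR R := x.1.1.
Let p2 (x : R3 R) : measurableTypeR R := x.1.2.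
Let p3 (x : R3 R) : measurableTypeR R := x.2.

Lemma measurable_p1 : measurable_fun setT p1.
Proof. exact: (measurableT_comp measurable_fst measurable_fst). Qed.
Lemma measurable_p2 : measurable_fun setT p2.
Proof. exact: (measurableT_comp measurable_snd measurable_fst). Qed.
Lemma measurable_p3 : measurable_fun setT p3.
Proof. exact: measurable_snd. Qed.

Let mU' : measurable_fun setT (U : measurableTypeR R -> R).
Proof. exact: mU. Qed.

Lemma measurable_pot3 : measurable_fun setT pot3.
Proof.
apply: measurable_funD; first apply: measurable_funD.
- exact: (measurableT_comp mU' measurable_p1).
- exact: (measurableT_comp mU' measurable_p2).
- exact: (measurableT_comp mU' measurable_p3).
Qed.

Lemma bounded_integrable d (T : measurableType d) (P : probability T R) (f : T -> R) (K : R) :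
  measurable_fun setT f -> (forall x, `|f x| <= K) -> P.-integrable setT (EFin \o f).
Proof.
move=> mf bf; apply: measurable_bounded_integrable => //.
  by apply: le_lt_trans (probability_le1 P measurableT) _; exact: ltry.
exists K; split; first exact: num_real.
by move=> y Ky x _ /=; apply: le_trans (bf x) (ltW Ky).
Qed.

Lemma integral_marginal (P : probability (R3 R) R) (p : R3 R -> measurableTypeR R) :
  measurable_fun setT p -> (forall A, measurable A -> P (p @^-1` A) = rho A) ->
  (\int[P]_x (U (p x))%:E = \int[rho]_x (U x)%:E)%E.
Proof.
move=> mp Pp.
have mE : measurable_fun setT (EFin \o (U : measurableTypeR R -> R)) by exact/measurable_EFinP.
transitivity (\int[pushforward P p]_(y in setT) (EFin \o U) y)%E.
  rewrite integral_pushforward//; rewrite preimage_setT.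
  apply: (@bounded_integrable _ _ P (U \o p) M) => [|x]; last exact: bU.
  exact: (measurableT_comp mU' mp).
apply: eq_measure_integral => A mA _; exact: Pp.
Qed.

Lemma integral_pot3 (P : probability (R3 R) R) : Pi3 rho P ->
  (\int[P]_x (pot3 x)%:E = \int[rho]_x (U x)%:E + \int[rho]_x (U x)%:E + \int[rho]_x (U x)%:E)%E.
Proof.
move=> [_ mar].
have i1 := @bounded_integrable _ _ P (U \o p1) M (measurableT_comp mU' measurable_p1) (fun x => bU _).
have i2 := @bounded_integrable _ _ P (U \o p2) M (measurableT_comp mU' measurable_p2) (fun x => bU _).
have i3 := @bounded_integrable _ _ P (U \o p3) M (measurableT_comp mU' measurable_p3) (fun x => bU _).
pose U12 x := U (p1 x) + U (p2 x).
have i12 : P.-integrable setT (EFin \o U12).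
  apply: (@bounded_integrable _ _ P _ (M + M)).
    by apply: measurable_funD; [exact: (measurableT_comp mU' measurable_p1)|exact: (measurableT_comp mU' measurable_p2)].
  by move=> x; apply: le_trans (ler_normD _ _) _; apply: lerD; exact: bU.
transitivity (\int[P]_x ((EFin \o U12) x + (EFin \o (U \o p3)) x))%E.
  by apply: eq_integral => x _; rewrite /= -EFinD.
rewrite integralD_EFin//.
have -> : (\int[P]_x (EFin \o U12) x =
   \int[P]_x (EFin \o (U \o p1)) x + \int[P]_x (EFin \o (U \o p2)) x)%E.
  rewrite -integralD_EFin//.
congr (_ + _ + _)%E.
- by apply: (integral_marginal measurable_p1) => A /mar[].
- by apply: (integral_marginal measurable_p2) => A /mar[].
- by apply: (integral_marginal measurable_p3) => A /mar[].
Qed.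

Lemma ccost3_integral_ge (P : probability (R3 R) R) (S : R -> bool) :
  Pi3 rho P -> measurable [set r : measurableTypeR R | S r] ->
  {ae rho, forall r, S r} -> (forall r, S r -> 0 <= r) ->
  (forall x : R3 R, S x.1.1 -> S x.1.2 -> S x.2 -> ((pot3 x)%:E <= ccost3 x)%E) ->
  (\int[P]_x (pot3 x)%:E <= \int[P]_(x in @Q3 R) ccost3 x)%E.
Proof.
move=> [_ mar] mS aeS S0 H.
pose S3 (x : R3 R) := [&& S (p1 x), S (p2 x) & S (p3 x)].
have mS3 : measurable [set x | S3 x].
  have -> : [set x | S3 x] = (p1 @^-1` [set r | S r]) `&` ((p2 @^-1` [set r | S r]) `&` (p3 @^-1` [set r | S r])).
    apply/seteqP; split => x /=; first by case/and3P.
    by case=> h1 [h2 h3]; apply/and3P.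
  apply: measurableI; [|apply: measurableI]; rewrite -[X in measurable X]setTI.
  - exact: (measurable_p1 measurableT).
  - exact: (measurable_p2 measurableT).
  - exact: (measurable_p3 measurableT).
have nS : rho (~` [set r | S r]) = 0%E.
  apply: measure_negligible; first exact: measurableC.
  by case: aeS => N [mN N0 sub]; exists N; split => //; apply: subset_trans sub.
have aeS3 : {ae P, forall x, S3 x}.
  have ae_p (p : R3 R -> measurableTypeR R) : measurable_fun setT p ->
      (forall A, measurable A -> P (p @^-1` A) = rho A) -> {ae P, forall x, S (p x)}.
    move=> mp Pp; exists (p @^-1` (~` [set r | S r])); split => //.
    - rewrite -[X in measurable X]setTI; apply: (mp measurableT); exact: measurableC.
    - by rewrite Pp//; exact: measurableC.
  have h1 := ae_p _ measurable_p1 (fun A mA => let: And3 h _ _ := mar A mA in h).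
  have h2 := ae_p _ measurable_p2 (fun A mA => let: And3 _ h _ := mar A mA in h).
  have h3 := ae_p _ measurable_p3 (fun A mA => let: And3 _ _ h := mar A mA in h).
  by apply: filterS3 h1 h2 h3 => x q1 q2 q3; apply/and3P.
(* The potential is below the cost only on [S3], a set of full measure. Its positive part, set to
   zero elsewhere, is measurable and below the cost everywhere. *)
pose f : R3 R -> \bar R := (EFin \o pot3)^\+%E.
pose g := (f \_ [set x | S3 x])%E.
have mf : measurable_fun setT f by apply: measurable_funepos; apply/measurable_EFinP; exact: measurable_pot3.
have mg : measurable_fun setT g.
  by apply/(measurable_restrictT f mS3); exact: measurable_funS mf.
have f0 x : (0 <= f x)%E by exact: funepos_ge0.
have g0 x : (0 <= g x)%E by exact: erestrict_ge0.
apply: (@le_trans _ _ (\int[P]_x f x)%E).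
  rewrite integralE -[leRHS]sube0 leeB// integral_ge0// => x _; exact: funeneg_ge0.
have -> : (\int[P]_x f x = \int[P]_x g x)%E.
  apply: ge0_ae_eq_integral => //.
  by apply: filterS aeS3 => x Sx _; rewrite /g patchE mem_set.
have -> : (\int[P]_x g x = \int[P]_(x in @Q3 R) g x)%E.
  rewrite [RHS]integral_mkcond; apply: eq_integral => x _; rewrite [RHS]patchE.
  case: ifPn => // /negP nQ; rewrite /g patchE; case: ifPn => // /set_mem /and3P[q1 q2 q3].
  by exfalso; apply: nQ; apply: mem_set; split; [exact: S0|split; exact: S0].
apply: ge0_integral_homo => // x _.
rewrite /g patchE; case: ifPn => [/set_mem /and3P[q1 q2 q3]|_]; last exact: ccost_ge0.
by rewrite /f funeposE ge_max H//= ccost_ge0.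
Qed.

Lemma ccost3_integral_le (P : probability (R3 R) R) :
  {ae P, forall x, (ccost3 x <= (pot3 x)%:E)%E} ->
  (\int[P]_(x in @Q3 R) ccost3 x <= \int[P]_x (pot3 x)%:E)%E.
Proof.
move=> aeP.
have mE : measurable_fun setT (EFin \o pot3) by apply/measurable_EFinP; exact: measurable_pot3.
pose f : R3 R -> \bar R := (EFin \o pot3)^\+%E.
have mf : measurable_fun setT f by exact: measurable_funepos.
have <- : (\int[P]_x f x = \int[P]_x (pot3 x)%:E)%E.
  apply: ae_eq_integral => //; apply: filterS aeP => x hx _.
  by rewrite /f funeposE; apply/max_idPl; apply: le_trans hx; exact: ccost_ge0.
apply: ge0_integral_ae_le => //.
- by move=> x _; exact: ccost_ge0.
- by move=> x; exact: funepos_ge0.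
- by apply: filterS aeP => x hx; rewrite /f funeposE le_max hx.
Qed.

End Plans.

(** * The DDI plan and its optimality *)

Section Optimality.
Variables (R : realType) (rho : probability (measurableTypeR R) R) (s1 s2 : R).
Hypothesis rho_pos : rho `[0, +oo[%classic = 1%E.
Hypothesis rho_ac : rho `<< (@lebesgue_measure R).
Hypothesis s12 : s1 < s2.
Hypothesis rho1 : rho `[0, s1[%classic = (1 / 3)%:E.
Hypothesis rho2 : rho `[s1, s2[%classic = (1 / 3)%:E.

Let F := Defs.cdf rho.
Let G := Defs.cdf_inv rho.
Let T : measurableTypeR R -> measurableTypeR R := DDI rho s1 s2.

Let mT : measurable_fun setT T.
Proof. exact: (measurable_DDI s2 rho_pos rho_ac rho1). Qed.

Definition ddi_graph (x : measurableTypeR R) : R3 R := ((x, T x), T (T x)).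

Lemma measurable_ddi_graph : measurable_fun setT ddi_graph.
Proof.
apply: measurable_fun_pair; last exact: (measurableT_comp mT mT).
by apply: measurable_fun_pair => //; exact: measurable_id.
Qed.

Definition ddi_graph_mfun : {mfun (measurableTypeR R) >-> (R3 R)} :=
  HB.pack ddi_graph (isMeasurableFun.Build _ _ _ _ _ measurable_ddi_graph).

Definition ddi_probability : probability (R3 R) R := distribution rho ddi_graph_mfun.

Lemma ddi_plan_Pi3 : Pi3 rho (ddi_plan rho s1 s2).
Proof.
split; first by exists ddi_probability.
move=> A mA.
have TA : rho (T @^-1` A) = rho A by exact: DDI_preserves.
have mTA : measurable (T @^-1` A) by rewrite -[X in measurable X]setTI; exact: (mT measurableT).
split => //.
transitivity (rho (T @^-1` (T @^-1` A))) => //.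
by rewrite -[RHS]TA; exact: DDI_preserves.
Qed.

Definition ddi_fiber (x y z : R) : Prop :=
  exists2 t, 0 < t < 1 / 3 & [/\ x = G t, y = G (2 / 3 - t) & z = G (2 / 3 + t)].

Let FG u : 0 <= u -> u < 1 -> F (G u) = u. Proof. exact: cdf_quantile. Qed.
Let Flt x y : F x < F y -> x < y. Proof. exact: cdf_lt. Qed.
Let F0 : F 0 = 0. Proof. exact: cdf0. Qed.

Lemma ddi_fiber_cost x y z : ddi_fiber x y z ->
  [/\ 0 < x & (ccost x y z <= ((x + y)^-1 + (z - x)^-1 + (y + z)^-1)%:E)%E].
Proof.
move=> [t /andP[t0 t1] [-> -> ->]].
have x0 : 0 < G t by apply: Flt; rewrite F0 FG; lra.
have y0 : 0 < G (2 / 3 - t) by apply: Flt; rewrite F0 FG; lra.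
split => //; apply: ccost_le_collinear => //.
by apply: Flt; rewrite !FG; lra.
Qed.

Lemma ae_ddi_cost (U : R -> R) :
  (forall x y z, ddi_fiber x y z -> 0 < x ->
     U x + U y + U z = (x + y)^-1 + (z - x)^-1 + (y + z)^-1) ->
  {ae ddi_probability, forall x, (ccost3 x <= (pot3 U x)%:E)%E}.
Proof.
move=> UE.
have good : {ae rho, forall x, (ccost3 (ddi_graph x) <= (pot3 U (ddi_graph x))%:E)%E}.
  have t0 : 0 <= 1 / 3 :> R by lra.
  have t1 : 1 / 3 < 1 :> R by lra.
  have u0 : 0 <= 2 / 3 :> R by lra.
  have u1 : 2 / 3 < 1 :> R by lra.
  have h0 := ae_level rho_pos rho_ac (lexx 0) ltr01.
  have h1 := ae_level rho_pos rho_ac t0 t1.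
  have h2 := ae_level rho_pos rho_ac u0 u1.
  apply: filterS3 (filterI h0 h1) (filterI h2 (ae_lt1 rho_pos rho_ac)) (ae_quantile_cdf rho_pos rho_ac) => x [x0 x1] [x2 x3] x4.
  have f0 : 0 < F x by rewrite lt_neqAle eq_sym x0; exact: cdf_ge0.
  have [t tt [[e1 e2 e3]|[e1 e2 e3]|[e1 e2 e3]]] := DDI_triple rho_pos rho_ac s12 rho1 rho2 f0 x3 x1 x2 x4.
  - have fib : ddi_fiber x (T x) (T (T x)) by exists t.
    have [p0 c] := ddi_fiber_cost fib.
    by rewrite /ccost3 /pot3 /= (UE _ _ _ fib p0).
  - have fib : ddi_fiber (T (T x)) x (T x) by exists t.
    have [p0 c] := ddi_fiber_cost fib.
    rewrite /ccost3 /pot3 /=.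
    rewrite [U x + _ + _]addrC addrA (UE _ _ _ fib p0); apply: le_trans c.
    by apply: le_trans (ccost_swap23 _ _ _) (ccost_swap12 _ _ _).
  - have fib : ddi_fiber (T x) (T (T x)) x by exists t.
    have [p0 c] := ddi_fiber_cost fib.
    rewrite /ccost3 /pot3 /=.
    rewrite -addrA [U x + _]addrC (UE _ _ _ fib p0); apply: le_trans c.
    by apply: le_trans (ccost_swap12 _ _ _) (ccost_swap23 _ _ _).
case: good => N [mN N0 sub].
(* The exceptional set needs a measurable null cover in three variables. The complement of [D], the
   part of the graph over the complement of N, is one, since its preimage under the graph map is
   N. *)
pose D := [set p : R3 R | (p.1.2 == T p.1.1) && (p.2 == T (T p.1.1))] `&`
  ((fun p : R3 R => p.1.1 : measurableTypeR R) @^-1` (~` N)).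
have mp1 : measurable_fun setT (fun p : R3 R => p.1.1 : measurableTypeR R) by exact: measurable_p1.
have mp2 : measurable_fun setT (fun p : R3 R => p.1.2 : measurableTypeR R) by exact: measurable_p2.
have mp3 : measurable_fun setT (fun p : R3 R => p.2 : measurableTypeR R) by exact: measurable_p3.
have mD : measurable D.
  apply: measurableI; last first.
    by rewrite -[X in measurable X]setTI; apply: (mp1 measurableT); exact: measurableC.
  have -> : [set p : R3 R | (p.1.2 == T p.1.1) && (p.2 == T (T p.1.1))] =
     ((fun p : R3 R => p.1.2 == T p.1.1) @^-1` [set true]) `&`
     ((fun p : R3 R => p.2 == T (T p.1.1)) @^-1` [set true]).
    by apply/seteqP; split => p /=; [case/andP|case=> -> ->].
  apply: measurableI; rewrite -[X in measurable X]setTI.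
    have m : measurable_fun setT (fun p : R3 R => p.1.2 == T p.1.1).
      by apply: (@measurable_fun_eqr _ _ R) => //; exact: (measurableT_comp mT mp1).
    exact: (m measurableT).
  have m : measurable_fun setT (fun p : R3 R => p.2 == T (T p.1.1)).
    by apply: (@measurable_fun_eqr _ _ R) => //; exact: (measurableT_comp mT (measurableT_comp mT mp1)).
  exact: (m measurableT).
exists (~` D); split; first exact: measurableC.
  transitivity (rho N) => //; congr (rho _); apply/seteqP; split => x; rewrite /D /= /preimage /= => h.
    by apply: contrapT => nx; apply: h; rewrite !eqxx.
  by case=> _; apply.
move=> [[x y] z] h [/= /andP[/eqP e1 /eqP e2] nN]; apply: nN; apply: sub => h'; apply: h.
by rewrite e1 e2; exact: h'.
Qed.

End Optimality.

Theorem theorem1p2 (R : realType) (rho : probability (measurableTypeR R) R)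
    (s1 s2 : R) :
  rho `[0, +oo[%classic = 1%E ->
  rho `<< (@lebesgue_measure R) ->
  s1 < s2 ->
  rho `[0, s1[%classic = (1 / 3)%:E ->
  rho `[s1, s2[%classic = (1 / 3)%:E ->
  rho `[s2, +oo[%classic = (1 / 3)%:E ->
  {ae ((rho \x rho) \x rho)%E, forall x : R3 R,
     (0 <= x.1.1 <= s1) && (s1 <= x.1.2 <= s2) && (s2 <= x.2) ->
     0 <= poly3 x.1.1 x.1.2 x.2} ->
  Pi3 rho (ddi_plan rho s1 s2) /\
  forall g : set (R3 R) -> \bar R, Pi3 rho g ->
    (\int[ddi_plan rho s1 s2]_(x in @Q3 R) ccost3 x <=
     \int[g]_(x in @Q3 R) ccost3 x)%E.
Proof.
move=> rho_pos rho_ac s12 rho1 rho2 _ stable.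
have pi : Pi3 rho (ddi_plan rho s1 s2) by exact: ddi_plan_Pi3.
split => // g gPi; have [[P Pg] _] := gPi.
have gE : g = P by apply/funext => A; rewrite Pg.
rewrite gE in gPi *; clear Pg gE g.
pose Q := @ddi_probability R rho s1 s2 rho_pos rho_ac rho1.
have QPi : Pi3 rho Q by exact: pi.
rewrite -[X in (X <= _)%E]/(\int[Q]_(x in @Q3 R) ccost3 x)%E.
have W := well_separated_support rho_pos rho_ac s12 rho1 rho2 stable.
set a := cdf_inv rho (1 / 3) in W; set b := upper_quantile rho (1 / 3) in W.
set B := cdf_inv rho (2 / 3) in W; set d := upper_quantile rho (2 / 3) in W.
have G0 t : 0 <= cdf_inv rho t by exact: quantile_ge0.
have Gh s t : s <= t -> t < 1 -> cdf_inv rho s <= cdf_inv rho t by exact: quantile_homo.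
have GF u : 0 <= u -> u < 1 -> Defs.cdf rho (cdf_inv rho u) = u by exact: cdf_quantile.
have Glt s t : s < 1 -> cdf_inv rho s < cdf_inv rho t -> s < t.
  by move=> s1'; apply: contraTT; rewrite -!leNgt => ts; exact: Gh.
have HG u t : 0 <= u -> u < t -> t < 1 -> upper_quantile rho u <= cdf_inv rho t.
  move=> u0 ut t1; have u1 : u < 1 by lra.
  by apply/ltW/(@cdf_lt _ rho); rewrite cdf_upper// GF//; lra.
have [U [mU [M bU] le eqU]] : exists U : R -> R,
    [/\ measurable_fun setT U, exists M, forall r, `|U r| <= M,
    forall r1 r2 r3, spread a b B d r1 -> spread a b B d r2 -> spread a b B d r3 ->
      ((U r1 + U r2 + U r3)%:E <= ccost r1 r2 r3)%E &
    forall x y z, ddi_fiber rho x y z -> 0 < x ->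
      U x + U y + U z = (x + y)^-1 + (z - x)^-1 + (y + z)^-1].
  apply: exists_dual_potential => //.
  - move=> x y z [t /andP[t0 t1] [-> -> ->]]; split.
    + by rewrite G0 Gh//; lra.
    + by rewrite HG ?Gh//; lra.
    + by apply: HG; lra.
  - move=> x y z x' y' z' [t /andP[t0 t1] [-> -> ->]] [t' /andP[t0' t1'] [-> -> ->]] h.
    have tt' : t < t' by apply: Glt h; lra.
    by split; apply: Gh; lra.
  - move=> x y z x' y' z' [t /andP[t0 t1] [_ -> ->]] [t' /andP[t0' t1'] [_ -> ->]] h.
    have tt' : 2 / 3 - t < 2 / 3 - t' by apply: Glt h; lra.
    by apply: Gh; lra.
apply: (@le_trans _ _ (\int[Q]_x (pot3 U x)%:E)%E).
  by apply: ccost3_integral_le => //; exact: ae_ddi_cost.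
(* The integral of the potential depends only on the marginals, which links the two plans. *)
rewrite (integral_pot3 mU bU QPi) -(integral_pot3 mU bU gPi).
have [ws1 ws2 _ ws3 _ _] := W.
apply: (@ccost3_integral_ge _ rho U mU P (spread a b B d)) => //.
- have -> : [set r : measurableTypeR R | spread a b B d r] =
    `]0, a]%classic `|` (`[b, B]%classic `|` `[d, +oo[%classic).
    apply/seteqP; split => r; rewrite /spread /= !in_itv/= andbT.
      by case/or3P => h; [left|right; left|right; right].
    by case=> [->//|[->|->]]; rewrite ?orbT.
  by apply: measurableU; [|apply: measurableU]; exact: measurable_itv.
- exact: (ae_spread rho_pos rho_ac).
- move=> r /or3P[/andP[/ltW]//|/andP[h _]|h]; last by have := ws_bB W; lra.
  by apply: le_trans h; exact: ltW.
- by move=> x h1 h2 h3; exact: le.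
Qed.
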